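(* There exists a function $\varphi:\mathbb N\times\mathbb N\to\mathbb R$ with the following property. For any rational functions $A$ and $X$ such that the equality $$A^{\circ d}=X\circ R$$ holds for some rational function $R$ and some integer $d\ge1$, there exist a natural number $N\le\varphi(\deg A,\deg X)$ and a rational function $R'$ such that $$A^{\circ N}=X\circ R'$$ and $R=R'\circ A^{\circ(d-N)}$ if $d>N$. In particular, for any fixed rational function $A$ and integer $n\ge1$, up to the change $X\to X\circ\mu$, where $\mu$ is a Möbius transformation, there exist at most finitely many rational functions $X$ of degree $n$ such that $A^{\circ d}=X\circ R$ holds for some rational function $R$ and some $d\ge1$.
   Context: ''Rational function'' means a nonconstant element of $\mathbb C(z)$, viewed as a map $\mathbb P^1(\mathbb C)\to\mathbb P^1(\mathbb C)$; $A^{\circ d}$ is the $d$-th iterate of $A$ under composition. *)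

(* Defs.v *)
From HB Require Import structures.
From mathcomp Require Import all_boot all_order all_algebra.

Set Implicit Arguments.
Unset Strict Implicit.
Unset Printing Implicit Defensive.

Import GRing.Theory.
Local Open Scope ring_scope.

Notation "x %:F" := (@tofrac _ x) : ring_scope.

Section RationalFunctions.

Variable K : closedFieldType.

Local Notation ratK := {fraction {poly K}}.

Definition is_ratfun (f : ratK) : Prop := forall c : K, f <> (c%:P)%:F.

Definition ratvar : ratK := 'X%:F.

(* The pair (ratnum f, ratden f) need not be in lowest terms. *)
Definition ratnum (f : ratK) : {poly K} := \n_(repr f).
Definition ratden (f : ratK) : {poly K} := \d_(repr f).

Definition ratdeg (f : ratK) : nat :=
  let g := gcdp (ratnum f) (ratden f) in
  (maxn (size (ratnum f %/ g)) (size (ratden f %/ g))).-1.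

Definition ratsubst (p : {poly K}) (g : ratK) : ratK :=
  (map_poly (@tofrac {poly K} \o polyC) p).[g].

(* f o g.  For nonconstant g the denominator is nonzero (ratsubst_neq0) and the
   value does not depend on the fraction p / q chosen for f (ratcompE). *)
Definition ratcomp (f g : ratK) : ratK :=
  ratsubst (ratnum f) g / ratsubst (ratden f) g.

Definition ratiter (f : ratK) (d : nat) : ratK := iter d (ratcomp f) ratvar.

Definition is_moebius (f : ratK) : Prop := is_ratfun f /\ ratdeg f = 1%N.

Lemma ratden_neq0 f : ratden f != 0.
Proof. exact: denom_ratioP. Qed.

Lemma ratnumden f : f = (ratnum f)%:F / (ratden f)%:F.
Proof.
have d0 := ratden_neq0 f.
apply: (canRL (mulfK _)); first by rewrite tofrac_eq0.
rewrite -[f in LHS]reprK; unlock tofrac.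
rewrite -[LHS]FracField.pi_mul; apply/eqP; rewrite FracField.equivf_def /=.
rewrite /FracField.mulf reprK.
by rewrite !numden_Ratio ?oner_eq0 ?mulr1 ?denom_ratioP ?ratden_neq0 // mulrC.
Qed.

Lemma ratnumden_cross p q :
  q != 0 -> p * ratden (p%:F / q%:F) = ratnum (p%:F / q%:F) * q.
Proof.
move=> q0; apply/eqP; rewrite -tofrac_eq !tofracM; apply/eqP.
set f := _ / q%:F.
have qF : q%:F != 0 by rewrite tofrac_eq0.
have dF : (ratden f)%:F != 0 by rewrite tofrac_eq0 ratden_neq0.
have E := ratnumden f; rewrite {1}/f in E.
by apply/eqP; rewrite -(eqr_div _ _ qF dF) E.
Qed.

Lemma ratsubst_neq0 q g : is_ratfun g -> q != 0 -> ratsubst q g != 0.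
Proof.
move=> gR q0; have [r Eq] := closed_field_poly_normal q.
rewrite /ratsubst Eq map_polyZ hornerZ mulf_neq0 //=.
  by rewrite tofrac_eq0 polyC_eq0 lead_coef_eq0.
rewrite rmorph_prod horner_prod prodf_seq_neq0; apply/allP=> c _ /=.
rewrite rmorphB /= map_polyX map_polyC hornerXsubC /= subr_eq0.
by apply/eqP/gR.
Qed.

Lemma ratcompE p q g : is_ratfun g -> q != 0 ->
  ratcomp (p%:F / q%:F) g = ratsubst p g / ratsubst q g.
Proof.
move=> gR q0; apply/eqP; rewrite eqr_div ?ratsubst_neq0 ?ratden_neq0 //.
by rewrite /ratsubst -!hornerM -!rmorphM /= ratnumden_cross.
Qed.

Lemma ratdegE p q : coprimep p q -> q != 0 ->
  ratdeg (p%:F / q%:F) = (maxn (size p) (size q)).-1.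
Proof.
move=> cpq q0; rewrite /ratdeg; set f := _ / _.
have := ratnumden_cross p q0; rewrite -/f.
have d0 := ratden_neq0 f; set n := ratnum f; set d := ratden f in d0 *.
have g0 : gcdp n d != 0 by rewrite gcdp_eq0 (negPf d0) andbF.
have cnd : coprimep (n %/ gcdp n d) (d %/ gcdp n d).
  by rewrite coprimep_div_gcd // d0 orbT.
rewrite -{1}(divpK (dvdp_gcdl n d)) -{1}(divpK (dvdp_gcdr n d)).
move: cnd; set n' := n %/ _; set d' := d %/ _ => cnd.
rewrite mulrA [n' * _ * q]mulrAC => /(mulIf g0) E.
have qd : q %| d' by rewrite -(Gauss_dvdpr _ (_ : coprimep q p)) 1?coprimep_sym // E dvdp_mull.
have dq : d' %| q by rewrite -(Gauss_dvdpr _ (_ : coprimep d' n')) 1?coprimep_sym // -E dvdp_mull.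
have pn : p %| n' by rewrite -(Gauss_dvdpl _ cpq) -E dvdp_mulr.
have np : n' %| p by rewrite -(Gauss_dvdpl _ cnd) E dvdp_mulr.
have /eqp_size -> : n' %= p by rewrite /eqp np pn.
by have /eqp_size -> : d' %= q by rewrite /eqp dq qd.
Qed.

End RationalFunctions.

(* Main.v *)
Require Import Defs.
From HB Require Import structures.
From mathcomp Require Import all_boot all_order all_algebra.
From mathcomp Require Import ring zify mpoly boolp.
From mathcomp Require Import reals.
From mathcomp.real_closed Require Import complex.

Set Implicit Arguments.
Unset Strict Implicit.
Unset Printing Implicit Defensive.

Import Order.TTheory GRing.Theory Num.Theory.
Local Open Scope ring_scope.

(* Given A^d = X o R, let stage k be the decomposition A^(d-k) = X_k o R_k in which R_k
   generates the compositum of K(R) and K(A^(d-k)); it exists by Luroth's theorem, X_0 = X and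
   deg X_d = 1. For k <= l there is a square X_k o C = A^(l-k) o X_l with K(X_l, C) = K(z), so
   the degrees of the X_k are nonincreasing. As soon as deg X_N = 1, the square from 0 to N
   yields R' and R = R' o A^(d-N), so it suffices to bound the length of a run of stages on
   which the degree has a constant value m > 1.
   On such a run, (1) X_i and X_j are inequivalent under precomposition by Moebius maps for
   i < j, since otherwise the later drop of degree would be contradicted by a square with the
   same X that does not drop; and (2) X_i o C = A^(2m) o X_l with deg X_l = deg X_i = m, which
   forces every critical value v of X_i to be a critical value of A^(2m): otherwise v has at
   least 2m + 2 preimages under A^(2m), and each of them would be a critical value of X_l, which
   has at most 2m - 2 of them.
   Finally, the rational functions of degree m whose critical values lie in a given finite set
   T, considered up to precomposition, are finitely many, with a bound depending only on m and
   #T. Normalizing to kill the Moebius group, they become zeros of polynomial systems of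
   bounded size and degree in the points of the fibres over T, one system for each pattern of
   coincidences among these points; such a zero is infinitesimally rigid, and a
   polynomial system has boundedly many nondegenerate zeros. *)

(** The bound may depend on A only through deg A, so at the end it is not enough that the functions
    with given critical values are finitely many: the count must ignore the position of T. This is
    why rigidity is proved infinitesimally and combined with a Bezout-type bound, which sees only
    the number of equations, their degree and the number of variables. Curves are replaced by
    subfields of K(z). In a square X o B = C o Y with K(Y, B) = K(z), the function B has degree deg
    Y over K(Y) and is a root of X(T) - C(Y), of degree deg X. Equality of the two degrees says that
    X(T) - C is irreducible, that is, that the fibre product of X and C is irreducible. This depends
    on X and C alone, whence (1); and it makes z -> (Y, B) onto the fibre product, which is what (2)
    uses. The final finiteness statement comes from the bound on N: every X in question is a left
    factor of one and the same iterate A^M, so its critical values are among those of A^M and the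
    same count applies. *)

Lemma addf_div_N1 (F : fieldType) (p1 q1 p2 q2 : F) : q1 != 0 -> q2 != 0 ->
  p1 / q1 - p2 / q2 = (p1 * q2 + (-1) * p2 * q1) / (q1 * q2).
Proof. by move=> ? ?; field; apply/andP. Qed.

Lemma linfrac_cancel (F : fieldType) (a b c d x : F) : a * d - b * c != 0 -> c * x + d != 0 ->
  (d * ((a * x + b) / (c * x + d)) - b) / (- c * ((a * x + b) / (c * x + d)) + a) = x.
Proof.
move=> D q0; field; rewrite q0 ?andbT /=.
by have -> : - c * (a * x + b) + a * (c * x + d) = a * d - b * c by ring.
Qed.

(** * Composition of rational functions and its degree *)

Section Composition.

Variable K : numClosedFieldType.
Local Notation ratK := {fraction {poly K}}.
Implicit Types (f g h : ratK) (p q : {poly K}).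

Local Notation const c := (@tofrac {poly K} (polyC c)).

Lemma ratfunP f : is_ratfun f <-> ~ exists c : K, f = const c.
Proof. by split=> [H [c /H]|H c E]; last by apply: H; exists c. Qed.

Lemma constP f : ~ is_ratfun f -> exists c : K, f = const c.
Proof. by move=> H; apply: contrapT => /ratfunP. Qed.

Lemma ratsubstM g : {morph (fun p => ratsubst p g) : p q / p * q}.
Proof. by move=> p q; rewrite /ratsubst rmorphM hornerM. Qed.
Lemma ratsubstD g : {morph (fun p => ratsubst p g) : p q / p + q}.
Proof. by move=> p q; rewrite /ratsubst rmorphD hornerD. Qed.
Lemma ratsubstC g c : ratsubst c%:P g = const c.
Proof. by rewrite /ratsubst map_polyC hornerC. Qed.
Lemma ratsubstX g : ratsubst 'X g = g.
Proof. by rewrite /ratsubst map_polyX hornerX. Qed.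

Lemma ratfracP f : exists p q, [/\ coprimep p q, q != 0 & f = p%:F / q%:F].
Proof.
have E := ratnumden f; have d0 := ratden_neq0 f.
set n := ratnum f in E; set d := ratden f in E d0.
have g0 : gcdp n d != 0 by rewrite gcdp_eq0 (negPf d0) andbF.
exists (n %/ gcdp n d), (d %/ gcdp n d); split.
- by rewrite coprimep_div_gcd // d0 orbT.
- by rewrite dvdp_div_eq0 // dvdp_gcdr.
rewrite E; apply/eqP; rewrite eqr_div ?tofrac_eq0 ?dvdp_div_eq0 ?dvdp_gcdr //.
rewrite -!tofracM -[n in X in (X * _)%:F](divpK (dvdp_gcdl n d)).
by rewrite -[d in X in _ == (_ * X)%:F](divpK (dvdp_gcdr n d)) mulrAC mulrA.
Qed.

Lemma ratfun_var : is_ratfun (ratvar K).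
Proof.
move=> c /eqP; rewrite tofrac_eq => /eqP /(congr1 (fun p : {poly K} => size p)).
by rewrite size_polyX size_polyC; case: (c != 0).
Qed.

Section CompMorphism.
Variables (g : ratK) (gR : is_ratfun g).

Lemma ratcompF p : ratcomp p%:F g = ratsubst p g.
Proof.
have := ratcompE p gR (oner_neq0 _).
by rewrite tofrac1 divr1 => ->; rewrite -[1]/(1%:P) ratsubstC tofrac1 divr1.
Qed.

(** The proof that [g] is nonconstant is an argument because f |-> f o g is a field morphism only
    then; its image is the subfield K(g) of K(z). *)
Definition comp_right of is_ratfun g := fun f : ratK => ratcomp f g.
Local Notation cr := (comp_right gR).

Lemma comp_right_additive : zmod_morphism cr.
Proof.
move=> f1 f2; have [p1 [q1 [_ q10 ->]]] := ratfracP f1.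
have [p2 [q2 [_ q20 ->]]] := ratfracP f2.
rewrite /comp_right.
have Q1 : q1%:F != 0 :> ratK by rewrite tofrac_eq0.
have Q2 : q2%:F != 0 :> ratK by rewrite tofrac_eq0.
have -> : p1%:F / q1%:F - p2%:F / q2%:F = (p1 * q2 + (-1)%:P * p2 * q1)%:F / (q1 * q2)%:F :> ratK.
  rewrite (addf_div_N1 _ _ Q1 Q2) tofracD !tofracM polyCN tofracN tofrac1.
  reflexivity.
rewrite !ratcompE ?mulf_neq0 // ratsubstD !ratsubstM ratsubstC.
rewrite polyCN tofracN tofrac1.
by rewrite -(addf_div_N1 _ _ (ratsubst_neq0 gR q10) (ratsubst_neq0 gR q20)).
Qed.

Lemma comp_right_multiplicative : monoid_morphism cr.
Proof.
split; first by rewrite /comp_right -[1]/(1%:F) ratcompF -[1]/(1%:P) ratsubstC.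
move=> f1 f2; have [p1 [q1 [_ q10 ->]]] := ratfracP f1.
have [p2 [q2 [_ q20 ->]]] := ratfracP f2.
rewrite /comp_right mulf_div -!tofracM.
by rewrite !ratcompE ?mulf_neq0 // !ratsubstM mulf_div.
Qed.

HB.instance Definition _ := GRing.isZmodMorphism.Build ratK ratK cr comp_right_additive.
HB.instance Definition _ := GRing.isMonoidMorphism.Build ratK ratK cr comp_right_multiplicative.

Lemma ratcompC c : ratcomp (const c) g = const c.
Proof. by rewrite ratcompF ratsubstC. Qed.
Lemma ratcomp_varl : ratcomp (ratvar K) g = g.
Proof. by rewrite ratcompF ratsubstX. Qed.
Lemma ratcompD f1 f2 : ratcomp (f1 + f2) g = ratcomp f1 g + ratcomp f2 g.
Proof. exact: (rmorphD cr). Qed.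
Lemma ratcompB f1 f2 : ratcomp (f1 - f2) g = ratcomp f1 g - ratcomp f2 g.
Proof. exact: (rmorphB cr). Qed.
Lemma ratcompM f1 f2 : ratcomp (f1 * f2) g = ratcomp f1 g * ratcomp f2 g.
Proof. exact: (rmorphM cr). Qed.
Lemma ratcompV f : ratcomp f^-1 g = (ratcomp f g)^-1.
Proof. exact: (fmorphV cr). Qed.
Lemma ratcompX f n : ratcomp (f ^+ n) g = ratcomp f g ^+ n.
Proof. exact: (rmorphXn cr). Qed.
Lemma ratcomp_inj : injective (fun f : ratK => ratcomp f g).
Proof. exact: (fmorph_inj cr). Qed.
End CompMorphism.

Lemma ratfun_comp f g : is_ratfun f -> is_ratfun g -> is_ratfun (ratcomp f g).
Proof. by move=> fR gR c; rewrite -(ratcompC gR) => /(ratcomp_inj gR) /fR. Qed.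

(* A field morphism out of K(z) fixing the constants is determined by the image of z. *)
Lemma ratfrac_rmorph_eq (L : fieldType) (u v : {rmorphism ratK -> L}) :
  (forall c, u (const c) = v (const c)) -> u (ratvar K) = v (ratvar K) -> u =1 v.
Proof.
move=> uvC uvX; have uX : u 'X%:F = v 'X%:F := uvX.
have uvF p : u p%:F = v p%:F.
  elim/poly_ind: p => [|p c IH]; first by rewrite tofrac0 !rmorph0.
  by rewrite tofracD tofracM !rmorphD !rmorphM /= IH uvC uX.
move=> f; have [p [q [_ q0 ->]]] := ratfracP f.
by rewrite !rmorphM !fmorphV !uvF.
Qed.

Lemma ratcompA f g h : is_ratfun g -> is_ratfun h ->
  ratcomp f (ratcomp g h) = ratcomp (ratcomp f g) h.
Proof.
move=> gR hR; have ghR := ratfun_comp gR hR.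
apply: (ratfrac_rmorph_eq (u := comp_right ghR) (v := comp_right hR \o comp_right gR)) => [c|] /=.
  by rewrite /comp_right !ratcompC.
by rewrite /comp_right !ratcomp_varl.
Qed.

Lemma ratcomp_varr f : ratcomp f (ratvar K) = f.
Proof.
apply: (ratfrac_rmorph_eq (u := comp_right ratfun_var) (v := idfun)) => [c|] /=.
  exact: (ratcompC ratfun_var).
exact: (ratcomp_varl ratfun_var).
Qed.

Lemma ratfun_iter f d : is_ratfun f -> is_ratfun (ratiter f d).
Proof. by move=> fR; elim: d => [|d IH]; [exact: ratfun_var | exact: ratfun_comp]. Qed.

Lemma ratiterD f d e : is_ratfun f ->
  ratiter f (d + e) = ratcomp (ratiter f d) (ratiter f e).
Proof.
move=> fR; elim: d => [|d IH]; first by rewrite add0n ratcomp_varl //; exact: ratfun_iter.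
by rewrite addSn /= -/(ratiter f (d + e)) IH ratcompA //; exact: ratfun_iter.
Qed.

Lemma ratfun_deg f : is_ratfun f <-> (0 < ratdeg f)%N.
Proof.
have [p [q [cpq q0 ->]]] := ratfracP f.
have qF : q%:F != 0 :> ratK by rewrite tofrac_eq0.
rewrite ratdegE // -subn1 subn_gt0; split=> [fR|s1 c /(canRL (mulfVK qF)) /eqP].
  rewrite ltnNge; apply/negP; rewrite geq_max => /andP [/size1_polyC Ep /size1_polyC Eq].
  have q00 : const q`_0 != 0 by rewrite -Eq.
  apply: (fR (p`_0 / q`_0)); rewrite {1}Ep {1}Eq; apply: (canLR (mulfK q00)).
  by rewrite -tofracM -polyCM divfK // -polyC_eq0 -Eq.
rewrite -tofracM tofrac_eq => /eqP E.
have sq : size q = 1%N.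
  apply/eqP; rewrite size_poly_eq1; apply: (coprimepP _ _ cpq); last exact: dvdpp.
  by rewrite E dvdp_mull.
move: s1; rewrite E sq; case: (eqVneq c 0) => [->|c0]; first by rewrite mul0r size_poly0.
by rewrite size_Cmul // sq.
Qed.

Lemma ratdegS f p q : coprimep p q -> q != 0 -> f = p%:F / q%:F ->
  (maxn (size p) (size q)) = (ratdeg f).+1.
Proof.
move=> cpq q0 ->; rewrite ratdegE // prednK // leq_max !lt0n !size_poly_eq0.
by rewrite q0 orbT.
Qed.

(* Value at [x : y] of the degree m homogenization of P. *)
Definition hhorner (R : comNzRingType) m (P : {poly R}) (x y : R) : R :=
  \sum_(k < m.+1) P`_k * x ^+ k * y ^+ (m - k).

Lemma hhornerE (F : fieldType) m (P : {poly F}) x y : (size P <= m.+1)%N -> y != 0 ->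
  hhorner m P x y = y ^+ m * P.[x / y].
Proof.
move=> sP y0; rewrite (horner_coef_wide _ sP) mulr_sumr; apply: eq_bigr => k _.
have km : (k <= m)%N by rewrite -ltnS.
have -> : y ^+ m = y ^+ (m - k) * y ^+ k by rewrite -exprD subnK.
by rewrite expr_div_n; field; rewrite expf_neq0.
Qed.

Lemma hhorner0 (F : fieldType) m (P : {poly F}) x : hhorner m P x 0 = P`_m * x ^+ m.
Proof.
rewrite /hhorner big_ord_recr /= subnn mulr1 big1 ?add0r // => k _.
by rewrite expr0n subn_eq0 leqNgt ltn_ord /= mulr0.
Qed.

(** For y != 0 a common zero would be a common root x / y; at infinity the values are, up to a power
    of x, the coefficients of degree m, one of which is a leading coefficient. *)
Lemma hhorner_coprime p q m x y : coprimep p q ->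
  maxn (size p) (size q) = m.+1 -> (x != 0) || (y != 0) ->
  (hhorner m p x y != 0) || (hhorner m q x y != 0).
Proof.
move=> cpq sm; have sp : (size p <= m.+1)%N by rewrite -sm leq_maxl.
have sq : (size q <= m.+1)%N by rewrite -sm leq_maxr.
have [-> | y0 _] := eqVneq y 0; last first.
  rewrite !hhornerE // !mulf_eq0 !expf_eq0 (negPf y0) !andbF /= -negb_and; apply/negP => /andP [rp rq].
  by move/coprimep_root: cpq => /(_ (x / y)); rewrite /root => /(_ rp); rewrite rq.
rewrite orbF => x0; rewrite !hhorner0 !mulf_eq0 !expf_eq0 (negPf x0) !andbF !orbF.
rewrite -negb_and; apply/negP => /andP [/eqP pm /eqP qm].
have H (r : {poly K}) : (size r <= m.+1)%N -> r`_m = 0 -> (size r <= m)%N.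
  move=> sr rm; apply/leq_sizeP => j; rewrite leq_eqVlt => /predU1P [<- //|mj].
  by apply: (leq_sizeP _ _ sr).
by move: sm; apply/eqP; rewrite ltn_eqF // ltnS geq_max !H.
Qed.

Lemma coefM_top (R : nzRingType) (p q : {poly R}) i j :
  (size p <= i.+1)%N -> (size q <= j.+1)%N -> (p * q)`_(i + j) = p`_i * q`_j.
Proof.
move=> sp sq; rewrite coefM.
have ii : (i < (i + j).+1)%N by rewrite ltnS leq_addr.
rewrite (bigD1 (Ordinal ii)) //= addKn big1 ?addr0 // => k /eqP kE.
have [ki|ki|ki] := ltngtP k i; last by case: kE; apply: val_inj.
- rewrite (leq_sizeP _ _ sq) ?mulr0 //; lia.
- by rewrite (leq_sizeP _ _ sp) ?mul0r.
Qed.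

Lemma coefX_top (R : nzRingType) (p : {poly R}) i n :
  (size p <= i.+1)%N -> (size (p ^+ n) <= (n * i).+1)%N /\ (p ^+ n)`_(n * i) = p`_i ^+ n.
Proof.
move=> sp; elim: n => [|n [IHs IH]].
  by rewrite !expr0 size_poly1 coef1.
rewrite !exprS mulSn; split; last by rewrite coefM_top // IH.
by apply: leq_trans (size_polyMleq _ _) _; lia.
Qed.

(** Homogenizing, f o g = H(p) / H(q) with H(P) = b^m P(a / b) for g = a / b. No cancellation
    occurs, since a and b have no common zero and neither have the forms of p and q. The
    coefficients of degree m r are the values of these forms at (a_r, b_r), so one of them is
    nonzero. *)
Lemma ratdeg_comp f g : is_ratfun f -> is_ratfun g ->
  ratdeg (ratcomp f g) = (ratdeg f * ratdeg g)%N.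
Proof.
move=> fR gR; have [p [q [cpq q0 Ef]]] := ratfracP f.
have [a [b [cab b0 Eg]]] := ratfracP g.
have sm := ratdegS cpq q0 Ef; have sr := ratdegS cab b0 Eg.
set m := ratdeg f in sm *; set r := ratdeg g in sr *.
have bF : b%:F != 0 :> ratK by rewrite tofrac_eq0.
pose H (P : {poly K}) := hhorner m (map_poly polyC P) a b.
have HE (P : {poly K}) : (size P <= m.+1)%N -> (H P)%:F = b%:F ^+ m * ratsubst P g.
  move=> sP; rewrite /ratsubst Eg -hhornerE //; last first.
    by apply: leq_trans (size_poly _ _) _.
  rewrite /H /hhorner rmorph_sum; apply: eq_bigr => k _ /=.
  by rewrite !tofracM !tofracXn !coef_map.
have Hw (P : {poly K}) (w : K) : (H P).[w] = hhorner m P a.[w] b.[w].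
  rewrite /H /hhorner horner_sum; apply: eq_bigr => k _.
  by rewrite !hornerM !horner_exp coef_map /= hornerC.
have sa : (size a <= r.+1)%N by rewrite -sr leq_maxl.
have sb : (size b <= r.+1)%N by rewrite -sr leq_maxr.
have Hs (P : {poly K}) : (size (H P) <= (m * r).+1)%N.
  apply: leq_trans (size_sum _ _ _) _; apply/bigmax_leqP => k _.
  have [s1 _] := coefX_top k sa; have [s2 _] := coefX_top (m - k) sb.
  rewrite -mulrA coef_map /= mul_polyC; apply: leq_trans (size_scale_leq _ _) _.
  apply: leq_trans (size_polyMleq _ _) _.
  have km : (k <= m)%N by rewrite -ltnS.
  have -> : (m * r = k * r + (m - k) * r)%N by rewrite -mulnDl subnKC.
  move: s1 s2; move: (k * r)%N ((m - k) * r)%N (size (a ^+ k)) (size (b ^+ (m - k))).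
  by move=> ? ? ? ? ? ?; lia.
have Htop (P : {poly K}) : (H P)`_(m * r) = hhorner m P a`_r b`_r.
  rewrite /H /hhorner coef_sum; apply: eq_bigr => k _.
  have [s1 c1] := coefX_top k sa; have [s2 c2] := coefX_top (m - k) sb.
  rewrite -mulrA coef_map /= mul_polyC coefZ.
  have km : (k <= m)%N by rewrite -ltnS.
  have -> : (m * r = k * r + (m - k) * r)%N by rewrite -mulnDl subnKC.
  by rewrite coefM_top // c1 c2 mulrA.
have cH : coprimep (H p) (H q).
  apply/Pdiv.ClosedField.coprimepP => w; rewrite /root !Hw => /eqP hp.
  have := hhorner_coprime (x := a.[w]) (y := b.[w]) cpq sm; rewrite hp eqxx /=; apply.
  rewrite -negb_and; apply/negP => /andP [ra rb].
  by move/coprimep_root: cab => /(_ w); rewrite /root => /(_ ra); rewrite rb.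
have sp : (size p <= m.+1)%N by rewrite -sm leq_maxl.
have sq : (size q <= m.+1)%N by rewrite -sm leq_maxr.
have Hq0 : H q != 0.
  rewrite -tofrac_eq0 (HE q sq); apply: mulf_neq0; [exact: expf_neq0 | exact: ratsubst_neq0].
have E : ratcomp f g = (H p)%:F / (H q)%:F.
  by rewrite {1}Ef (ratcompE _ gR q0) (HE p sp) (HE q sq) -mulf_div divff ?mul1r ?expf_neq0.
apply/eqP; rewrite -eqSS -(ratdegS cH Hq0 E) eqn_leq geq_max !Hs /=.
have : (a`_r != 0) || (b`_r != 0).
  have : (r.+1 <= maxn (size a) (size b))%N by rewrite sr.
  rewrite leq_max -negb_and; apply: contraL => /andP [/eqP ar /eqP br].
  rewrite negb_or -!leqNgt; apply/andP; split; apply/leq_sizeP => j;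
    rewrite leq_eqVlt => /predU1P [<- //|rj]; by [apply: (leq_sizeP _ _ sa)|apply: (leq_sizeP _ _ sb)].
move/(hhorner_coprime cpq sm); rewrite -!Htop leq_max.
by case/orP => h; apply/orP; [left|right]; rewrite ltnNge; apply: contraNN h => h;
  apply/eqP/(leq_sizeP _ _ h).
Qed.

Lemma ratdeg_var : ratdeg (ratvar K) = 1%N.
Proof.
by rewrite /ratvar -[_%:F]divr1 -tofrac1 ratdegE ?oner_neq0 ?coprimep1 // size_polyX size_poly1.
Qed.

Lemma ratdeg_iter f d : is_ratfun f -> ratdeg (ratiter f d) = (ratdeg f ^ d)%N.
Proof.
move=> fR; elim: d => [|d IH]; first exact: ratdeg_var.
by rewrite /= ratdeg_comp ?expnS ?IH //; exact: ratfun_iter.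
Qed.

Lemma moebius_ratfun f : is_moebius f -> is_ratfun f. Proof. by case. Qed.

Lemma moebius_deg f : ratdeg f = 1%N -> is_moebius f.
Proof. by move=> f1; split=> //; apply/ratfun_deg; rewrite f1. Qed.

Lemma moebius_comp f g : is_moebius f -> is_moebius g -> is_moebius (ratcomp f g).
Proof. by move=> [fR f1] [gR g1]; apply: moebius_deg; rewrite ratdeg_comp // f1 g1. Qed.

Lemma moebius_var : is_moebius (ratvar K).
Proof. exact: moebius_deg ratdeg_var. Qed.

(** * Moebius transformations *)

Local Notation x := (ratvar K).

Lemma size_lin (u v : K) : (size (u *: 'X + v%:P)%R <= 2)%N.
Proof.
apply/leq_sizeP => [] [|[|j]] // _; rewrite coefD coefZ coefX coefC /=.
by rewrite mulr0 addr0.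
Qed.

Lemma lin_eq0 (u v : K) : u *: 'X + v%:P = 0 -> u = 0 /\ v = 0.
Proof.
move=> /polyP E; have := E 0; have := E 1%N.
by rewrite !coefD !coefZ !coefX !coefC /= !(mulr0, mulr1, addr0, add0r).
Qed.

Definition linfrac (a b c d : K) : ratK := (const a * x + const b) / (const c * x + const d).

Lemma linfracE a b c d : linfrac a b c d = (a *: 'X + b%:P)%:F / (c *: 'X + d%:P)%:F.
Proof. by rewrite /linfrac -!mul_polyC !tofracD !tofracM. Qed.

Lemma moebius_linfrac (a b c d : K) : a * d - b * c != 0 -> is_moebius (linfrac a b c d).
Proof.
move=> D; apply: moebius_deg; rewrite linfracE.
have q0 : c *: 'X + d%:P != 0 :> {poly K}.
  by apply: contraNneq D => /lin_eq0 [-> ->]; rewrite !mulr0 subrr.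
rewrite ratdegE //; last first.
  apply/Pdiv.ClosedField.coprimepP => w; rewrite /root !hornerE => E1.
  apply: contraNneq D => E2; move: E1; rewrite addrC addr_eq0 => /eqP ->.
  by move/eqP: E2; rewrite addrC addr_eq0 => /eqP ->; apply/eqP; ring.
have : (maxn (size (a *: 'X + b%:P)%R) (size (c *: 'X + d%:P)%R) <= 2)%N.
  by rewrite geq_max !size_lin.
move=> s3; suff E2 : maxn (size (a *: 'X + b%:P)%R) (size (c *: 'X + d%:P)%R) = 2%N.
  by rewrite E2.
apply/eqP; rewrite eqn_leq s3 /=.
rewrite leqNgt; apply: contra D; rewrite ltnS geq_max => /andP [/leq_sizeP s1 /leq_sizeP s2].
have := s1 1%N isT; have := s2 1%N isT.
rewrite !coefD !coefZ !coefX !coefC /= !mulr1 !addr0 => -> ->.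
by rewrite mul0r mulr0 subrr.
Qed.

Lemma linfracP f : is_moebius f -> exists a b c d, a * d - b * c != 0 /\ f = linfrac a b c d.
Proof.
move=> [fR f1]; have [p [q [cpq q0 Ef]]] := ratfracP f.
have := ratdegS cpq q0 Ef; rewrite f1 => s2.
have lin (r : {poly K}) : (size r <= 2)%N -> r = r`_1 *: 'X + (r`_0)%:P.
  move=> sr; apply/polyP => [] [|[|j]]; rewrite coefD coefZ coefX coefC /=.
  - by rewrite mulr0 add0r.
  - by rewrite mulr1 addr0.
  - by rewrite mulr0 addr0 (leq_sizeP _ _ sr).
have Ep := lin p; have Eq := lin q; rewrite -s2 leq_maxl leq_maxr in Ep Eq.
move: (Ep isT) (Eq isT) => {}Ep {}Eq; exists p`_1, p`_0, q`_1, q`_0; split; last first.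
  by rewrite linfracE -Ep -Eq.
apply/eqP => D; suff [k Ek] : exists k, p = k *: q.
  apply: (fR k); rewrite Ef Ek -mul_polyC tofracM mulfK //.
  by rewrite tofrac_eq0.
have kE k : k *: q = (k * q`_1) *: 'X + (k * q`_0)%:P.
  by rewrite {1}Eq scalerDr scalerA -[X in _ + X]mul_polyC polyCM.
have [q00|q00] := eqVneq q`_0 0; last first.
  exists (p`_0 / q`_0); rewrite {1}Ep kE divfK //; congr (_ *: _ + _).
  by apply: (mulIf q00); rewrite mulrAC divfK // (subr0_eq D).
have q10 : q`_1 != 0.
  by apply: contraNneq q0 => q10; rewrite Eq q10 q00 scale0r add0r.
have p00 : p`_0 = 0.
  move: D; rewrite q00 mulr0 sub0r => /eqP; rewrite oppr_eq0 mulf_eq0 (negPf q10) orbF.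
  by move/eqP.
by exists (p`_1 / q`_1); rewrite {1}Ep kE divfK // p00 q00 mulr0.
Qed.

Lemma const_eq0 c : (const c == 0) = (c == 0).
Proof. by rewrite tofrac_eq0 polyC_eq0. Qed.

Lemma constB c d : const (c - d) = const c - const d.
Proof. by rewrite polyCB tofracB. Qed.
Lemma constM c d : const (c * d) = const c * const d.
Proof. by rewrite polyCM tofracM. Qed.

Lemma lin_neq0 c d (g : ratK) : is_ratfun g -> c != 0 \/ d != 0 -> const c * g + const d != 0.
Proof.
move=> gR cd; have -> : const c * g + const d = ratsubst (c *: 'X + d%:P) g.
  by rewrite -mul_polyC ratsubstD ratsubstM !ratsubstC ratsubstX.
apply: ratsubst_neq0 => //; apply/eqP => /lin_eq0 [c0 d0].
by case: cd; rewrite ?c0 ?d0 eqxx.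
Qed.

Lemma ratcomp_linfrac a b c d g : is_ratfun g ->
  ratcomp (linfrac a b c d) g = (const a * g + const b) / (const c * g + const d).
Proof.
move=> gR; rewrite /linfrac ratcompM // ratcompV // !ratcompD // !ratcompM //.
by rewrite !ratcompC // !ratcomp_varl.
Qed.

Lemma linfracK a b c d : a * d - b * c != 0 ->
  ratcomp (linfrac d (- b) (- c) a) (linfrac a b c d) = x.
Proof.
move=> D; have mR := moebius_ratfun (moebius_linfrac D).
have D' : const a * const d - const b * const c != 0 by rewrite -!constM -constB const_eq0.
have cd : c != 0 \/ d != 0.
  have [c0|c0] := eqVneq c 0; [right|by left].
  by apply: contraNneq D => ->; rewrite c0 !mulr0 subrr.
have q0 := lin_neq0 ratfun_var cd.
rewrite (ratcomp_linfrac _ _ _ _ mR) /linfrac !polyCN !tofracN.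
by have := linfrac_cancel D' q0.
Qed.

Lemma moebius_inv f : is_moebius f ->
  exists g, [/\ is_moebius g, ratcomp f g = x & ratcomp g f = x].
Proof.
move=> /linfracP [a [b [c [d [D ->]]]]]; exists (linfrac d (- b) (- c) a).
have D' : d * a - (- b) * (- c) != 0 by rewrite mulrNN mulrC.
split; [exact: moebius_linfrac| |exact: linfracK].
by have := linfracK D'; rewrite !opprK.
Qed.

Lemma moebius_add v : is_moebius (x + const v).
Proof.
have := @moebius_linfrac 1 v 0 1; rewrite mulr0 subr0 mul1r oner_neq0 => /(_ isT).
by rewrite /linfrac !tofrac0 !tofrac1 mul1r mul0r add0r divr1.
Qed.

Lemma moebius_V : is_moebius x^-1.
Proof.
have := @moebius_linfrac 0 1 1 0; rewrite mul0r sub0r mulr1 oppr_eq0 oner_neq0 => /(_ isT).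
by rewrite /linfrac !tofrac0 !tofrac1 mul1r mul0r add0r addr0 div1r.
Qed.

Lemma ratcomp_add v g : is_ratfun g -> ratcomp (x + const v) g = g + const v.
Proof. by move=> gR; rewrite ratcompD // ratcomp_varl // ratcompC. Qed.

Lemma ratcomp_V g : is_ratfun g -> ratcomp x^-1 g = g^-1.
Proof. by move=> gR; rewrite ratcompV // ratcomp_varl. Qed.

End Composition.

Lemma row_dependent (F : fieldType) n k (M : 'M[F]_(n, k)) : (k < n)%N ->
  exists2 v : 'rV_n, v != 0 & v *m M = 0.
Proof.
move=> kn; have : kermx M != 0.
  by rewrite -mxrank_eq0 mxrank_ker subn_eq0 -ltnNge (leq_ltn_trans (rank_leq_col M)).
case/rowV0Pn=> v /sub_kermxP vM v0; by exists v.
Qed.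

(** * Degree bounds over a subfield *)

Section SubfieldEval.
Variables (E F : fieldType) (phi : {rmorphism E -> F}).

(** [phi] embeds the coefficient field in [F]. Below it is f |-> f o Y on K(z), so that the values
    at [u] of polynomials over K(z) are the elements of K(Y)[u] and the subfield K(Y) does not have
    to be made a type. *)
Definition subeval (u : F) (p : {poly E}) : F := (map_poly phi p).[u].

Lemma subevalD u : {morph subeval u : p q / p + q}.
Proof. by move=> p q; rewrite /subeval rmorphD hornerD. Qed.
Lemma subevalN u : {morph subeval u : p / - p}.
Proof. by move=> p; rewrite /subeval rmorphN hornerN. Qed.
Lemma subevalB u : {morph subeval u : p q / p - q}.
Proof. by move=> p q; rewrite subevalD subevalN. Qed.
Lemma subevalM u : {morph subeval u : p q / p * q}.
Proof. by move=> p q; rewrite /subeval rmorphM hornerM. Qed.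
Lemma subeval0 u : subeval u 0 = 0.
Proof. by rewrite /subeval rmorph0 horner0. Qed.
Lemma subeval1 u : subeval u 1 = 1.
Proof. by rewrite /subeval rmorph1 hornerC. Qed.
Lemma subevalX u : subeval u 'X = u.
Proof. by rewrite /subeval map_polyX hornerX. Qed.
Lemma subevalC u c : subeval u c%:P = phi c.
Proof. by rewrite /subeval map_polyC hornerC. Qed.
Lemma subevalXn u p n : subeval u (p ^+ n) = subeval u p ^+ n.
Proof. by rewrite /subeval rmorphXn horner_exp. Qed.
Lemma subeval_sum u I (r : seq I) (P : pred I) (G : I -> {poly E}) :
  subeval u (\sum_(i <- r | P i) G i) = \sum_(i <- r | P i) subeval u (G i).
Proof. by rewrite /subeval rmorph_sum horner_sum. Qed.

(** A factor that [Phi] shares with [g] does not vanish at [u]; it is divided out of [Phi] until the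
    two are coprime, and Bezout's identity then inverts [g]. *)
Lemma subeval_inv u Phi g : Phi != 0 -> subeval u Phi = 0 -> subeval u g != 0 ->
  exists a, subeval u a = (subeval u g)^-1.
Proof.
have [n] := ubnP (size Phi); elim: n => // n IH in Phi *.
rewrite ltnS => sn P0 evP evg; have [c|nc] := boolP (coprimep g Phi).
  case/Bezout_eq1_coprimepP: c => -[a b] /= /(congr1 (subeval u)).
  rewrite subevalD !subevalM evP mulr0 addr0 subeval1 => ag.
  by exists a; apply: (mulIf evg); rewrite ag mulVf.
have d0 : gcdp g Phi != 0 by rewrite gcdp_eq0 (negPf P0) andbF.
have Eg := divpK (dvdp_gcdl g Phi); have EP := divpK (dvdp_gcdr g Phi).
set d := gcdp g Phi in d0 Eg EP nc *.
have evd : subeval u d != 0.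
  by apply: contraNneq evg => evd; rewrite -Eg subevalM evd mulr0.
have q0 : Phi %/ d != 0 by apply: contraNneq P0 => q0; rewrite -EP q0 mul0r.
apply: (IH _ _ q0) => //; last first.
  by apply: (mulIf evd); rewrite mul0r -subevalM EP.
apply: leq_trans sn; rewrite size_divp //.
have aux (i j : nat) : (0 < i -> 0 < j -> i != 1 -> j - i.-1 < j)%N by move=> ? ? /eqP ?; lia.
by apply: aux => //; rewrite lt0n size_poly_eq0.
Qed.

Lemma polyOfRow n (v : 'rV[E]_n) : v != 0 -> rVpoly v != 0 :> {poly E}.
Proof. by apply: contraNneq => v0; rewrite -[v]rVpolyK v0 linear0. Qed.

Section Exchange.
Variables (z : F) (r : nat).
Hypothesis span : forall h, exists2 p : {poly E}, (size p <= r)%N & subeval z p = h.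
Hypothesis indep : forall p : {poly E}, (size p <= r)%N -> subeval z p = 0 -> p = 0.

Lemma subeval_row n (v : 'rV[E]_n) u : subeval u (rVpoly v) = \sum_(i < n) phi (v 0 i) * u ^+ i.
Proof.
rewrite /subeval (horner_coef_wide (n := n)); last first.
  by apply: leq_trans (size_poly _ _) _; rewrite size_poly.
by apply: eq_bigr => i _; rewrite coef_map coef_rVpoly_ord.
Qed.

(** [span] and [indep] say that 1, z, .., z^(r-1) is a basis of [F] over [E]; the first r + 1 powers
    of [u] are therefore dependent. *)
Lemma annihilator_exists u : exists P : {poly E}, [/\ P != 0, (size P <= r.+1)%N & subeval u P = 0].
Proof.
have [pp spp ppE] : exists2 pp : F -> {poly E}, (forall h, (size (pp h) <= r)%N) &
    forall h, subeval z (pp h) = h.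
  by exists (fun h => s2val (cid2 (span h))) => h; case: cid2.
have [v v0 vM] := row_dependent (\matrix_(i < r.+1) (poly_rV (pp (u ^+ i)) : 'rV_r)) (ltnSn r).
exists (rVpoly v); split; [exact: polyOfRow | exact: size_poly |].
rewrite subeval_row.
have : subeval z (\sum_(i < r.+1) v 0 i *: pp (u ^+ i)) = 0.
  rewrite -[RHS](subeval0 z); congr subeval; apply/polyP => k; rewrite coef0 coef_sum.
  have [kr|kr] := ltnP k r; last first.
    by rewrite big1 // => i _; rewrite coefZ (leq_sizeP _ _ (spp _)) ?mulr0.
  transitivity ((v *m \matrix_(i < r.+1) (poly_rV (pp (u ^+ i)) : 'rV_r)) 0 (Ordinal kr)).
    by rewrite mxE; apply: eq_bigr => i _; rewrite coefZ !mxE.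
  by rewrite vM mxE.
rewrite subeval_sum => Hs; apply: etrans Hs; apply: eq_bigr => i _.
by rewrite -mul_polyC subevalM subevalC ppE.
Qed.

(** Modulo a polynomial [P] of degree below r that kills [u], the powers of [g] with exponent below
    r are dependent; evaluating at [u] gives a relation between 1, z, .., z^(r-1). *)
Lemma annihilator_size u g (P : {poly E}) : subeval u g = z -> P != 0 -> subeval u P = 0 -> (r < size P)%N.
Proof.
move=> gz P0 uP; rewrite ltnNge; apply/negP => sP.
have modE h : subeval u (h %% P) = subeval u h.
  by rewrite {2}(divp_eq h P) subevalD subevalM uP mulr0 add0r.
have e_r : ((size P).-1 < r)%N by move: sP; rewrite -size_poly_eq0 in P0; lia.
have [v v0 vM] := row_dependent
  (\matrix_(i < r) (poly_rV ((g ^+ i) %% P) : 'rV_(size P).-1)) e_r.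
suff /eqP : rVpoly v = 0 by apply/negP/polyOfRow.
apply: indep; first exact: size_poly.
rewrite subeval_row.
transitivity (subeval u (\sum_(i < r) v 0 i *: (g ^+ i %% P))).
  rewrite subeval_sum; apply: eq_bigr => i _.
  by rewrite -mul_polyC subevalM subevalC modE subevalXn gz.
rewrite -[RHS](subeval0 u); congr subeval; apply/polyP => k; rewrite coef0 coef_sum.
have [kr|kr] := ltnP k (size P).-1; last first.
  rewrite big1 // => i _; rewrite coefZ (leq_sizeP _ _ (leqnn _)) ?mulr0 //.
  have := ltn_modp (g ^+ i) P; rewrite P0 => h; rewrite -ltnS; apply: leq_trans h _.
  by rewrite (leq_trans (leqSpred _)) // ltnS.
transitivity ((v *m \matrix_(i < r) (poly_rV (g ^+ i %% P) : 'rV_(size P).-1)) 0 (Ordinal kr)).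
  by rewrite mxE; apply: eq_bigr => i _; rewrite coefZ !mxE.
by rewrite vM mxE.
Qed.
End Exchange.
End SubfieldEval.

Section RationalFunctionFields.
Variable K : numClosedFieldType.
Local Notation ratK := {fraction {poly K}}.

Lemma clear_denominators (p : {poly ratK}) :
  exists (d : {poly K}) (P : {poly {poly K}}), d != 0 /\ d%:F *: p = map_poly (@tofrac _) P.
Proof.
elim/poly_ind: p => [|p c [d [P [d0 E]]]].
  by exists 1, 0; rewrite oner_neq0 scaler0 rmorph0.
have [n [m [_ m0 ->]]] := ratfracP c; exists (d * m), (m *: P * 'X + (d * n)%:P).
split; first by rewrite mulf_neq0.
have mF : m%:F != 0 :> ratK by rewrite tofrac_eq0.
have -> : map_poly (@tofrac _) (m *: P * 'X + (d * n)%:P) =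
   m%:F *: map_poly (@tofrac _) P * 'X + (d%:F * n%:F)%:P :> {poly ratK}.
  by apply/polyP => i; rewrite coef_map !coefD !coefMX !coefC !coefZ !coef_map;
     case: i => [|i] /=; rewrite rmorphD ?rmorphM ?rmorph0.
rewrite -E tofracM scalerDr -!scalerAl !scalerA [m%:F * _]mulrC; congr (_ + _).
by rewrite -mul_polyC -polyCM; congr (_%:P); rewrite mulrACA divff ?mulr1.
Qed.

End RationalFunctionFields.

Section BivariateEval.
Variable K : numClosedFieldType.
Local Notation ratK := {fraction {poly K}}.
Local Notation const c := (@tofrac {poly K} (polyC c)).
Local Notation x := (ratvar K).
Implicit Types (u v f g h : ratK) (p q a b : {poly K}).

Definition rsubst u := fun p => ratsubst p u.

Lemma rsubst_additive u : zmod_morphism (rsubst u).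
Proof. by move=> p q; rewrite /rsubst /ratsubst rmorphB hornerD hornerN. Qed.
Lemma rsubst_multiplicative u : monoid_morphism (rsubst u).
Proof. by split=> [|p q]; rewrite /rsubst /ratsubst ?rmorph1 ?hornerC ?rmorphM ?hornerM. Qed.
HB.instance Definition _ u := GRing.isZmodMorphism.Build _ _ (rsubst u) (rsubst_additive u).
HB.instance Definition _ u := GRing.isMonoidMorphism.Build _ _ (rsubst u) (rsubst_multiplicative u).

Lemma rsubstC u c : rsubst u c%:P = const c. Proof. exact: ratsubstC. Qed.
Lemma rsubstX u : rsubst u 'X = u. Proof. exact: ratsubstX. Qed.

Lemma rsubst_var p : rsubst x p = p%:F.
Proof.
elim/poly_ind: p => [|p c IH]; first by rewrite tofrac0 rmorph0.
by rewrite rmorphD rmorphM /= tofracD tofracM IH rsubstC rsubstX.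
Qed.

(* The first variable is the inner one, of coefficients. *)
Definition bieval u v (P : {poly {poly K}}) : ratK := (map_poly (rsubst u) P).[v].

Lemma bieval_additive u v : zmod_morphism (bieval u v).
Proof. by move=> p q; rewrite /bieval rmorphB hornerD hornerN. Qed.
Lemma bieval_multiplicative u v : monoid_morphism (bieval u v).
Proof. by split=> [|p q]; rewrite /bieval ?rmorph1 ?hornerC ?rmorphM ?hornerM. Qed.
HB.instance Definition _ u v := GRing.isZmodMorphism.Build _ _ (bieval u v) (bieval_additive u v).
HB.instance Definition _ u v := GRing.isMonoidMorphism.Build _ _ (bieval u v) (bieval_multiplicative u v).

Lemma bievalC u v p : bieval u v p%:P = rsubst u p.
Proof. by rewrite /bieval map_polyC hornerC. Qed.
Lemma bievalX u v : bieval u v 'X = v.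
Proof. by rewrite /bieval map_polyX hornerX. Qed.

Lemma bipoly_rmorph_eq (L : nzRingType) (s t : {rmorphism {poly {poly K}} -> L}) :
  (forall c, s c%:P%:P = t c%:P%:P) -> s 'X%:P = t 'X%:P -> s 'X = t 'X -> s =1 t.
Proof.
move=> stC stX stY P; elim/poly_ind: P => [|P p IH]; first by rewrite !rmorph0.
rewrite !rmorphD !rmorphM /= IH stY; congr (_ + _).
elim/poly_ind: p => [|p c IHp]; first by rewrite polyC0 !rmorph0.
by rewrite polyCD polyCM !rmorphD !rmorphM /= IHp stX stC.
Qed.

Lemma bieval_swapXY u v P : bieval u v (swapXY P) = bieval v u P.
Proof.
apply: (bipoly_rmorph_eq (s := bieval u v \o @swapXY K) (t := bieval v u)) => [c||] /=.
- by rewrite swapXY_polyC map_polyC /= !bievalC !rsubstC.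
- by rewrite swapXY_polyC map_polyX bievalX bievalC rsubstX.
- by rewrite swapXY_X bievalX bievalC rsubstX.
Qed.

Lemma bieval_subeval f (fR : is_ratfun f) v P :
  bieval f v P = subeval (comp_right fR) v (map_poly (@tofrac _) P).
Proof.
rewrite /bieval /subeval -map_poly_comp; congr (_.[_]).
by apply: eq_map_poly => p /=; rewrite /comp_right ratcompF.
Qed.

Lemma bieval_var f P : bieval x f P = (map_poly (@tofrac _) P).[f].
Proof. by rewrite /bieval; congr (_.[_]); apply: eq_map_poly => p; exact: rsubst_var. Qed.

Lemma ratfun_neq0 f : is_ratfun f -> f != 0.
Proof. by move=> fR; apply/eqP => f0; apply: (fR 0); rewrite f0 tofrac0. Qed.

(** The rational root theorem over K[z]: once [P] has a nonzero constant term and f = a / b, the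
    polynomial a divides this term and b divides the leading coefficient, so one of the two has
    degree at least deg f. *)
Lemma bieval_var_size f (P : {poly {poly K}}) : is_ratfun f -> P != 0 -> bieval x f P = 0 ->
  exists j, (ratdeg f < size (P`_j)%R)%N.
Proof.
move=> fR; have [n] := ubnP (size P); elim: n => // n IH in P *.
rewrite ltnS => sn P0 PE; have [P00|P00] := eqVneq P`_0 0.
  have EP : P = (\poly_(i < (size P).-1) P`_i.+1) * 'X.
    apply/polyP => [] [|i]; rewrite coefMX //= coef_poly.
    case: ltnP => // h; rewrite (leq_sizeP _ _ (leqnn _)) //.
    by apply: leq_trans (leqSpred _) _.
  move: (\poly_(i < _) _) EP => P1 EP; rewrite EP in sn P0 PE *.
  have P10 : P1 != 0 by apply: contraNneq P0 => ->; rewrite mul0r.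
  have sP1 : (size P1 < n)%N.
    by apply: leq_trans sn; rewrite size_mulX.
  move: PE; rewrite rmorphM /= bievalX => /eqP.
  rewrite mulf_eq0 (negPf (ratfun_neq0 fR)) orbF => /eqP /(IH _ sP1 P10) [j Hj].
  by exists j.+1; rewrite coefMX.
have [a [b [cab b0 Ef]]] := ratfracP f; have sr := ratdegS cab b0 Ef.
have bF : b%:F != 0 :> ratK by rewrite tofrac_eq0.
set D := (size P).-1.
have lead0 : P`_D != 0 by rewrite -[_`_ _]/(lead_coef P) lead_coef_eq0.
have /eqP := congr1 (fun t => b%:F ^+ D * t) PE; rewrite mulr0 bieval_var Ef.
rewrite -hhornerE //; last by apply: leq_trans (size_poly _ _) (leqSpred _).
have -> : hhorner D (map_poly (@tofrac _) P) a%:F b%:F = (hhorner D P a b)%:F.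
  rewrite /hhorner rmorph_sum; apply: eq_bigr => k _ /=.
  by rewrite !tofracM !tofracXn coef_map.
rewrite tofrac_eq0 => /eqP HD.
have sa : (size a <= size (P`_0)%R)%N.
  apply: dvdp_leq => //; have cab' : coprimep a (b ^+ D) by rewrite coprimep_expr.
  rewrite -(Gauss_dvdpl _ cab').
  move: HD; rewrite /hhorner big_ord_recl /= expr0 mulr1 subn0 => /eqP.
  rewrite addr_eq0 => /eqP ->; rewrite dvdpNr.
  apply: (big_ind (fun t => a %| t)) => [|t1 t2 h1 h2|i _]; rewrite ?dvdp0 ?dvdp_add //.
  by rewrite exprS mulrAC dvdp_mull // dvdp_mulr.
have sb : (size b <= size (P`_D)%R)%N.
  apply: dvdp_leq => //; have cab' : coprimep b (a ^+ D) by rewrite coprimep_expr // coprimep_sym.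
  rewrite -(Gauss_dvdpl _ cab').
  move: HD; rewrite /hhorner big_ord_recr /= subnn expr0 mulr1 => /eqP.
  rewrite addrC addr_eq0 => /eqP ->; rewrite dvdpNr.
  apply: (big_ind (fun t => b %| t)) => [|t1 t2 h1 h2|i _]; rewrite ?dvdp0 ?dvdp_add //.
  have -> : (D - i = (D - i).-1.+1)%N by rewrite prednK // subn_gt0.
  by rewrite exprS dvdp_mull // dvdp_mulr.
have : (ratdeg f < maxn (size a) (size b))%N by rewrite sr.
rewrite -Ef leq_max => /orP [h|h].
  by exists 0%N; apply: leq_trans h sa.
by exists D; apply: leq_trans h sb.
Qed.

(** A relation between powers of z over K(f), with denominators cleared and the variables exchanged,
    is an equation for f over K[z] whose coefficients have degree below deg f, contrary to
    [bieval_var_size]. *)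
Lemma ratfun_indep f (fR : is_ratfun f) (p : {poly ratK}) :
  (size p <= ratdeg f)%N -> subeval (comp_right fR) x p = 0 -> p = 0.
Proof.
move=> sp p0; have [d [P [d0 E]]] := clear_denominators p.
have dF : d%:F != 0 :> ratK by rewrite tofrac_eq0.
suff /eqP : d%:F *: p = 0 by rewrite scaler_eq0 (negPf dF) => /eqP.
have [P0|P0] := eqVneq P 0; first by rewrite E P0 rmorph0.
exfalso.
have PE : bieval x f (swapXY P) = 0.
  by rewrite bieval_swapXY (bieval_subeval fR) -E -mul_polyC subevalM p0 mulr0.
have [|j] := bieval_var_size fR _ PE; first by rewrite swapXY_eq0.
apply/negP; rewrite -leqNgt; apply: leq_trans sp.
apply/leq_sizeP => i hi; rewrite coef_swapXY.
have := congr1 (fun t : {poly ratK} => t`_i) E.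
rewrite coefZ coef_map (leq_sizeP _ _ (leqnn (size p))) // mulr0 => /eqP /=.
by rewrite eq_sym tofrac_eq0 => /eqP ->; rewrite coef0.
Qed.

(* With X = p / q, the polynomial X(T) - C up to the factor q(T). *)
Definition fibpoly (C : ratK) p q : {poly ratK} :=
  map_poly (@tofrac _ \o polyC) p - C *: map_poly (@tofrac _ \o polyC) q.

Lemma const_lin_eq0 C (a b : K) : is_ratfun C -> const a - C * const b = 0 -> a = 0 /\ b = 0.
Proof.
move=> CR /eqP E; have [/eqP|b0] := eqVneq b 0; last first.
  have := @lin_neq0 _ (- b) a C CR (or_introl _); rewrite oppr_eq0 => /(_ b0).
  by rewrite polyCN tofracN mulNr addrC mulrC E.
move=> /eqP b0; move: E; rewrite b0 polyC0 tofrac0 mulr0 subr0 const_eq0.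
by move/eqP.
Qed.

Lemma coef_fibpoly C p q i : (fibpoly C p q)`_i = const p`_i - C * const q`_i.
Proof. by rewrite coefB coefZ !coef_map. Qed.

Lemma size_fibpoly C p q : is_ratfun C -> size (fibpoly C p q) = maxn (size p) (size q).
Proof.
move=> CR; apply/eqP; rewrite eqn_leq geq_max; apply/and3P; split.
- apply/leq_sizeP => j; rewrite geq_max => /andP [h1 h2].
  by rewrite coef_fibpoly (leq_sizeP _ _ h1) // (leq_sizeP _ _ h2) // polyC0 tofrac0 mulr0 subrr.
- apply/leq_sizeP => j /leq_sizeP /(_ j (leqnn j)); rewrite coef_fibpoly.
  by case/(const_lin_eq0 CR).
- apply/leq_sizeP => j /leq_sizeP /(_ j (leqnn j)); rewrite coef_fibpoly.
  by case/(const_lin_eq0 CR).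
Qed.

Lemma subeval_map_const (phi : {rmorphism ratK -> ratK}) u p :
  (forall c, phi (const c) = const c) -> subeval phi u (map_poly (@tofrac _ \o polyC) p) = rsubst u p.
Proof.
move=> phiC; rewrite /subeval -map_poly_comp /rsubst /ratsubst; congr (_.[_]).
by apply: eq_map_poly => c /=; rewrite phiC.
Qed.

Lemma comp_right_const f (fR : is_ratfun f) c : comp_right fR (const c) = const c.
Proof. exact: ratcompC. Qed.

Lemma subeval_fibpoly C p q Y (YR : is_ratfun Y) B :
  subeval (comp_right YR) B (fibpoly C p q) = rsubst B p - ratcomp C Y * rsubst B q.
Proof.
rewrite /fibpoly subevalB -mul_polyC subevalM subevalC.
by rewrite !subeval_map_const //; exact: comp_right_const.
Qed.

(** With f = a / b, z is a root of a(T) - f b(T), of degree deg f. Numerators, and also inverses of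
    denominators, are polynomials in z over K(f), to be reduced modulo this one. *)
Lemma ratfun_span f (fR : is_ratfun f) h :
  exists2 p : {poly ratK}, (size p <= ratdeg f)%N & subeval (comp_right fR) x p = h.
Proof.
have [a [b [cab b0 Ef]]] := ratfracP f; have sr := ratdegS cab b0 Ef.
pose Phi := fibpoly x a b; have sPhi : size Phi = (ratdeg f).+1.
  by rewrite size_fibpoly //; exact: ratfun_var.
have Phi0 : Phi != 0 by rewrite -size_poly_gt0 sPhi.
have bF : b%:F != 0 :> ratK by rewrite tofrac_eq0.
have PhiE : subeval (comp_right fR) x Phi = 0.
  rewrite subeval_fibpoly !rsubst_var (ratcomp_varl fR) Ef.
  by rewrite divfK ?subrr.
have polyE p : subeval (comp_right fR) x (map_poly (@tofrac _ \o polyC) p) = p%:F.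
  by rewrite subeval_map_const ?rsubst_var //; exact: comp_right_const.
have [n [d [_ d0 ->]]] := ratfracP h.
have dF : d%:F != 0 :> ratK by rewrite tofrac_eq0.
have [|e eE] := subeval_inv (phi := comp_right fR) (u := x) (g := map_poly (@tofrac _ \o polyC) d) Phi0 PhiE.
  by rewrite polyE.
pose g := map_poly (@tofrac _ \o polyC) n * e.
exists (g %% Phi).
  by rewrite -ltnS -sPhi ltn_modp.
have : subeval (comp_right fR) x g = n%:F / d%:F by rewrite subevalM eE !polyE.
by rewrite {1}(divp_eq g Phi) subevalD subevalM PhiE mulr0 add0r.
Qed.

End BivariateEval.

(** Division by a monic polynomial involves no inverse, so the remainder keeps its coefficients in
    the subring [L]. *)
Lemma monic_division (R : fieldType) (L : R -> Prop) (h P : {poly R}) :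
  (forall u v, L u -> L v -> L (u - v)) -> (forall u v, L u -> L v -> L (u * v)) -> L 0 ->
  h \is monic -> (forall i, L h`_i) -> (forall i, L P`_i) ->
  exists q r : {poly R}, [/\ P = q * h + r, forall i, L r`_i & (size r < size h)%N].
Proof.
move=> LB LM L0 hm Lh; have [n] := ubnP (size P); elim: n => // n IH in P *.
rewrite ltnS => sn LP; have [sP|sP] := ltnP (size P) (size h).
  by exists 0, P; rewrite mul0r add0r.
have h0 : h != 0 by rewrite monic_neq0.
have sh : (0 < size h)%N by rewrite size_poly_gt0.
pose t := lead_coef P *: ('X^(size P - size h) * h).
have Lt i : L t`_i.
  rewrite coefZ; apply: (LM); first exact: LP.
  by rewrite coefXnM; case: ifP => _; [exact: L0 | exact: Lh].
have st : (size t <= size P)%N.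
  apply: leq_trans (size_scale_leq _ _) _.
  by rewrite size_monicM ?monicXn // size_polyXn addSn /= subnK.
have sPt : (size (P - t)%R < size P)%N.
  have P0 : (0 < size P)%N by apply: leq_trans sP.
  rewrite -(prednK P0) ltnS; apply/leq_sizeP => j; rewrite leq_eqVlt => /predU1P [<-|jP].
    have aux (k l : nat) : (0 < k -> k <= l -> (l.-1 < l - k) = false /\ l.-1 - (l - k) = k.-1)%N.
      by move=> ? ?; split; lia.
    have [lt_l eq_l] := aux _ _ sh sP.
    rewrite coefB coefZ coefXnM lt_l eq_l.
    by rewrite -[h`_ _]/(lead_coef h) (monicP hm) mulr1 subrr.
  have Pj : (size P <= j)%N by rewrite -(prednK P0).
  by rewrite coefB (leq_sizeP _ _ Pj) // (leq_sizeP _ _ (leq_trans st Pj)) // subrr.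
have [||q [r [E Lr sr]]] := IH (P - t).
- exact: leq_trans sPt sn.
- by move=> i; rewrite coefB; apply: LB.
exists (q + lead_coef P *: 'X^(size P - size h)), r; split=> //.
by rewrite mulrDl addrAC -E -scalerAl subrK.
Qed.

(** * The field generated by two rational functions *)

Section GeneratedField.
Variable K : numClosedFieldType.
Local Notation ratK := {fraction {poly K}}.
Local Notation const c := (@tofrac {poly K} (polyC c)).
Local Notation x := (ratvar K).
Implicit Types (u v f g h : ratK) (p q a b : {poly K}).

(** Gauss's lemma, one root c of [e] at a time: specialized at c, [P] is nonzero, so [S] is zero and
    the factor X - c cancels on both sides. *)
Lemma gauss_dvd (e : {poly K}) (N P S : {poly {poly K}}) : e != 0 ->
  (forall c, map_poly (horner_eval c) P != 0) -> e *: N = P * S -> exists S', N = P * S'.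
Proof.
have [n] := ubnP (size e); elim: n => // n IH in e S *.
rewrite ltnS => sn e0 primP E; have [se|] := boolP (size e == 1%N).
  have /size_poly1P [c c0 ec] := se.
  exists (c^-1%:P *: S); rewrite -scalerAr -E ec scalerA -polyCM mulVf //.
  by rewrite scale1r.
case/closed_rootP => c /factor_theorem [e1 Ee].
have S0 : map_poly (horner_eval c) S = 0.
  have /eqP := congr1 (map_poly (horner_eval c)) E.
  rewrite rmorphM /= map_polyZ /= /horner_eval Ee hornerM hornerXsubC subrr mulr0 scale0r.
  by rewrite eq_sym mulf_eq0 (negPf (primP c)) /= => /eqP.
have [S1 ES] : exists S1, S = ('X - c%:P) *: S1.
  exists (\poly_(i < size S) (S`_i %/ ('X - c%:P))); apply/polyP => i.
  rewrite coefZ coef_poly; case: ltnP => [|/leq_sizeP /(_ i (leqnn i)) ->]; last by rewrite mulr0.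
  move=> _; rewrite mulrC divpK // dvdp_XsubCl /root.
  by have := congr1 (fun t : {poly K} => t`_i) S0; rewrite coef_map coef0 => /eqP.
have e10 : e1 != 0 by apply: contraNneq e0 => e10; rewrite Ee e10 mul0r.
apply: (IH e1 S1) => //.
  by apply: leq_trans sn; rewrite Ee size_Mmonic ?monicXsubC // size_XsubC addn2.
apply: (mulfI (x := ('X - c%:P)%:P)); first by rewrite polyC_eq0 polyXsubC_eq0.
by rewrite !mul_polyC scalerA mulrC -Ee E ES scalerAr.
Qed.

Section Gen.
Variables (F : ratK) (FR : is_ratfun F) (G : ratK).

(* [h] lies in K(F)[G], which equals K(F, G) because G is algebraic over K(F). *)
Definition gen h := exists p : {poly ratK}, subeval (comp_right FR) G p = h.

Lemma genC c : gen (const c).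
Proof. by exists (const c)%:P; rewrite subevalC; exact: ratcompC. Qed.
Lemma gen_comp u : gen (ratcomp u F).
Proof. by exists u%:P; rewrite subevalC. Qed.
Lemma genF : gen F.
Proof. by have := gen_comp x; rewrite ratcomp_varl. Qed.
Lemma genG : gen G.
Proof. by exists 'X; rewrite subevalX. Qed.
Lemma genD u v : gen u -> gen v -> gen (u + v).
Proof. by move=> [p <-] [q <-]; exists (p + q); rewrite subevalD. Qed.
Lemma genB u v : gen u -> gen v -> gen (u - v).
Proof. by move=> [p <-] [q <-]; exists (p - q); rewrite subevalB. Qed.
Lemma genM u v : gen u -> gen v -> gen (u * v).
Proof. by move=> [p <-] [q <-]; exists (p * q); rewrite subevalM. Qed.

Lemma annihilator : exists P : {poly ratK},
  [/\ P != 0, (size P <= (ratdeg F).+1)%N & subeval (comp_right FR) G P = 0].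
Proof. exact: (annihilator_exists (ratfun_span FR)). Qed.

Lemma genV u : gen u -> gen u^-1.
Proof.
move=> [p <-]; have [->|p0] := eqVneq (subeval (comp_right FR) G p) 0.
  by rewrite invr0 -(subeval0 (comp_right FR) G); exists 0.
have [P [P0 _ PE]] := annihilator; exact: (subeval_inv P0 PE p0).
Qed.

Lemma gen_ratcomp u v : is_ratfun v -> gen v -> gen (ratcomp u v).
Proof.
move=> vR gv; have genS p : gen (rsubst v p).
  elim/poly_ind: p => [|p c IH]; first by rewrite rmorph0 -tofrac0 -polyC0; exact: genC.
  by rewrite rmorphD rmorphM /= rsubstC rsubstX; apply: genD (genC _); exact: genM.
have [p [q [_ q0 ->]]] := ratfracP u; rewrite ratcompE //.
by apply: genM; [|apply: genV]; exact: genS.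
Qed.

(** K(z) has degree deg F over K(F), so a generator [G] of this extension has no annihilator of
    smaller degree. *)
Lemma gen_size (P : {poly ratK}) : gen x -> P != 0 -> subeval (comp_right FR) G P = 0 -> (ratdeg F < size P)%N.
Proof. by case=> g; exact: (annihilator_size (ratfun_indep (fR := FR))). Qed.

End Gen.

Lemma gen_sub F (FR : is_ratfun F) G F' (FR' : is_ratfun F') G' h :
  gen FR' G' F -> gen FR' G' G -> gen FR G h -> gen FR' G' h.
Proof.
move=> gF gG [p <-]; elim/poly_ind: p => [|p c IH].
  by rewrite subeval0 -tofrac0 -polyC0; exact: genC.
rewrite subevalD subevalM subevalX subevalC; apply: genD; first exact: genM.
exact: gen_ratcomp.
Qed.

Lemma subeval_compr F (FR : is_ratfun F) G W (WR : is_ratfun W) (FWR : is_ratfun (ratcomp F W))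
    (p : {poly ratK}) :
  subeval (comp_right FWR) (ratcomp G W) p = ratcomp (subeval (comp_right FR) G p) W.
Proof.
elim/poly_ind: p => [|p c IH].
  by rewrite !subeval0; apply/esym; have := ratcompC WR 0; rewrite polyC0 tofrac0.
rewrite !subevalD !subevalM !subevalX !subevalC ratcompD // ratcompM // IH.
congr (_ + _); exact: ratcompA.
Qed.

Lemma gen_compr F (FR : is_ratfun F) G W (WR : is_ratfun W) (FWR : is_ratfun (ratcomp F W)) h :
  gen FWR (ratcomp G W) (ratcomp h W) <-> gen FR G h.
Proof.
have E := subeval_compr FR G WR FWR.
by split=> [[p]|[p <-]]; [rewrite E => /(ratcomp_inj WR) <-|rewrite -E]; exists p.
Qed.

End GeneratedField.

Lemma tofrac_inj (R : idomainType) : injective (@tofrac R).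
Proof. by move=> p q /eqP; rewrite tofrac_eq => /eqP. Qed.

Lemma leq1_of_add (i j k : nat) : (k < i -> (i + j).-1 <= k.+1 -> j <= 1)%N.
Proof. by lia. Qed.

Lemma map_tofracZ (R : idomainType) (c : R) (P : {poly R}) :
  map_poly (@tofrac R) (c *: P) = c%:F *: map_poly (@tofrac R) P.
Proof. by apply/polyP => i; rewrite coef_map !coefZ coef_map /= tofracM. Qed.

Lemma map_tofracM (R : idomainType) (P Q : {poly R}) :
  map_poly (@tofrac R) (P * Q) = map_poly (@tofrac R) P * map_poly (@tofrac R) Q.
Proof. exact: rmorphM. Qed.

(** * Luroth's theorem *)

Section Luroth.
Variable K : numClosedFieldType.
Local Notation ratK := {fraction {poly K}}.
Local Notation const c := (@tofrac {poly K} (polyC c)).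
Local Notation x := (ratvar K).
Implicit Types (u v f g h : ratK) (p q a b : {poly K}).

Lemma size_coef_swapXY (H : {poly {poly K}}) i : (size (H`_i)%R <= size (swapXY H))%N.
Proof.
apply/leq_sizeP => j hj; rewrite -coef_swapXY.
by rewrite (leq_sizeP _ _ hj) // coef0.
Qed.

(* The minimal polynomial of z over a subfield, with its denominators cleared, is primitive. *)
Lemma primitive_multiple (h : {poly ratK}) : h \is monic ->
  exists (d : {poly K}) (H : {poly {poly K}}),
    [/\ d != 0, d%:F *: h = map_poly (@tofrac _) H & forall c, map_poly (horner_eval c) H != 0].
Proof.
move=> hm; have [d0 [H0 [d00 E0]]] := clear_denominators h.
have [n] := ubnP (size d0); elim: n => // n IH in d0 H0 d00 E0 *.
rewrite ltnS => sn.
have [prim|] := pselect (forall c, map_poly (horner_eval c) H0 != 0); first by exists d0, H0.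
move/existsNP => [c /negP]; rewrite negbK => /eqP Hc.
have Hi i : ('X - c%:P) %| H0`_i.
  rewrite dvdp_XsubCl /root.
  by have := congr1 (fun t : {poly K} => t`_i) Hc; rewrite coef_map coef0 => /eqP.
have Ed0 : d0 = H0`_(size h).-1.
  have hl : h`_(size h).-1 = 1 := monicP hm.
  have := congr1 (fun t : {poly ratK} => t`_(size h).-1) E0.
  rewrite coefZ coef_map hl mulr1; exact: tofrac_inj.
have /dvdpP [d1 Ed1] := Hi (size h).-1; rewrite -Ed0 in Ed1.
have d10 : d1 != 0 by apply: contraNneq d00 => d10; rewrite Ed1 d10 mul0r.
apply: (IH d1 (\poly_(i < size H0) (H0`_i %/ ('X - c%:P)))) => //; last first.
  by apply: leq_trans sn; rewrite Ed1 size_Mmonic ?monicXsubC // size_XsubC addn2.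
have Xc0 : ('X - c%:P)%:F != 0 :> ratK by rewrite tofrac_eq0 polyXsubC_eq0.
apply/polyP => i; rewrite coefZ coef_map coef_poly /=.
apply: (mulfI Xc0); rewrite mulrA -tofracM [_ * d1]mulrC -Ed1.
have := congr1 (fun t : {poly ratK} => t`_i) E0; rewrite coefZ coef_map => -> /=.
case: ltnP => [_|/leq_sizeP /(_ i (leqnn i)) ->]; last by rewrite tofrac0 mulr0.
by rewrite -tofracM mulrC divpK.
Qed.

Lemma ratdeg_le_sizes p q : q != 0 -> p != 0 ->
  exists a b, [/\ coprimep a b, b != 0, p%:F / q%:F = a%:F / b%:F :> ratK,
    (size a <= size p)%N & (size b <= size q)%N].
Proof.
move=> q0 p0; have [a [b [cab b0 E]]] := ratfracP (p%:F / q%:F).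
suff [sa sb] : (size a <= size p)%N /\ (size b <= size q)%N by exists a, b.
have qF : q%:F != 0 :> ratK by rewrite tofrac_eq0.
have bF : b%:F != 0 :> ratK by rewrite tofrac_eq0.
move/eqP: (E); rewrite (eqr_div _ _ qF bF) -!tofracM => /eqP /tofrac_inj E2; split; apply: dvdp_leq => //.
  by rewrite -(Gauss_dvdpl _ cab) E2 dvdp_mulr.
have cba : coprimep b a by rewrite coprimep_sym.
by rewrite -(Gauss_dvdpr _ cba) -E2 dvdp_mull.
Qed.

Section Subfield.
Variables (L : ratK -> Prop).
Hypotheses (LC : forall c, L (const c)) (LB : forall u v, L u -> L v -> L (u - v)).
Hypotheses (LM : forall u v, L u -> L v -> L (u * v)) (LV : forall u, L u -> L u^-1).
Variable F : ratK.
Hypotheses (FR : is_ratfun F) (LF : L F).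

Let L0 : L 0. Proof. by rewrite -tofrac0 -polyC0. Qed.
Let LD u v : L u -> L v -> L (u + v).
Proof. by move=> hu hv; rewrite -[v]opprK -[- v]sub0r; apply/LB/LB. Qed.

Lemma subfield_rsubst u p : L u -> L (rsubst u p).
Proof.
move=> Lu; elim/poly_ind: p => [|p c IH]; first by rewrite rmorph0.
by rewrite rmorphD rmorphM /= rsubstC rsubstX; apply: LD (LC _); exact: LM.
Qed.

Lemma subfield_comp u v : is_ratfun u -> L u -> L (ratcomp v u).
Proof.
move=> uR Lu; have [p [q [_ q0 ->]]] := ratfracP v; rewrite ratcompE //.
by apply: LM; [|apply: LV]; exact: subfield_rsubst.
Qed.

Lemma subfield_minpoly : exists h : {poly ratK}, [/\ h \is monic, forall i, L h`_i, h.[x] = 0 &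
  forall P : {poly ratK}, (forall i, L P`_i) -> P.[x] = 0 -> (size P < size h)%N -> P = 0].
Proof.
pose Q n := `[< exists h : {poly ratK}, [/\ h != 0, forall i, L h`_i, h.[x] = 0 & size h = n] >].
have exQ : exists n, Q n.
  have [a [b [cab b0 EF]]] := ratfracP F; have sr := ratdegS cab b0 EF.
  exists (ratdeg F).+1; apply/asboolP; exists (fibpoly F a b).
  have sF : size (fibpoly F a b) = (ratdeg F).+1 by rewrite size_fibpoly.
  split=> //; first by rewrite -size_poly_gt0 sF.
    by move=> i; rewrite coef_fibpoly; apply: LB => //; exact: LM.
  have bF : b%:F != 0 :> ratK by rewrite tofrac_eq0.
  rewrite /fibpoly hornerD hornerN hornerZ -[(map_poly _ a).[x]]/(rsubst x a).
  rewrite -[(map_poly _ b).[x]]/(rsubst x b) !rsubst_var {1}EF.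
  by rewrite divfK ?subrr.
case: (ex_minnP exQ) => n /asboolP [h [h0 Lh hx sh]] min.
have l0 : lead_coef h != 0 by rewrite lead_coef_eq0.
exists ((lead_coef h)^-1 *: h); split.
- by rewrite monicE lead_coefZ mulVf.
- by move=> i; rewrite coefZ; apply: LM => //; apply: LV; exact: Lh.
- by rewrite hornerZ hx mulr0.
move=> P LP Px; rewrite size_scale ?invr_eq0 // sh ltnNge => sP; apply/eqP; apply: contraNT sP => P0.
by apply: min; apply/asboolP; exists P.
Qed.

(** [W] is a nonconstant coefficient of the minimal polynomial h of z over [L]. With W = a / b, h
    divides a(T) - W b(T), and the point is that both have degree deg W: then K(z) has the same
    degree over [L] as over K(W), so the two fields agree. *)
Lemma luroth_subfield : exists W, [/\ is_ratfun W, L W & forall f, L f -> exists f', f = ratcomp f' W].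
Proof.
have [h [hm Lh hx hmin]] := subfield_minpoly.
have h0 : h != 0 by rewrite monic_neq0.
have dvd_h (P : {poly ratK}) : (forall i, L P`_i) -> P.[x] = 0 -> exists g : {poly ratK}, P = g * h.
  move=> LP Px; have [q [r [E Lr sr]]] := monic_division LB LM L0 hm Lh LP.
  exists q; rewrite [LHS]E [X in _ + X]hmin ?addr0 //.
  by move: Px; rewrite E hornerD hornerM hx mulr0 add0r.
(* Otherwise z would be algebraic over K. *)
have [k kR] : exists k, is_ratfun h`_k.
  apply: contrapT => nk.
  have /choice [cf cfE] : forall k, exists c, h`_k = const c.
    by move=> k; apply: constP => hk; apply: nk; exists k.
  have E : h = map_poly (@tofrac _ \o polyC) (\poly_(i < size h) cf i).
    apply/polyP => i; rewrite coef_map coef_poly cfE /=.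
    case: ltnP => // /leq_sizeP /(_ i (leqnn i)); rewrite cfE => -> //.
  move: hx; rewrite E -[_.[x]]/(rsubst x _) rsubst_var => /eqP.
  by rewrite tofrac_eq0 => /eqP p0; move/eqP: h0; rewrite E p0 rmorph0.
have [d [H [d0 EH primH]]] := primitive_multiple hm.
have dF : d%:F != 0 :> ratK by rewrite tofrac_eq0.
set W := h`_k in kR.
have EW : W = (H`_k)%:F / d%:F.
  have := congr1 (fun t : {poly ratK} => t`_k) EH; rewrite coefZ coef_map => /= <-.
  by rewrite mulrC mulKf.
have Ed : d = H`_(size h).-1.
  have hl : h`_(size h).-1 = 1 := monicP hm.
  have := congr1 (fun t : {poly ratK} => t`_(size h).-1) EH.
  rewrite coefZ coef_map hl mulr1; exact: tofrac_inj.
have Hk0 : H`_k != 0.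
  by apply: contraTneq (ratfun_neq0 kR) => Hk; rewrite EW Hk tofrac0 mul0r eqxx.
have [a [b [cab b0 Eab sa sb]]] := ratdeg_le_sizes d0 Hk0.
rewrite -EW in Eab; have sr := ratdegS cab b0 Eab.
have sW : (ratdeg W < size (swapXY H))%N.
  rewrite -sr geq_max; apply/andP; split.
    exact: leq_trans sa (size_coef_swapXY _ _).
  by apply: leq_trans sb _; rewrite Ed size_coef_swapXY.
have LW : L W by exact: Lh.
have bF : b%:F != 0 :> ratK by rewrite tofrac_eq0.
have LPW i : L (fibpoly W a b)`_i by rewrite coef_fibpoly; apply: LB => //; exact: LM.
have PWx : (fibpoly W a b).[x] = 0.
  rewrite /fibpoly hornerD hornerN hornerZ -[(map_poly _ a).[x]]/(rsubst x a).
  rewrite -[(map_poly _ b).[x]]/(rsubst x b) !rsubst_var {1}Eab.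
  by rewrite divfK ?subrr.
have [g Eg] := dvd_h _ LPW PWx.
pose Phi : {poly {poly K}} := b *: map_poly polyC a - a *: map_poly polyC b.
have PhiE : map_poly (@tofrac _) Phi = b%:F *: fibpoly W a b.
  apply/polyP => i; rewrite coef_map coefZ coef_fibpoly coefB !coefZ !coef_map /=.
  rewrite tofracB !tofracM mulrBr mulrA; congr (_ - _ * _).
  by rewrite Eab mulrC divfK.
have [e [G' [e0 EG]]] := clear_denominators g.
have [S ES] : exists S, Phi = H * S.
  apply: (gauss_dvd (e := e * d) (S := b *: G')) => //; first by rewrite mulf_neq0.
  apply: (map_inj_poly (@tofrac_inj _) (tofrac0 _)).
  rewrite map_tofracZ PhiE Eg map_tofracM map_tofracZ -EH -EG tofracM.
  rewrite -!scalerAr -!scalerAl !scalerA [h * g]mulrC; congr (_ *: _).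
  by rewrite -[RHS]mulrA mulrC.
have sPhi : size Phi = (ratdeg W).+1.
  have <- : size (map_poly (@tofrac _) Phi) = size Phi.
    by rewrite size_map_inj_poly ?tofrac0 //; exact: tofrac_inj.
  by rewrite PhiE size_scale // size_fibpoly.
have Phi0 : Phi != 0 by rewrite -size_poly_gt0 sPhi.
have S0 : S != 0 by apply: contraNneq Phi0 => S0; rewrite ES S0 mulr0.
have H0 : H != 0 by apply: contraNneq Phi0 => H0; rewrite ES H0 mul0r.
(* In the variable z, [Phi] has degree at most deg W and [H] at least deg W, as d and d W are among
   its coefficients; hence [S] does not involve z. *)
have [q Eq] : exists q : {poly K}, S = map_poly polyC q.
  exists ((swapXY S)`_0); rewrite -swapXY_polyC -[LHS]swapXYK; congr swapXY.
  apply: size1_polyC.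
  have sSP : (size (swapXY Phi) <= (ratdeg W).+1)%N.
    apply/leq_sizeP => j hj; apply/polyP => i; rewrite coef_swapXY coef0.
    rewrite coefB !coefZ !coef_map /= coefB !coefMC.
    have sa' : (size a <= j)%N by apply: leq_trans hj; rewrite -sr leq_maxl.
    have sb' : (size b <= j)%N by apply: leq_trans hj; rewrite -sr leq_maxr.
    by rewrite (leq_sizeP _ _ sa' j (leqnn j)) (leq_sizeP _ _ sb' j (leqnn j)) !mul0r subrr.
  have Hs0 : swapXY H != 0 by rewrite swapXY_eq0.
  have Ss0 : swapXY S != 0 by rewrite swapXY_eq0.
  move: sSP; rewrite ES rmorphM size_mul //=.
  exact: leq1_of_add.
(* A root t of [q] would give b a(t) = a b(t); as W is not constant, a(t) = b(t) = 0, against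
   coprimality. *)
have sq : size q = 1%N.
  apply/eqP; apply: contraT => /closed_rootP [t /eqP qt]; exfalso.
  have : Phi.[t%:P] = 0 by rewrite ES Eq hornerM horner_map /= qt mulr0.
  rewrite /Phi hornerD hornerN !hornerZ !horner_map /= => /(congr1 (@tofrac _)) /eqP.
  rewrite tofracB !tofracM tofrac0 subr_eq0 => /eqP E.
  have [a0 b0'] : a.[t] = 0 /\ b.[t] = 0.
    apply: (const_lin_eq0 kR); apply: (mulfI bF); rewrite mulr0 mulrBr E mulrA.
    have -> : b%:F * W = a%:F by rewrite Eab mulrC divfK.
    by rewrite subrr.
  by move/coprimep_root: cab => /(_ t); rewrite /root a0 b0' eqxx => /(_ isT).
have sh : size h = (ratdeg W).+1.
  rewrite -(size_scale h dF).
  rewrite EH size_map_inj_poly ?tofrac0 //; last exact: tofrac_inj.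
  rewrite -sPhi ES Eq (size1_polyC (eq_leq sq)) map_polyC size_mul //; last first.
    by rewrite Eq (size1_polyC (eq_leq sq)) map_polyC in S0.
  rewrite size_polyC; case: eqVneq => [E|_]; last by rewrite addn1.
  by move: S0; rewrite Eq (size1_polyC (eq_leq sq)) map_polyC /= E eqxx.
(* Over K(W), f is the value at z of a polynomial p of degree less than deg W. Then p - f has its
   coefficients in [L] and kills z, so it vanishes by minimality of h, and f is the constant
   coefficient of p. *)
exists W; split=> // f Lf; have [p sp pE] := ratfun_span kR f.
exists p`_0; pose P := map_poly (comp_right kR) p - f%:P.
have P0 : P = 0.
  apply: hmin.
  - move=> i; rewrite coefB coef_map coefC; apply: LB; first exact: subfield_comp.
    by case: (i == 0)%N.
  - by rewrite hornerD hornerN hornerC -[_.[x]]/(subeval (comp_right kR) x p) pE subrr.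
  rewrite sh ltnS; apply: leq_trans (size_polyD _ _) _; rewrite geq_max size_polyN.
  rewrite (leq_trans (size_poly _ _) sp) (leq_trans (size_polyC_leq1 _)) //.
  exact/ratfun_deg.
have P0E : P`_0 = ratcomp p`_0 W - f.
  rewrite /P coefB coefC eqxx; congr (_ - _).
  exact: coef_map.
rewrite P0 coef0 in P0E.
apply: esym.
apply: subr0_eq.
exact: esym P0E.
Qed.
End Subfield.

(** A generator W of K(F, G) is factored out on the right; what remains generates K(z). *)
Theorem luroth2 F G : is_ratfun F -> exists W F' G' (F'R : is_ratfun F'),
  [/\ is_ratfun W, F = ratcomp F' W, G = ratcomp G' W & gen F'R G' x].
Proof.
move=> FR; have [W [WR [p pW] WL]] := luroth_subfield (genC FR G) (@genB _ _ FR G) (@genM _ _ FR G)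
  (@genV _ _ FR G) FR (genF FR G).
have [F' EF] := WL _ (genF FR G); have [G' EG] := WL _ (genG FR G).
have F'R : is_ratfun F' by move=> c Ec; apply: (FR c); rewrite EF Ec ratcompC.
exists W, F', G', F'R; split=> //; subst F G.
by apply/(gen_compr F'R G' WR FR); rewrite ratcomp_varl //; exists p.
Qed.

End Luroth.

Lemma gcdp_bezout (F : fieldType) (p q : {poly F}) : exists u v, gcdp p q = u * p + v * q.
Proof.
have [[u v] /= /eqpP [[c1 c2] /= /andP [c10 c20] E]] := Bezoutp p q.
exists (c2^-1 *: (c1 *: u)), (c2^-1 *: (c1 *: v)).
by rewrite -!scalerAl -!scalerDr E scalerA mulVf ?scale1r.
Qed.

Lemma size_cofactor (R : idomainType) (e d P : {poly R}) :
  e != 0 -> d != 0 -> e * d = P -> (1 < size d)%N -> (size e < size P)%N.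
Proof.
move=> e0 d0 <- sd; rewrite size_mul //; rewrite -size_poly_gt0 in e0.
by move: e0 sd; move: (size e) (size d); lia.
Qed.

(** * Commutative squares and stages *)

Section GoodSquares.
Variable K : numClosedFieldType.
Local Notation ratK := {fraction {poly K}}.
Local Notation const c := (@tofrac {poly K} (polyC c)).
Local Notation x := (ratvar K).

Lemma fibpoly_square (C X Y B : ratK) (YR : is_ratfun Y) p q : is_ratfun B -> q != 0 ->
  X = p%:F / q%:F -> ratcomp X B = ratcomp C Y ->
  subeval (comp_right YR) B (fibpoly C p q) = 0.
Proof.
move=> BR q0 -> E; rewrite subeval_fibpoly -E (ratcompE _ BR q0).
have q0' : rsubst B q != 0 by exact: ratsubst_neq0.
by rewrite (divfK q0') subrr.
Qed.

(** K(Y, B) = K(z) has degree deg Y over K(Y), and B is a root of X(T) - C(Y), of degree deg X. *)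
Lemma square_deg_le (C X Y B : ratK) (YR : is_ratfun Y) :
  is_ratfun C -> is_ratfun X -> is_ratfun B ->
  ratcomp X B = ratcomp C Y -> gen YR B x -> (ratdeg Y <= ratdeg X)%N.
Proof.
move=> CR XR BR E gx; have [p [q [cpq q0 EX]]] := ratfracP X.
have sX := ratdegS cpq q0 EX; rewrite -ltnS -sX -(size_fibpoly p q CR).
apply: (gen_size gx); last exact: fibpoly_square EX E.
by rewrite -size_poly_gt0 size_fibpoly // sX.
Qed.

(* The second square shows that X(T) - C is irreducible, hence is the minimal polynomial of B
   over K(Y) in the first square. *)
Lemma square_deg_rigid (C X Y B Y' B' : ratK) (YR : is_ratfun Y) (Y'R : is_ratfun Y') :
  is_ratfun C -> is_ratfun X -> is_ratfun B -> is_ratfun B' ->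
  ratcomp X B = ratcomp C Y -> gen YR B x ->
  ratcomp X B' = ratcomp C Y' -> gen Y'R B' x ->
  ratdeg Y' = ratdeg X -> ratdeg Y = ratdeg X.
Proof.
move=> CR XR BR B'R E gx E' gx' dY'.
apply/eqP; rewrite eqn_leq (square_deg_le CR XR BR E gx) /= leqNgt; apply/negP => dYX.
have [p [q [cpq q0 EX]]] := ratfracP X; have sX := ratdegS cpq q0 EX.
have PhiE := fibpoly_square YR BR q0 EX E; have PhiE' := fibpoly_square Y'R B'R q0 EX E'.
have := size_fibpoly p q CR; rewrite sX; move: PhiE PhiE'; set Phi := fibpoly C p q => PhiE PhiE' sPhi.
(* B has an annihilator of degree at most deg Y < deg X, so its gcd with X(T) - C is a proper
   factor. In the second square B' kills this factor or its cofactor, and both are too small. *)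
have [pi [pi0 spi piE]] := annihilator YR B.
have dE : subeval (comp_right YR) B (gcdp pi Phi) = 0.
  have [u [v ->]] := gcdp_bezout pi Phi.
  by rewrite subevalD !subevalM piE PhiE !mulr0 addr0.
have d0 : gcdp pi Phi != 0 by rewrite gcdp_eq0 (negPf pi0).
have Phi0 : Phi != 0 by rewrite -size_poly_gt0 sPhi.
have ED := divpK (dvdp_gcdr pi Phi).
have sd : (size (gcdp pi Phi) <= ratdeg X)%N.
  apply: leq_trans (leq_trans spi dYX); exact: (dvdp_leq pi0 (dvdp_gcdl _ _)).
have sd1 : (1 < size (gcdp pi Phi))%N.
  have := gen_size gx d0 dE; apply: leq_ltn_trans; exact/ratfun_deg.
move: (gcdp pi Phi) d0 dE ED sd sd1 => dd d0 dE ED sd sd1.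
have e0 : Phi %/ dd != 0 by apply: contraNneq Phi0 => e0; rewrite -ED e0 mul0r.
have se := size_cofactor e0 d0 ED sd1; rewrite sPhi ltnS in se.
move/eqP: PhiE'; rewrite -ED subevalM mulf_eq0 => /orP [/eqP h|/eqP h].
  by have := gen_size gx' e0 h; rewrite dY' ltnNge se.
by have := gen_size gx' d0 h; rewrite dY' ltnNge sd.
Qed.

Section Stages.
Variables (A Q : ratK) (AR : is_ratfun A) (QR : is_ratfun Q) (d : nat).

(* R generates the compositum of K(Q) and K(A^(d-k)) inside K(z). *)
Definition stage k X R := [/\ is_ratfun X, is_ratfun R, ratiter A (d - k)%N = ratcomp X R,
  exists2 B, is_ratfun B & Q = ratcomp B R & gen (ratfun_iter (d := (d - k)%N) AR) Q R].

Lemma ratfun_compl (f g : ratK) : is_ratfun g -> is_ratfun (ratcomp f g) -> is_ratfun f.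
Proof. by move=> gR fgR c E; apply: (fgR c); rewrite E ratcompC. Qed.

Lemma stage_exists k : exists XR, stage k XR.1 XR.2.
Proof.
have [W [F' [G' [F'R [WR EF EG gx]]]]] := luroth2 Q (ratfun_iter (d := (d - k)%N) AR).
exists (F', W); split=> //=.
  by exists G' => //; apply: (ratfun_compl WR); rewrite -EG.
have FWR : is_ratfun (ratcomp F' W) by rewrite -EF; exact: ratfun_iter.
have [p pE] := gx; exists p; rewrite -[RHS](ratcomp_varl WR) -pE.
rewrite -(subeval_compr F'R G' WR FWR) -EG.
by rewrite /subeval; congr (_.[_]); apply: eq_map_poly => u; rewrite /= /comp_right EF.
Qed.

(** [R] is an expression in A^(d-k) and [Q], which are both functions of [S]; this gives C. Since
    [Q] is also a function of [R], and [S] an expression in A^(d-l) and [Q], removing [S] on the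
    right leaves K(Y, C) = K(z). *)
Lemma stage_square k l X R Y S : (k <= l)%N -> (l <= d)%N -> stage k X R -> stage l Y S ->
  exists C (YR : is_ratfun Y), [/\ is_ratfun C, R = ratcomp C S,
    ratcomp X C = ratcomp (ratiter A (l - k)%N) Y & gen YR C x].
Proof.
move=> kl ld [XR RR EX [B BR EQ] gR] [YR SR EY [B' B'R EQ'] gS].
have F'R : is_ratfun (ratcomp (ratiter A (l - k)%N) Y) by apply: ratfun_comp => //; exact: ratfun_iter.
have EA : ratiter A (d - k)%N = ratcomp (ratcomp (ratiter A (l - k)%N) Y) S.
  rewrite -(ratcompA _ YR SR) -EY -ratiterD //; congr ratiter.
  by rewrite addnBAC // subnKC.
case: gR => p pE; pose C := subeval (comp_right F'R) B' p.
have ERC : R = ratcomp C S.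
  have FWR : is_ratfun (ratcomp (ratcomp (ratiter A (l - k)%N) Y) S) by exact: ratfun_comp.
  rewrite -(subeval_compr F'R B' SR FWR) -EQ' -[LHS]pE.
  by rewrite /subeval; congr (_.[_]); apply: eq_map_poly => u; rewrite /= /comp_right EA.
have CR : is_ratfun C by apply: (ratfun_compl SR); rewrite -ERC.
exists C, YR; split=> //.
  by apply: (ratcomp_inj SR); rewrite -(ratcompA _ CR SR) -ERC -EX EA.
have gx : gen YR B' x.
  have FWR : is_ratfun (ratcomp Y S) by rewrite -EY; exact: ratfun_iter.
  apply/(gen_compr YR B' SR FWR); rewrite ratcomp_varl // -EQ'.
  case: gS => p' p'E; exists p'; rewrite -[RHS]p'E.
  by rewrite /subeval; congr (_.[_]); apply: eq_map_poly => u; rewrite /= /comp_right EY.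
apply: (gen_sub (genF YR C) _ gx).
have -> : B' = ratcomp B C.
  by apply: (ratcomp_inj SR); rewrite -EQ' EQ ERC ratcompA.
exact: gen_ratcomp CR (genG YR C).
Qed.

Lemma stage_last X R : stage d X R -> ratdeg X = 1%N.
Proof.
case=> XR RR; rewrite subnn /= => E _ _.
have := ratdeg_comp XR RR; rewrite -E ratdeg_var => /esym /eqP.
by rewrite muln_eq1 => /andP [/eqP].
Qed.

Lemma stage_first X : is_ratfun X -> ratiter A d = ratcomp X Q -> stage 0 X Q.
Proof.
move=> XR E; split=> //; first by rewrite subn0.
  by exists x; [exact: ratfun_var | rewrite ratcomp_varl].
exact: genG.
Qed.

Lemma stage_conclude N X Y S : is_ratfun X -> ratiter A d = ratcomp X Q -> (N <= d)%N ->
  stage N Y S -> ratdeg Y = 1%N ->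
  exists Q', [/\ is_ratfun Q', ratiter A N = ratcomp X Q' & Q = ratcomp Q' (ratiter A (d - N)%N)].
Proof.
move=> XR E Nd stN Y1; have [C [YR [CR EQ EX gx]]] := stage_square (leq0n N) Nd (stage_first XR E) stN.
have [nu [nuM Ynu nuY]] := moebius_inv (moebius_deg Y1); have nuR := moebius_ratfun nuM.
have [_ SR EY _ _] := stN.
(* As deg Y = 1, the square X o C = A^N o Y can be solved for A^N; R' is C o Y^-1. *)
exists (ratcomp C nu); split; first exact: ratfun_comp.
  rewrite ratcompA // EX subn0 -ratcompA // Ynu ratcomp_varr; reflexivity.
by rewrite EY -(ratcompA C nuR (ratfun_comp YR SR)) (ratcompA nu YR SR) nuY ratcomp_varl.
Qed.
End Stages.
End GoodSquares.

Lemma addf_frac (F : fieldType) (a b c d : F) : b != 0 -> d != 0 ->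
  a / b + c / d = (a * d + c * b) / (b * d).
Proof. by move=> ? ?; rewrite addf_div. Qed.

Lemma divf_cancel (F : fieldType) (a b c : F) : c != 0 -> (a / c) / (b / c) = a / b.
Proof. by move=> c0; rewrite invf_div mulrA divfK. Qed.

Lemma expV_mul (F : fieldType) (y : F) i m : y != 0 -> (i <= m)%N ->
  y^-1 ^+ i * y ^+ m = y ^+ (m - i).
Proof.
move=> y0 im; rewrite -{1}(subnK im) exprD exprVn mulrC mulfK //.
by rewrite expf_neq0.
Qed.

Lemma rev_index k m s : (0 < s -> s <= m.+1 -> m.+1 < s + k -> m - s.-1 < k /\ s.-1 <= m)%N.
Proof. by lia. Qed.

Lemma rev_size k m s t : (0 < s -> 0 < k -> s + k <= m.+1 -> maxn s t = m.+1 -> k <= m /\ t = m.+1)%N.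
Proof. by lia. Qed.

Lemma rev_high k m s j : (s + k <= m.+1 -> j < k -> s <= m - j)%N.
Proof. by lia. Qed.

Lemma rev_lt k m j : (k <= j -> k <= m -> (j - k < m.+1 - k) = (j < m.+1))%N.
Proof. by move=> ? ?; apply/idP/idP; lia. Qed.

(** * Order of vanishing *)

Section Vanishing.
Variable K : numClosedFieldType.
Local Notation ratK := {fraction {poly K}}.
Local Notation const c := (@tofrac {poly K} (polyC c)).
Local Notation x := (ratvar K).

(* The function [u] is regular at 0 with value [c]. *)
Definition val0 (u : ratK) (c : K) := exists n d : {poly K},
  [/\ d.[0] != 0, n.[0] = c * d.[0] & u = n%:F / d%:F].

(* The order of vanishing at 0 is at least k. *)
Definition van k (f : ratK) := exists u c, f = x ^+ k * u /\ val0 u c.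

Lemma horner0_neq0 (d : {poly K}) (c : K) : d.[c] != 0 -> d%:F != 0 :> ratK.
Proof. by move=> d0; rewrite tofrac_eq0; apply: contraNneq d0 => ->; rewrite horner0. Qed.

Lemma val0_poly p : val0 p%:F p.[0].
Proof.
exists p, 1; rewrite hornerC oner_neq0 mulr1; split=> //.
by rewrite tofrac1 divr1.
Qed.

Lemma val0M u v c e : val0 u c -> val0 v e -> val0 (u * v) (c * e).
Proof.
move=> [n [d [d0 n0 ->]]] [n' [d' [d0' n0' ->]]]; exists (n * n'), (d * d'); split.
- by rewrite hornerM mulf_neq0.
- by rewrite !hornerM n0 n0' mulrACA.
by rewrite !tofracM mulf_div.
Qed.

Lemma val0D u v c e : val0 u c -> val0 v e -> val0 (u + v) (c + e).
Proof.
move=> [n [d [d0 n0 ->]]] [n' [d' [d0' n0' ->]]]; exists (n * d' + n' * d), (d * d'); split.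
- by rewrite hornerM mulf_neq0.
- by rewrite hornerD !hornerM n0 n0'; ring.
by rewrite (addf_frac _ _ (horner0_neq0 d0) (horner0_neq0 d0')) tofracD !tofracM.
Qed.

Lemma val0V u c : c != 0 -> val0 u c -> val0 u^-1 c^-1.
Proof.
move=> c0 [n [d [d0 n0 ->]]]; exists d, n; split.
- by rewrite n0 mulf_neq0.
- by rewrite n0 mulKf.
by rewrite invf_div.
Qed.

Lemma val0_van k u c : (0 < k)%N -> val0 u c -> val0 (x ^+ k * u) 0.
Proof.
move=> k0 uc; rewrite -[0](mul0r c); apply: val0M uc.
have := val0_poly 'X^k; rewrite hornerXn expr0n (gtn_eqF k0) tofracXn; exact.
Qed.

Lemma van_val0 f : van 1 f -> val0 f 0.
Proof. by case=> u [c [-> uc]]; exact: val0_van uc. Qed.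

Lemma val0_rsubst g p : val0 g 0 -> val0 (rsubst g p) p.[0].
Proof.
move=> g0; elim/poly_ind: p => [|p c IH].
  by rewrite rmorph0 horner0 -tofrac0; have := val0_poly 0; rewrite horner0.
rewrite rmorphD rmorphM /= rsubstC rsubstX hornerD hornerM hornerX hornerC mulr0.
apply: val0D; last by have := val0_poly c%:P; rewrite hornerC.
by rewrite -(mulr0 p.[0]); exact: val0M.
Qed.

Lemma vanM k f u c : van k f -> val0 u c -> van k (f * u).
Proof.
move=> [v [e [-> ve]]] uc; exists (v * u), (e * c); split; last exact: val0M.
by rewrite mulrA.
Qed.

Lemma vanX k f : van 1 f -> van k (f ^+ k).
Proof.
move=> [u [c [-> uc]]]; elim: k => [|k [v [e [E ve]]]].
  exists 1, 1; rewrite !expr0 mulr1; split=> //.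
  by have := val0_poly 1; rewrite tofrac1 hornerC.
exists (u * v), (c * e); split; last exact: val0M.
by rewrite exprS E expr1 exprS mulrACA.
Qed.

Lemma van_numden k (n d : {poly K}) : d != 0 -> van k (n%:F / d%:F) -> 'X^k %| n.
Proof.
move=> d0 [u [c [E [un [ud [ud0 _ Eu]]]]]].
have dF : d%:F != 0 :> ratK by rewrite tofrac_eq0.
have udF := horner0_neq0 ud0.
have E2 : n%:F / d%:F = ('X^k * un)%:F / ud%:F :> ratK.
  by rewrite E Eu tofracM tofracXn mulrA.
move/eqP: E2; rewrite (eqr_div _ _ dF udF) -!tofracM => /eqP /tofrac_inj E2.
have cX : coprimep 'X^k ud.
  by rewrite coprimep_sym coprimep_expr // coprimepX /root.
rewrite -(Gauss_dvdpl _ cX) E2 -mulrA dvdp_mulr //.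
Qed.

Lemma numden_van k p d : d.[0] != 0 -> van k (('X^k * p)%:F / d%:F).
Proof.
move=> d0; exists (p%:F / d%:F), (p.[0] / d.[0]); rewrite tofracM tofracXn mulrA; split=> //.
by exists p, d; rewrite divfK.
Qed.

Lemma ratsubst_shift c p : ratsubst p (x + const c) = (p \Po ('X + c%:P))%:F.
Proof.
elim/poly_ind: p => [|p e IH].
  by rewrite comp_poly0 tofrac0; exact: (rmorph0 (rsubst _)).
rewrite ratsubstD ratsubstM IH ratsubstC ratsubstX comp_polyD comp_polyM comp_polyX comp_polyC.
by rewrite !tofracD !tofracM tofracD.
Qed.

Lemma comp_shiftK c p : (p \Po ('X + c%:P)) \Po ('X - c%:P) = p :> {poly K}.
Proof. by rewrite -comp_polyA comp_polyD comp_polyX comp_polyC subrK comp_polyXr. Qed.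

Lemma van_shiftP k c f n d : coprimep n d -> d != 0 -> f = n%:F / d%:F ->
  (0 < k)%N -> van k (ratcomp f (x + const c)) <-> ('X - c%:P) ^+ k %| n.
Proof.
move=> cnd d0 -> k0; have sR := moebius_ratfun (moebius_add c).
rewrite (ratcompE _ sR d0) !ratsubst_shift.
have sX : (1 < size ('X + c%:P)%R)%N by rewrite -[c]opprK polyCN size_XsubC.
split=> [/van_numden|].
  rewrite comp_poly_eq0 // d0 => /(_ isT) /(dvdp_comp_poly ('X - c%:P)).
  by rewrite comp_shiftK comp_Xn_poly.
case/dvdpP => m Em.
have -> : n \Po ('X + c%:P) = 'X^k * (m \Po ('X + c%:P)).
  rewrite Em comp_polyM mulrC; congr (_ * _).
  transitivity ((('X - c%:P) \Po ('X + c%:P)) ^+ k); first exact: rmorphXn.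
  by rewrite comp_polyB comp_polyX comp_polyC addrK.
apply: numden_van; rewrite horner_comp !hornerE /=.
have : root n c by rewrite Em rootM; apply/orP; right; rewrite -(prednK k0) exprS rootM root_XsubC eqxx.
by move/coprimep_root: cnd => H /H.
Qed.

(* The reversal of p, as a polynomial of formal degree m. *)
Definition revp m (p : {poly K}) : {poly K} := \poly_(j < m.+1) p`_(m - j).

Lemma ratsubst_rev m (p : {poly K}) : (size p <= m.+1)%N -> ratsubst p x^-1 = (revp m p)%:F / x ^+ m.
Proof.
move=> sp; have x0 : x != 0 by exact: ratfun_neq0 (@ratfun_var K).
have xm0 : x ^+ m != 0 by rewrite expf_neq0.
apply: (mulIf xm0); rewrite divfK // /ratsubst (horner_coef_wide (n := m.+1)); last first.
  by apply: leq_trans (size_poly _ _) sp.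
rewrite /revp poly_def rmorph_sum mulr_suml [RHS](reindex_inj rev_ord_inj) /=.
apply: eq_bigr => i _; rewrite coef_map /= -mul_polyC tofracM tofracXn subSS.
have im : (i <= m)%N by rewrite -ltnS.
rewrite subKn // -mulrA; congr (_ * _).
exact: expV_mul x0 im.
Qed.

(** Inversion reverses the numerator and the denominator. The order of vanishing at infinity is deg
    d - deg n, and deg d = deg f as soon as it is positive. *)
Lemma van_invP k f n d : coprimep n d -> d != 0 -> n != 0 -> f = n%:F / d%:F -> (0 < k)%N ->
  van k (ratcomp f x^-1) <-> (size n + k <= (ratdeg f).+1)%N.
Proof.
move=> cnd d0 n0 Ef k0; have VR := moebius_ratfun (moebius_V K).
have sm := ratdegS cnd d0 Ef; move: (ratdeg f) sm => m sm.
have sn : (size n <= m.+1)%N by rewrite -sm leq_maxl.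
have sd : (size d <= m.+1)%N by rewrite -sm leq_maxr.
have x0 : x != 0 by exact: ratfun_neq0 (@ratfun_var K).
have -> : ratcomp f x^-1 = (revp m n)%:F / (revp m d)%:F.
  rewrite Ef (ratcompE _ VR d0) (ratsubst_rev sn) (ratsubst_rev sd).
  exact: (divf_cancel _ _ (expf_neq0 m x0)).
split=> [/van_numden|].
  have rd0 : revp m d != 0.
    apply: contraNneq d0 => rd0; apply/eqP/polyP => j; rewrite coef0.
    have [jm|jm] := leqP j m; last by rewrite (leq_sizeP _ _ sd).
    have := congr1 (fun t : {poly K} => t`_(m - j)) rd0.
    by rewrite coef0 coef_poly ltnS leq_subr subKn.
  move/(_ rd0)/dvdpP => [g Eg].
  have sn0 : (0 < size n)%N by rewrite size_poly_gt0.
  rewrite leqNgt; apply/negP => lt_m.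
  have [h1 h2] := rev_index sn0 sn lt_m.
  have := congr1 (fun t : {poly K} => t`_(m - (size n).-1)) Eg.
  rewrite coefMXn h1 coef_poly ltnS leq_subr subKn //.
  by move/eqP; rewrite -[n`_ _]/(lead_coef n) lead_coef_eq0 (negPf n0).
move=> snk; have [km sdm] : (k <= m)%N /\ size d = m.+1.
  have sn0 : (0 < size n)%N by rewrite size_poly_gt0.
  exact: rev_size sn0 k0 snk sm.
have -> : revp m n = 'X^k * \poly_(j < m.+1 - k) n`_(m - (j + k)).
  apply/polyP => j; rewrite coefXnM !coef_poly; have [jk|kj] := ltnP j k.
    case: ifP => // jm; rewrite (leq_sizeP _ _ (leqnn (size n))) //.
    exact: rev_high snk jk.
  by rewrite subnK // (rev_lt kj km).
apply: numden_van; rewrite horner_coef0 coef_poly /= subn0.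
have := lead_coef_eq0 d; rewrite lead_coefE sdm /= => ->; exact: d0.
Qed.

End Vanishing.

(** * Points of a square of full degree *)

Lemma map_poly_pencil (F R S : comNzRingType) (cc : {rmorphism F -> R}) (ev : {rmorphism R -> S})
    (t : R) (p q : {poly F}) :
  map_poly ev (map_poly cc p - t *: map_poly cc q) =
  map_poly (ev \o cc) p - ev t *: map_poly (ev \o cc) q.
Proof.
apply/polyP => i; rewrite coef_map !coefB !coefZ !coef_map /=.
by rewrite rmorphB rmorphM.
Qed.

Section Surjectivity.
Variable K : numClosedFieldType.
Local Notation ratK := {fraction {poly K}}.
Local Notation const c := (@tofrac {poly K} (polyC c)).
Local Notation x := (ratvar K).

Lemma van_num0 (n d : {poly K}) : coprimep n d -> d != 0 -> van 1 (n%:F / d%:F) ->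
  n.[0] = 0 /\ d.[0] != 0.
Proof.
move=> cnd d0 /(van_numden d0); rewrite expr1 -[X in X %| _]subr0 -polyC0 dvdp_XsubCl => rn.
by split; [apply/eqP|move/coprimep_root: cnd; apply].
Qed.

(* With C = cn / cd and X = p / q, the polynomial X(T) - C(x) up to the factor cd(x) q(T). *)
Definition bifib (cn cd p q : {poly K}) : {poly {poly K}} :=
  cd *: map_poly polyC p - cn *: map_poly polyC q.

Lemma map_bifib C cn cd p q : cd != 0 -> C = cn%:F / cd%:F ->
  map_poly (@tofrac _) (bifib cn cd p q) = cd%:F *: fibpoly C p q.
Proof.
move=> cd0 EC; have cdF : cd%:F != 0 :> ratK by rewrite tofrac_eq0.
apply/polyP => i; rewrite coef_map coefZ coef_fibpoly coefB !coefZ !coef_map /=.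
rewrite tofracB !tofracM mulrBr mulrA; congr (_ - _ * _).
by rewrite EC mulrC divfK.
Qed.

Lemma horner_bifib cn cd p q c :
  map_poly (horner_eval c) (bifib cn cd p q) = cd.[c] *: p - cn.[c] *: q.
Proof.
apply/polyP => i; rewrite coef_map coefB !coefZ !coef_map coefB !coefZ /=.
by rewrite /horner_eval hornerD hornerN !hornerM !hornerC.
Qed.

Lemma bifib_primitive cn cd p q : coprimep cn cd -> coprimep p q ->
  q != 0 -> is_ratfun (p%:F / q%:F) ->
  forall c, map_poly (horner_eval c) (bifib cn cd p q) != 0.
Proof.
move=> cc cpq q0 XR c; rewrite horner_bifib; apply/negP => /eqP E.
have qF : q%:F != 0 :> ratK by rewrite tofrac_eq0.
have [cn0 cd0] : cn.[c] = 0 /\ cd.[c] = 0.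
  apply: (const_lin_eq0 XR); apply: (mulIf qF).
  rewrite mul0r mulrBl mulrAC (divfK qF) -!tofracM -tofracB -tofrac0; congr tofrac.
  rewrite [p * _]mulrC !mul_polyC.
  by have := congr1 -%R E; rewrite oppr0 opprB.
by move/coprimep_root: cc => /(_ c); rewrite /root cn0 cd0 eqxx => /(_ isT).
Qed.

(* In full degree the fibre product of C and X is irreducible, so z |-> (Y, B) is onto it. *)
Lemma square_surjective C X Y B (YR : is_ratfun Y) : is_ratfun C -> is_ratfun X -> is_ratfun B ->
  ratcomp X B = ratcomp C Y -> gen YR B x -> ratdeg Y = ratdeg X ->
  van 1 C -> van 1 X ->
  exists nu, [/\ is_moebius nu, van 1 (ratcomp Y nu) & van 1 (ratcomp B nu)].
Proof.
move=> CR XR BR E gx dYX vC vX.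
have [pY [qY [cY qY0 EY]]] := ratfracP Y; have [pB [qB [cB qB0 EB]]] := ratfracP B.
have pY0 : pY != 0.
  by apply: contraTneq (ratfun_neq0 YR) => p0; rewrite EY p0 tofrac0 mul0r eqxx.
have pB0 : pB != 0.
  by apply: contraTneq (ratfun_neq0 BR) => p0; rewrite EB p0 tofrac0 mul0r eqxx.
(* nu0 = c + 1/z sends infinity to a point where neither Y nor B vanishes. The numerators of Y o nu0
   and B o nu0 then have full degree, so that the resultant below commutes with specialization at
   (0, 0). *)
have [c] : exists c, ~~ root (pY * pB) c.
  apply: contrapT => H; have /closed_nonrootP : pY * pB != 0 by rewrite mulf_neq0.
  by case=> c hc; apply: H; exists c.
rewrite rootM negb_or => /andP [cY0 cB0].
pose nu0 := linfrac c 1 1 0.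
have nuM : is_moebius nu0.
  by apply: moebius_linfrac; rewrite mulr0 mulr1 sub0r oppr_eq0 oner_neq0.
have nuR := moebius_ratfun nuM.
have nuV : ratcomp nu0 x^-1 = x + const c.
  rewrite ratcomp_linfrac; last exact: moebius_ratfun (moebius_V K).
  by rewrite polyC0 polyC1 tofrac0 tofrac1 mul1r addr0 invrK mulrDl mul1r -mulrA mulVf ?mulr1 1?addrC //;
    exact: ratfun_neq0 (@ratfun_var K).
have top (f : ratK) n d : is_ratfun f -> coprimep n d -> d != 0 -> f = n%:F / d%:F -> ~~ root n c ->
  exists p q, [/\ coprimep p q, q != 0, ratcomp f nu0 = p%:F / q%:F &
     size p = (ratdeg f).+1 /\ (size q <= size p)%N].
  move=> fR cnd d0 Ef rn; have [p [q [cpq q0 Ep]]] := ratfracP (ratcomp f nu0).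
  exists p, q; split=> //; have sp := ratdegS cpq q0 Ep.
  have dg : ratdeg (ratcomp f nu0) = ratdeg f by rewrite ratdeg_comp // (proj2 nuM) muln1.
  rewrite dg in sp.
  have fnR := ratfun_comp fR nuR.
  have p0 : p != 0.
    by apply: contraTneq (ratfun_neq0 fnR) => p0; rewrite Ep p0 tofrac0 mul0r eqxx.
  suff sp' : ~ (size p + 1 <= (ratdeg f).+1)%N.
    by move: sp sp'; move: (size p) (size q) (ratdeg f); clear; lia.
  rewrite -dg => /(van_invP cpq q0 p0 Ep (ltn0Sn 0)).
  rewrite -(ratcompA _ nuR (moebius_ratfun (moebius_V K))) nuV.
  by move=> /(van_shiftP c cnd d0 Ef (ltn0Sn 0)); rewrite expr1 dvdp_XsubCl; apply/negP.
have [p1 [q1 [c1 q10 E1 [s1 s1']]]] := top _ _ _ YR cY qY0 EY cY0.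
have [a [b [cab b0 Eab [sa sb]]]] := top _ _ _ BR cB qB0 EB cB0.
pose Y1 := ratcomp Y nu0; pose B1 := ratcomp B nu0.
have Y1R : is_ratfun Y1 by exact: ratfun_comp. have B1R : is_ratfun B1 by exact: ratfun_comp.
have E' : ratcomp X B1 = ratcomp C Y1 by rewrite /B1 /Y1 !ratcompA // E.
have [nu1 [nu1M nu1r nu1l]] := moebius_inv nuM.
have gx1 : gen Y1R B1 x.
  have : gen Y1R B1 nu0.
    by have := proj2 (gen_compr YR B nuR Y1R x) gx; rewrite ratcomp_varl.
  by move=> /(gen_ratcomp nu1 nuR); rewrite nu1l.
have dY1 : ratdeg Y1 = ratdeg X by rewrite ratdeg_comp // (proj2 nuM) muln1.
have [cn [cd [cC cd0 EC]]] := ratfracP C; have [pX [qX [cX qX0 EX]]] := ratfracP X.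
have [cn0 cd00] : cn.[0] = 0 /\ cd.[0] != 0 by apply: van_num0 => //; rewrite -EC.
have [pX0 _] : pX.[0] = 0 /\ qX.[0] != 0 by apply: van_num0 => //; rewrite -EX.
pose cc : {rmorphism K -> {poly {poly K}}} := polyC \o polyC.
(* With u for the inner variable and v for the outer one, these are p1(T) - u q1(T) and a(T) - v
   b(T). Their resultant N(u, v) vanishes at (Y1, B1), where both have the root T = z. *)
pose PP := map_poly cc p1 - 'X%:P *: map_poly cc q1 : {poly {poly {poly K}}}.
pose QQ := map_poly cc a - 'X *: map_poly cc b : {poly {poly {poly K}}}.
pose ev0 : {rmorphism {poly {poly K}} -> K} := horner_eval (0 : K) \o horner_eval (0 : {poly K}).
have ev0c p : map_poly (ev0 \o cc) p = p.
  apply/polyP => i; rewrite coef_map_id0 /= /horner_eval; first by rewrite !hornerC.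
  by rewrite !hornerC.
have ev0PP : map_poly ev0 PP = p1.
  apply: etrans (map_poly_pencil cc ev0 _ _ _) _; rewrite !ev0c.
  by rewrite /= /horner_eval hornerC hornerX scale0r subr0.
have ev0QQ : map_poly ev0 QQ = a.
  apply: etrans (map_poly_pencil cc ev0 _ _ _) _; rewrite !ev0c.
  by rewrite /= /horner_eval hornerX hornerC scale0r subr0.
have lead_ev0 (P : {poly {poly {poly K}}}) (f : {poly K}) :
    map_poly ev0 P = f -> (size P <= size f)%N -> f != 0 -> ev0 (lead_coef P) != 0 /\ size P = size f.
  move=> Ef sP f0; have ss : size P = size f.
    by apply/eqP; rewrite eqn_leq sP -Ef size_poly.
  by rewrite lead_coefE ss -coef_map Ef -lead_coefE lead_coef_eq0.
have sPP : (size PP <= size p1)%N.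
  apply/leq_sizeP => i hi; rewrite coefB coefZ !coef_map (leq_sizeP _ _ hi i (leqnn i)) (leq_sizeP _ _ (leq_trans s1' hi) i (leqnn i)) /=.
  by rewrite !polyC0 mulr0 subr0.
have sQQ : (size QQ <= size a)%N.
  apply/leq_sizeP => i hi; rewrite coefB coefZ !coef_map (leq_sizeP _ _ hi i (leqnn i)) (leq_sizeP _ _ (leq_trans sb hi) i (leqnn i)) /=.
  by rewrite !polyC0 mulr0 subr0.
have p10 : p1 != 0 by rewrite -size_poly_gt0 s1.
have a0 : a != 0 by rewrite -size_poly_gt0 sa.
have [lPP szPP] := lead_ev0 _ _ ev0PP sPP p10; have [lQQ szQQ] := lead_ev0 _ _ ev0QQ sQQ a0.
pose N := resultant PP QQ.
have ev0N : ev0 N = resultant p1 a by rewrite map_resultant // ev0PP ev0QQ.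
have Y1pos : (0 < ratdeg Y)%N by apply/ratfun_deg.
have Bpos : (0 < ratdeg B)%N by apply/ratfun_deg.
have q1F : q1%:F != 0 :> ratK by rewrite tofrac_eq0.
have bF : b%:F != 0 :> ratK by rewrite tofrac_eq0.
have biN : bieval Y1 B1 N = 0.
  have [||[u v] _ /= uv] := @resultant_in_ideal _ PP QQ; [by rewrite szPP s1|by rewrite szQQ sa|].
  pose phi : {rmorphism {poly {poly K}} -> ratK} := bieval Y1 B1.
  have phic p : map_poly (phi \o cc) p = map_poly (@tofrac _ \o polyC) p.
    by apply: eq_map_poly => t; rewrite /= bievalC rsubstC.
  have PPx : (map_poly phi PP).[x] = 0.
    rewrite (map_poly_pencil cc phi) !phic hornerD hornerN hornerZ.
    rewrite -[(map_poly _ p1).[x]]/(rsubst x p1) -[(map_poly _ q1).[x]]/(rsubst x q1) !rsubst_var.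
    by rewrite /= bievalC rsubstX /Y1 E1 (divfK q1F) subrr.
  have QQx : (map_poly phi QQ).[x] = 0.
    rewrite (map_poly_pencil cc phi) !phic hornerD hornerN hornerZ.
    rewrite -[(map_poly _ a).[x]]/(rsubst x a) -[(map_poly _ b).[x]]/(rsubst x b) !rsubst_var.
    by rewrite /= bievalX /B1 Eab (divfK bF) subrr.
  have := congr1 (fun t => (map_poly phi t).[x]) uv.
  rewrite map_polyC hornerC => ->.
  rewrite rmorphD !rmorphM hornerD !hornerM PPx QQx.
  by rewrite !mulr0 addr0.
have sX := ratdegS cX qX0 EX.
have sPhi := size_fibpoly pX qX CR; rewrite sX in sPhi.
have Phi0 : fibpoly C pX qX != 0 by rewrite -size_poly_gt0 sPhi.
have PhiE := fibpoly_square Y1R B1R qX0 EX E'.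
(* X(T) - C has degree deg Y, hence is a minimal polynomial of B1 over K(Y1), and it divides N. *)
have [g Eg] : exists g, map_poly (@tofrac _) N = g * fibpoly C pX qX.
  exists (map_poly (@tofrac _) N %/ fibpoly C pX qX); rewrite {1}(divp_eq (map_poly _ N) (fibpoly C pX qX)).
  rewrite [X in _ + X](_ : _ = 0) ?addr0 //.
  set rem := _ %% _; apply/eqP; apply: contraT => rem0.
  have : (size rem < (ratdeg X).+1)%N by rewrite -sPhi ltn_modp.
  rewrite ltnS leqNgt -dY1 (gen_size gx1 rem0) //.
  move: biN; rewrite (bieval_subeval Y1R) (divp_eq (map_poly _ N) (fibpoly C pX qX)).
  by rewrite subevalD subevalM PhiE mulr0 add0r.
have [e [G' [e0 EG]]] := clear_denominators g.
have [S ES] : exists S, N = bifib cn cd pX qX * S.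
  apply: (gauss_dvd (e := e * cd) (S := G')); first by rewrite mulf_neq0.
    by apply: bifib_primitive => //; rewrite -EX.
  apply: (map_inj_poly (@tofrac_inj _) (tofrac0 _)).
  rewrite map_tofracZ map_tofracM (map_bifib _ _ cd0 EC) -EG Eg tofracM.
  by rewrite -scalerAl -!scalerAr !scalerA [e%:F * _]mulrC [g * _]mulrC.
(* C and X vanish at 0, so the factor of N does at (0, 0). Therefore p1 and a have a common root w,
   and Y and B both vanish at nu0(w). *)
have N00 : ev0 N = 0.
  rewrite ES rmorphM [ev0 (bifib _ _ _ _)](_ : _ = 0) ?mul0r //.
  rewrite /= /horner_eval /bifib hornerD hornerN !hornerZ.
  have h0 (r : {poly K}) : (map_poly polyC r).[0] = (r.[0])%:P by rewrite -[0 in LHS]polyC0 horner_map.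
  by rewrite !h0 hornerD hornerN !hornerM cn0 mul0r subr0 /= hornerC pX0 mulr0.
move: ev0N; rewrite N00 => /esym /eqP; rewrite resultant_eq0 => sg.
have [w] : exists w, root (gcdp p1 a) w by apply/closed_rootP; rewrite gtn_eqF.
rewrite root_gcd => /andP [rp ra].
have shM := moebius_add w; have shR := moebius_ratfun shM.
exists (ratcomp nu0 (x + const w)); split; first exact: moebius_comp.
  rewrite (ratcompA _ nuR shR); apply/(van_shiftP w c1 q10 E1 (ltn0Sn 0)).
  by rewrite expr1 dvdp_XsubCl.
rewrite (ratcompA _ nuR shR); apply/(van_shiftP w cab b0 Eab (ltn0Sn 0)).
by rewrite expr1 dvdp_XsubCl.
Qed.

End Surjectivity.

Lemma linfrac_shift (F : fieldType) (a b c d w x : F) : c * x + d != 0 -> b = w * d ->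
  ((a - w * c) * x + 0) / (c * x + d) + w = (a * x + b) / (c * x + d).
Proof. by move=> q0 ->; field. Qed.

(** * Ramification *)

Section Ramification.
Variable K : numClosedFieldType.
Local Notation ratK := {fraction {poly K}}.
Local Notation const c := (@tofrac {poly K} (polyC c)).
Local Notation x := (ratvar K).

Implicit Types (u f g : ratK).

(* Since [mu] can send 0 to any point, this says that 0 is a critical value of [g]. *)
Definition ram (g : ratK) := exists2 mu, is_moebius mu & van 2 (ratcomp g mu).

Lemma ram_moebius g mu : is_moebius mu -> ram g <-> ram (ratcomp g mu).
Proof.
move=> muM; have muR := moebius_ratfun muM.
split=> [[nu nuM h]|[nu nuM h]].
  have [iu [iuM _ iuK]] := moebius_inv muM.
  have [iv [ivM muiv _]] := moebius_inv muM.
  exists (ratcomp iv nu); first exact: moebius_comp.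
  have ivR := moebius_ratfun ivM; have nuR := moebius_ratfun nuM.
  by rewrite -(ratcompA _ muR (ratfun_comp ivR nuR)) (ratcompA mu ivR nuR) muiv ratcomp_varl.
exists (ratcomp mu nu); first exact: moebius_comp.
by rewrite (ratcompA _ muR (moebius_ratfun nuM)).
Qed.

Lemma val0_comp u c g : is_ratfun g -> val0 g 0 -> val0 u c -> val0 (ratcomp u g) c.
Proof.
move=> gR g0 [n [d [d0 n0 ->]]].
have dn0 : d != 0 by apply: contraNneq d0 => ->; rewrite horner0.
rewrite (ratcompE _ gR dn0) -[c](mulfK d0) -n0; apply: val0M; first exact: val0_rsubst.
by apply: val0V => //; exact: val0_rsubst.
Qed.

Lemma van_comp k f g : is_ratfun g -> van 1 g -> van k f -> van k (ratcomp f g).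
Proof.
move=> gR g1 [u [c [-> uc]]].
rewrite ratcompM // ratcompX // ratcomp_varl //.
apply: (vanM (vanX k g1)); exact: val0_comp (van_val0 g1) uc.
Qed.

Lemma val0_neq0 u c : val0 u c -> c != 0 -> u != 0.
Proof.
move=> [n [d [d0 n0 ->]]] c0; have dF := horner0_neq0 d0.
apply: mulf_neq0; last exact: invr_neq0.
rewrite tofrac_eq0; apply: contraNneq (mulf_neq0 c0 d0) => n00.
by rewrite -n0 n00 horner0.
Qed.

Lemma van_simple f : van 1 f -> ~ van 2 f -> exists u c, [/\ f = x * u, val0 u c & c != 0].
Proof.
move=> [u [c [E uc]]] nv; exists u, c; split=> //.
apply: contra_notN nv => /eqP c0; have [n [d [d0 n0 Eu]]] := uc.
have : 'X - 0%:P %| n by rewrite dvdp_XsubCl /root n0 c0 mul0r.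
rewrite polyC0 subr0 => /dvdpP [m Em].
suff -> : f = ('X^2 * m)%:F / d%:F by exact: numden_van.
rewrite E expr1 Eu Em mulrA; congr (_ / _).
rewrite -[ratvar K]/(tofrac 'X) -tofracM; congr tofrac.
by rewrite expr2 [m * _]mulrC mulrA.
Qed.

Lemma linfrac0_van (a c d : K) : d != 0 -> van 1 (linfrac a 0 c d).
Proof.
move=> d0; have d0' : (c *: 'X + d%:P).[0] != 0 by rewrite !hornerE.
suff -> : linfrac a 0 c d = ('X^1 * a%:P)%:F / (c *: 'X + d%:P)%:F by exact: numden_van.
by rewrite linfracE expr1 ['X * _]mulrC mul_polyC polyC0 addr0.
Qed.

Lemma van_linfrac_inv k g (a c d : K) : a != 0 -> d != 0 ->
  van k (ratcomp g (linfrac a 0 c d)) -> van k g.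
Proof.
move=> a0 d0 vg; have D : a * d - 0 * c != 0 by rewrite mul0r subr0 mulf_neq0.
have D' : d * a - (- 0) * (- c) != 0 by rewrite mulrNN mulrC.
have M := moebius_linfrac D; have M' := moebius_linfrac D'.
have := linfracK D'; rewrite !opprK => EK.
rewrite -(ratcomp_varr g) -EK.
rewrite (ratcompA _ (moebius_ratfun M) (moebius_ratfun M')).
apply: van_comp => //; first exact: moebius_ratfun.
by rewrite oppr0; exact: linfrac0_van.
Qed.

(** [mu] sends 0 to b / e, or to infinity if e = 0; up to a Moebius map fixing 0, which preserves
    orders, it is a translation or the inversion. *)
Lemma ram_cases f (n d : {poly K}) : coprimep n d -> d != 0 -> n != 0 -> f = n%:F / d%:F -> ram f ->
  (exists w, ('X - w%:P) ^+ 2 %| n) \/ (size n + 2 <= (ratdeg f).+1)%N.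
Proof.
move=> cnd d0 n0 Ef [mu /linfracP [a [b [c [e [D ->]]]]] vf].
have [e0|e0] := eqVneq e 0.
  right; apply/(@van_invP _ 2 _ _ _ cnd d0 n0 Ef isT).
  have c0 : c != 0 by apply: contraNneq D => ->; rewrite e0 !mulr0 subrr.
  have b0 : b != 0 by apply: contraNneq D => ->; rewrite e0 mulr0 mul0r subrr.
  apply: (@van_linfrac_inv _ _ c a b) => //.
  have R' : is_ratfun (linfrac c 0 a b).
    by apply/moebius_ratfun/moebius_linfrac; rewrite mul0r subr0 mulf_neq0.
  rewrite -(ratcompA _ (moebius_ratfun (moebius_V K)) R') ratcomp_V //.
  by move: vf; rewrite e0 /linfrac invf_div.
left; exists (b / e); apply/(@van_shiftP _ 2 (b / e) _ _ _ cnd d0 Ef isT).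
have a0 : a - (b / e) * c != 0.
  apply: contraNneq D => /(congr1 (fun t => t * e)); rewrite mul0r mulrBl mulrAC divfK // => E.
  by rewrite E.
apply: (@van_linfrac_inv _ _ (a - (b / e) * c) c e) => //.
have R' : is_ratfun (linfrac (a - b / e * c) 0 c e).
  by apply/moebius_ratfun/moebius_linfrac; rewrite mul0r subr0 mulf_neq0.
rewrite -(ratcompA _ (moebius_ratfun (moebius_add _)) R') ratcomp_add //.
move: vf; congr (van _ (ratcomp _ _)); rewrite /linfrac.
have q0 : const c * x + const e != 0 by apply: lin_neq0; [exact: ratfun_var|right].
rewrite constB constM polyC0 tofrac0; apply: esym; apply: linfrac_shift => //.
by rewrite -constM divfK.
Qed.

(** At a point where Y = B = 0, which [square_surjective] provides, C o Y = X o B vanishes to order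
    2 while C has a simple zero at 0; so Y itself vanishes to order 2. *)
Lemma square_ram0 C X Y B (YR : is_ratfun Y) : is_ratfun C -> is_ratfun X -> is_ratfun B ->
  ratcomp X B = ratcomp C Y -> gen YR B x -> ratdeg Y = ratdeg X ->
  van 1 C -> ~ van 2 C -> van 2 X -> ram Y.
Proof.
move=> CR XR BR E gx dYX C1 C2 X2.
have X1 : van 1 X.
  have [u [c [-> uc]]] := X2; exists (x * u), (0 * c); split; last first.
    by apply: val0M uc; have := val0_poly ('X : {poly K}); rewrite hornerX.
  by rewrite expr2 expr1 mulrA.
have [nu [nuM vY vB]] := square_surjective CR XR BR E gx dYX C1 X1.
have nuR := moebius_ratfun nuM; exists nu => //.
have YnR : is_ratfun (ratcomp Y nu) by exact: ratfun_comp.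
have BnR : is_ratfun (ratcomp B nu) by exact: ratfun_comp.
have [u [c [EC uc c0]]] := van_simple C1 C2.
have [w [e [EX we]]] := X2.
have uY := val0_comp YnR (van_val0 vY) uc.
have wB := val0_comp BnR (van_val0 vB) we.
have u0 := val0_neq0 uY c0.
have E2 : ratcomp B nu ^+ 2 * ratcomp w (ratcomp B nu) = ratcomp Y nu * ratcomp u (ratcomp Y nu).
  rewrite -[X in X ^+ 2 * _](ratcomp_varl BnR) -(ratcompX BnR) -(ratcompM BnR) -EX.
  rewrite -[X in _ = X * _](ratcomp_varl YnR) -(ratcompM YnR) -EC.
  by rewrite (ratcompA X BR nuR) E (ratcompA C YR nuR).
have -> : ratcomp Y nu = ratcomp B nu ^+ 2 * (ratcomp w (ratcomp B nu) * (ratcomp u (ratcomp Y nu))^-1).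
  by rewrite mulrA E2 (mulfK u0).
apply: (vanM (vanX 2 vB)); exact: val0M wB (val0V c0 uY).
Qed.

Lemma deriv_eq0 (p : {poly K}) : p^`() = 0 -> (size p <= 1)%N.
Proof.
move=> E; apply/leq_sizeP => [] [//|j] _.
have := congr1 (fun t : {poly K} => t`_j) E; rewrite coef_deriv coef0 => /eqP.
by rewrite mulrn_eq0 => /eqP.
Qed.

(** If it vanished, coprimality would make p divide p' and q divide q', so both would be constant in
    characteristic 0. *)
Lemma wronskian_neq0 (p q : {poly K}) : coprimep p q -> (1 < maxn (size p) (size q))%N ->
  p^`() * q - p * q^`() != 0.
Proof.
move=> cpq s1; apply: contraTneq s1 => /subr0_eq E; rewrite -leqNgt geq_max.
have small (r t : {poly K}) : coprimep r t -> r %| r^`() * t -> (size r <= 1)%N.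
  move=> crt; rewrite (Gauss_dvdpl _ crt) => rr.
  have [r0|r0] := eqVneq r^`() 0; first exact: deriv_eq0.
  have := dvdp_leq r0 rr; have [->|rn0] := eqVneq r 0; first by rewrite size_poly0.
  by rewrite leqNgt lt_size_deriv.
rewrite (small p q) //=; last by rewrite E dvdp_mulr.
by rewrite (small q p) 1?coprimep_sym // mulrC -E dvdp_mull.
Qed.

Lemma subr_const_comp f v : is_ratfun f -> f - const v = ratcomp (x + const (- v)) f.
Proof. by move=> fR; rewrite (ratcomp_add _ fR) polyCN tofracN. Qed.

Lemma ratfun_subr f v : is_ratfun f -> is_ratfun (f - const v).
Proof.
move=> fR; rewrite (subr_const_comp _ fR); apply: ratfun_comp fR.
exact: moebius_ratfun (moebius_add _).
Qed.

Lemma ratdeg_subr f v : is_ratfun f -> ratdeg (f - const v) = ratdeg f.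
Proof.
move=> fR; rewrite (subr_const_comp _ fR) (ratdeg_comp (moebius_ratfun (moebius_add _)) fR).
by rewrite (proj2 (moebius_add _)) mul1n.
Qed.

(** With m = deg f, critical values come from the at most 2m - 1 roots of the Wronskian, or from a
    multiple point at infinity, which lies over a single value. *)
Lemma ram_count f (s : seq K) : is_ratfun f -> uniq s ->
  (forall v, v \in s -> ram (f - const v)) -> (size s <= 2 * ratdeg f)%N.
Proof.
move=> fR us rs; have [p [q [cpq q0 Ef]]] := ratfracP f.
have qF : q%:F != 0 :> ratK by rewrite tofrac_eq0.
have sm := ratdegS cpq q0 Ef; have m0 : (0 < ratdeg f)%N by apply/ratfun_deg.
have W0 : p^`() * q - p * q^`() != 0 by apply: wronskian_neq0 => //; rewrite sm.
set W := _ - _ in W0; have [r Er] := closed_field_poly_normal W.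
have sW : (size W <= 2 * ratdeg f)%N.
  apply: leq_trans (size_polyD _ _) _; rewrite geq_max size_polyN.
  have dpoly (t : {poly K}) : (size t <= (ratdeg f).+1)%N -> (size t^`() <= ratdeg f)%N.
    by move=> st; apply: leq_trans (size_poly _ _) _; case: (size t) st.
  have sp : (size p <= (ratdeg f).+1)%N by rewrite -sm leq_maxl.
  have sq : (size q <= (ratdeg f).+1)%N by rewrite -sm leq_maxr.
  have aux i j k : (i <= k -> j <= k.+1 -> (i + j).-1 <= 2 * k)%N by lia.
  apply/andP; split; apply: leq_trans (size_polyMleq _ _) _; first exact: aux (dpoly _ sp) sq.
  by rewrite addnC; exact: aux (dpoly _ sq) sp.
have sr : (size r).+1 = size W.
  by rewrite Er size_scale ?lead_coef_eq0 // size_prod_XsubC.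
have fE v : f - const v = (p - v%:P * q)%:F / q%:F.
  by rewrite Ef tofracB tofracM mulrBl (mulfK qF).
have cv v : coprimep (p - v%:P * q) q.
  by rewrite coprimep_sym addrC -mulNr coprimep_addl_mul coprimep_sym.
have n0 v : p - v%:P * q != 0.
  by apply/eqP => E; have := ratfun_neq0 (ratfun_subr (v := v) fR); rewrite fE E tofrac0 mul0r eqxx.
have cases v : v \in s -> (exists2 w, w \in r & v = p.[w] / q.[w]) \/
    (size (p - v%:P * q)%R < ratdeg f)%N.
  move=> /rs rv; have [[w Hw]|] := ram_cases (cv v) q0 (n0 v) (fE v) rv; last first.
    by rewrite (ratdeg_subr _ fR) addn2 ltnS; right.
  left; exists w; last first.
    have rw : root (p - v%:P * q) w.
      by rewrite -dvdp_XsubCl; apply: dvdp_trans Hw; rewrite expr2 dvdp_mulIl.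
    have qw : q.[w] != 0 by have /coprimep_root := cv v; apply.
    move: rw; rewrite /root hornerD hornerN hornerM hornerC subr_eq0 => /eqP ->.
    by rewrite mulfK.
  have : root W w.
    have -> : W = (p - v%:P * q)^`() * q - (p - v%:P * q) * q^`().
      by rewrite derivB derivM derivC mul0r add0r /W; ring.
    move/dvdpP: Hw => [g ->]; rewrite /root expr2 !derivM derivXsubC.
    by rewrite !(hornerD, hornerN, hornerM, hornerX, hornerC); apply/eqP; ring.
  by rewrite Er rootZ ?lead_coef_eq0 // root_prod_XsubC.
have [[v0 v0s]|nv] := pselect (exists2 v, v \in s & (size (p - v%:P * q)%R < ratdeg f)%N); last first.
  apply: (leq_trans (n := size r)); last by rewrite (leq_trans _ sW) // -sr.
  rewrite -(size_map (fun w => p.[w] / q.[w]) r); apply: uniq_leq_size => // v vs.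
  by case: (cases v vs) => [[w wr ->]|sv]; [exact: map_f|case: nv; exists v].
move=> sv0; apply: leq_trans sW; rewrite -sr.
rewrite -(size_map (fun w => p.[w] / q.[w]) r) -[_.+1]/(size (v0 :: _)).
apply: uniq_leq_size => // v vs; rewrite inE.
case: (cases v vs) => [[w wr ->]|sv]; first by apply/orP; right; apply/mapP; exists w.
apply/orP; left; apply: contraT => vv0; exfalso.
have sq : (size q < ratdeg f)%N.
  rewrite -(size_scale q (a := v0 - v)); last by rewrite subr_eq0 eq_sym.
  have -> : (v0 - v) *: q = (p - v%:P * q) - (p - v0%:P * q).
    by rewrite -mul_polyC polyCB; ring.
  by apply: leq_ltn_trans (size_polyD _ _) _; rewrite size_polyN gtn_max sv.
have sp : (size p < ratdeg f)%N.
  rewrite -[p](subrK (v%:P * q)); apply: leq_ltn_trans (size_polyD _ _) _.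
  rewrite gtn_max sv /= mul_polyC; exact: leq_ltn_trans (size_scale_leq _ _) sq.
have : (maxn (size p) (size q) < ratdeg f)%N by rewrite gtn_max sp sq.
by rewrite sm ltnNge leqnSn.
Qed.

Lemma uniq_prod_XsubC (r : seq K) :
  (forall w, ~~ (('X - w%:P) ^+ 2 %| \prod_(z <- r) ('X - z%:P))) -> uniq r.
Proof.
elim: r => //= z r IH H; apply/andP; split.
  apply/negP => zr; have := H z; rewrite big_cons (perm_big _ (perm_to_rem zr)) big_cons.
  by rewrite mulrA expr2 dvdp_mulr.
by apply: IH => w; apply: contra (H w) => dw; rewrite big_cons dvdp_mull.
Qed.

(* Otherwise every zero of C is a critical value of Y, by [square_ram0]. *)
Lemma square_ram C X Y B (YR : is_ratfun Y) : is_ratfun C -> is_ratfun X -> is_ratfun B ->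
  ratcomp X B = ratcomp C Y -> gen YR B x -> ratdeg Y = ratdeg X ->
  (2 * ratdeg X + 2 <= ratdeg C)%N -> ram X -> ram C.
Proof.
move=> CR XR BR E gx dYX dC [mu muM X2]; apply: contrapT => nC.
have muR := moebius_ratfun muM; have [nu [nuM munu numu]] := moebius_inv muM.
have nuR := moebius_ratfun nuM.
have XmR : is_ratfun (ratcomp X mu) by exact: ratfun_comp.
have nBR : is_ratfun (ratcomp nu B) by exact: ratfun_comp.
have EB : ratcomp mu (ratcomp nu B) = B by rewrite (ratcompA mu nuR BR) munu ratcomp_varl.
have [n [d [cnd d0 EC]]] := ratfracP C.
have n0 : n != 0.
  by apply/eqP => n0; have := ratfun_neq0 CR; rewrite EC n0 tofrac0 mul0r eqxx.
(* A zero of C at infinity is simple, so C has at least deg C - 1 >= 2 deg X + 1 finite zeros; if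
   all of them were critical values of Y, [ram_count] would fail. *)
have sn : (ratdeg C <= size n)%N.
  rewrite leqNgt; apply/negP => lt; apply: nC; exists x^-1; first exact: moebius_V.
  by apply/(@van_invP _ 2 _ _ _ cnd d0 n0 EC isT); rewrite addn2 !ltnS.
have nosq w : ~ ('X - w%:P) ^+ 2 %| n.
  move=> dw; apply: nC; exists (x + const w); first exact: moebius_add.
  exact/(@van_shiftP _ 2 w _ _ _ cnd d0 EC isT).
have [r Er] := closed_field_poly_normal n.
have sr : (size r).+1 = size n by rewrite Er size_scale ?lead_coef_eq0 // size_prod_XsubC.
have ur : uniq r.
  apply: uniq_prod_XsubC => w; apply/negP => dw; apply: (nosq w).
  by rewrite Er dvdpZr ?lead_coef_eq0.
have := ram_count YR ur; rewrite dYX => /(_ _) cnt.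
suff /cnt : forall v, v \in r -> ram (Y - const v).
  by move: dC sn sr; move: (ratdeg X) (ratdeg C) (size n) (size r); clear; lia.
move=> u ur'; have YuR := ratfun_subr (v := u) YR.
have rn : root n u by rewrite Er rootZ ?lead_coef_eq0 // root_prod_XsubC.
have shR := moebius_ratfun (moebius_add u).
apply: (@square_ram0 (ratcomp C (x + const u)) (ratcomp X mu) (Y - const u) (ratcomp nu B) YuR) => //.
- exact: ratfun_comp.
- rewrite -(ratcompA X muR nBR) EB E -(ratcompA C shR YuR) ratcomp_add //.
  by rewrite subrK.
- apply: (gen_sub _ _ gx).
    by rewrite -{2}[Y](subrK (const u)); apply: genD (genF _ _) (genC _ _ _).
  by have := gen_ratcomp mu nBR (genG YuR (ratcomp nu B)); rewrite EB.
- by rewrite (ratdeg_subr _ YR) (ratdeg_comp XR muR) (proj2 muM) muln1.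
- apply/(@van_shiftP _ 1 u _ _ _ cnd d0 EC isT).
  by rewrite expr1 dvdp_XsubCl.
by move/(@van_shiftP _ 2 u _ _ _ cnd d0 EC isT); exact: nosq.
Qed.

End Ramification.

Definition base_code n B (b : {ffun 'I_n -> 'I_B}) : nat := (\sum_(i < n) b i * B ^ i)%N.

Lemma base_code_inj n B : injective (@base_code n B).
Proof.
elim: n => [|n IH] b b' E; first by apply/ffunP => -[].
have codeE (a : {ffun 'I_n.+1 -> 'I_B}) :
    base_code a = (a ord0 + base_code [ffun i => a (lift ord0 i)] * B)%N.
  rewrite /base_code big_ord_recl expn0 muln1 big_distrl /=; congr (_ + _)%N.
  by apply: eq_bigr => i _; rewrite ffunE -mulnA -expnSr.
have B0 : (0 < B)%N by case: (b ord0) => m; case: B {IH b b' E codeE}.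
rewrite !codeE in E.
have E0 : b ord0 = b' ord0.
  apply: val_inj; have := congr1 (modn^~ B) E.
  by rewrite ![(_ + _ * B)%N]addnC !modnMDl !modn_small.
move: E; rewrite E0 => /addnI /eqP; rewrite eqn_pmul2r // => /eqP /IH /ffunP Et.
apply/ffunP => i; case: (unliftP ord0 i) => [j|] ->; last by rewrite E0.
by have := Et j; rewrite !ffunE.
Qed.

(** * Nondegenerate zeros of polynomial systems *)

Section Zeros.
Variable K : closedFieldType.

(* Kronecker substitution. *)
Lemma box_nonvanishing n B (a : {ffun 'I_n -> 'I_B} -> K) b0 : a b0 != 0 ->
  exists c : 'I_n -> K, \sum_b a b * \prod_(i < n) c i ^+ b i != 0.
Proof.
move=> ab0; pose P := \sum_b a b *: 'X^(base_code b) : {poly K}.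
have P0 : P != 0.
  suff Pb : P`_(base_code b0) = a b0 by apply: contraNneq ab0 => P0; rewrite -Pb P0 coef0.
  rewrite coef_sum (bigD1 b0) //= coefZ coefXn eqxx mulr1 big1 ?addr0 // => b bb0.
  rewrite coefZ coefXn; case: eqP => [/base_code_inj E|_]; last by rewrite mulr0.
  by rewrite E eqxx in bb0.
have [t] := closed_nonrootP P P0.
rewrite /root horner_sum => tP; exists (fun i => t ^+ (B ^ i)).
suff -> : \sum_b a b * \prod_(i < n) (t ^+ (B ^ i)) ^+ b i = \sum_b (a b *: 'X^(base_code b)).[t] by [].
apply: eq_bigr => b _; rewrite hornerZ hornerXn /base_code -prodrXr; congr (_ * _).
by apply: eq_bigr => i _; rewrite -exprM mulnC.
Qed.

Definition line_eval n (x v : 'I_n -> K) : {mpoly K[n]} -> {poly K} :=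
  mmap polyC (fun i => (x i)%:P + (v i)%:P * 'X).

HB.instance Definition _ n x v := GRing.RMorphism.on (@line_eval n x v).

Lemma mpoly_ring_ind n (P : {mpoly K[n]} -> Prop) :
  (forall c, P c%:MP) -> (forall i, P 'X_i) -> (forall p q, P p -> P q -> P (p + q)) ->
  (forall p q, P p -> P q -> P (p * q)) -> forall p, P p.
Proof.
move=> PC PX PD PM; apply: mpolyind => [|c m p _ _ Pp]; first by rewrite -mpolyC0.
apply: (PD) Pp; rewrite -mul_mpolyC; apply: (PM) => //; rewrite mpolyXE_id.
apply: (big_ind P); [by rewrite -mpolyC1|exact: PM|move=> i _].
by elim: (m i) => [|k IH]; rewrite ?expr0 -?mpolyC1 // exprS; exact: PM.
Qed.

Lemma line_evalC n (x v : 'I_n -> K) c : line_eval x v c%:MP = c%:P.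
Proof. exact: mmapC. Qed.

Lemma line_evalX n (x v : 'I_n -> K) i : line_eval x v 'X_i = (x i)%:P + (v i)%:P * 'X.
Proof. by rewrite /line_eval mmapX mmap1U. Qed.

Lemma line_eval_coef0 n (x v : 'I_n -> K) f : (line_eval x v f)`_0 = f.@[x].
Proof.
elim/mpoly_ring_ind: f => [c|i|p q IHp IHq|p q IHp IHq].
- by rewrite line_evalC mevalC coefC.
- by rewrite line_evalX mevalXU coefD coefC coefMX addr0.
- by rewrite mevalD rmorphD coefD IHp IHq.
- by rewrite mevalM rmorphM coef0M IHp IHq.
Qed.

Definition dirderiv n (x v : 'I_n -> K) f : K := (line_eval x v f)`_1.

Lemma dirderivM n (x v : 'I_n -> K) f g :
  dirderiv x v (f * g) = dirderiv x v f * g.@[x] + f.@[x] * dirderiv x v g.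
Proof.
by rewrite /dirderiv rmorphM /= coefM !big_ord_recl big_ord0 /= !line_eval_coef0 addr0 addrC.
Qed.

Lemma dirderiv_lin n (x v : 'I_n -> K) f :
  dirderiv x v f = \sum_j v j * dirderiv x (fun i => (i == j)%:R) f.
Proof.
elim/mpoly_ring_ind: f => [c|i|p q IHp IHq|p q IHp IHq].
- rewrite /dirderiv line_evalC coefC big1 // => j _.
  by rewrite line_evalC coefC mulr0.
- rewrite /dirderiv line_evalX coefD coefC coefMX coefC /= add0r (bigD1 i) //= line_evalX.
  rewrite coefD coefC coefMX coefC /= add0r eqxx mulr1 big1 ?addr0 // => j ji.
  by rewrite line_evalX coefD coefC coefMX coefC /= add0r eq_sym (negPf ji) mulr0.
- rewrite /dirderiv rmorphD coefD -/(dirderiv x v p) -/(dirderiv x v q) IHp IHq -big_split /=.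
  by apply: eq_bigr => j _; rewrite rmorphD coefD mulrDr.
- rewrite dirderivM IHp IHq mulr_suml mulr_sumr -big_split /=.
  by apply: eq_bigr => j _; rewrite dirderivM mulrDr mulrA mulrCA.
Qed.

Lemma msize_mul_le n (p q : {mpoly K[n]}) d e :
  (msize p <= d.+1)%N -> (msize q <= e.+1)%N -> (msize (p * q) <= (d + e).+1)%N.
Proof.
have [->|p0] := eqVneq p 0; first by rewrite mul0r msize0.
have [->|q0] := eqVneq q 0; first by rewrite mulr0 msize0.
by rewrite msizeM // => hp hq; move: hp hq; move: (msize p) (msize q); clear; lia.
Qed.

Lemma msize_exp_le n (p : {mpoly K[n]}) d k :
  (msize p <= d.+1)%N -> (msize (p ^+ k) <= (k * d).+1)%N.
Proof.
move=> hp; elim: k => [|k IH]; first by rewrite expr0 msize1.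
by rewrite exprS mulSn msize_mul_le.
Qed.

Lemma card_bmultinom n d : (#|{: 'X_{1..n < d}}| <= d ^ n)%N.
Proof.
case: d => [|d].
  by rewrite eq_card0 // => m; have := bmdeg m.
have : injective (fun m : 'X_{1..n < d.+1} => [ffun i : 'I_n => inord (m i) : 'I_d.+1]).
  move=> m1 m2 /ffunP E; apply/val_inj/mnmP => i; have := E i; rewrite !ffunE.
  have lt (m : 'X_{1..n < d.+1}) : (m i < d.+1)%N.
    by apply: leq_ltn_trans (bmdeg m); rewrite mdegE (bigD1 i) //= leq_addr.
  by move=> /(congr1 val) /=; rewrite !inordK.
by move/leq_card; rewrite card_ffun !card_ord.
Qed.

Section Relation.
Variables (n D : nat) (f : 'I_n -> {mpoly K[n]}).
Hypothesis fD : forall i, (msize (f i) <= D.+1)%N.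

Let B := ((n * D + 2) ^ n).+1.

(** The B^(n+1) products have degree less than B (n D + 2), so they lie in a space of dimension at
    most (B (n D + 2))^n, and B > (n D + 2)^n makes this smaller than B^(n+1). *)
Lemma algebraic_relation (h : {mpoly K[n]}) : (msize h <= 2)%N ->
  exists a : {ffun 'I_n -> 'I_B} * 'I_B -> K, (exists b, a b != 0) /\
    \sum_b a b *: ((\prod_i f i ^+ b.1 i) * h ^+ b.2) = 0.
Proof.
move=> sh; pose J := ({ffun 'I_n -> 'I_B} * 'I_B)%type.
pose mono (b : J) := (\prod_i f i ^+ b.1 i) * h ^+ b.2.
pose d := (B * (n * D + 2))%N.
have smono b : (msize (mono b) <= d)%N.
  have s1 : (msize (\prod_i f i ^+ b.1 i) <= (n * (B.-1 * D)).+1)%N.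
    rewrite -[n in (n * _)%N]card_ord -sum_nat_const.
    elim/big_rec2: _ => [|i y p _ IH]; first by rewrite msize1.
    apply: msize_mul_le => //; apply: leq_trans (msize_exp_le _ (fD i)) _.
    by rewrite ltnS leq_mul2r -ltnS ltn_ord orbT.
  have s2 : (msize (h ^+ b.2) <= (B.-1).+1)%N.
    apply: leq_trans (msize_exp_le _ sh) _; rewrite muln1.
    exact: ltn_ord.
  apply: leq_trans (msize_mul_le s1 s2) _; rewrite /d /B /=.
  move: ((n * D + 2) ^ n)%N => e; rewrite mulSn mulnDr addnS.
  by move: (n * (e * D))%N (mulnCA n e D) => u ->; move: (n * D)%N => w; lia.
have card_lt : (#|{: 'X_{1..n < d}}| < #|{: J}|)%N.
  apply: leq_ltn_trans (card_bmultinom n d) _.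
  rewrite card_prod card_ffun !card_ord /d expnMn ltn_pmul2l ?expn_gt0 //.
have [v v0 vM] := row_dependent (\matrix_(i < #|{: J}|, j < #|{: 'X_{1..n < d}}|)
   (mono (enum_val i))@_(enum_val j)) card_lt.
exists (fun b => v 0 (enum_rank b)); split.
  have /rV0Pn [i vi] := v0; exists (enum_val i); by rewrite enum_valK.
apply/mpolyP => m; rewrite mcoeff0 raddf_sum /=.
have [md|md] := ltnP (mdeg m) d; last first.
  rewrite big1 // => b _; rewrite mcoeffZ memN_msupp_eq0 ?mulr0 //.
  by apply: msize_mdeg_ge; apply: leq_trans (smono b) md.
have := congr1 (fun t : 'rV_ _ => t 0 (enum_rank (BMultinom md))) vM.
rewrite !mxE => E; apply: etrans E; rewrite (reindex_onto (fun i : 'I_#|{: J}| => enum_val i) (fun b => enum_rank b)) /=; last first.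
  by move=> b _; rewrite enum_rankK.
apply: eq_big => [i|i _]; first by rewrite enum_valK eqxx.
by rewrite !mxE mcoeffZ enum_valK enum_rankK.
Qed.

(** Let w be the least total degree in the f_i of a term of the relation. On a line x + t v along
    which f_i = t u_i with u_i(0) = c_i, dividing by t^w and setting t = 0 leaves a polynomial in
    x_j that depends on the relation and on c, but not on x. *)
Lemma coordinate_polynomial j : exists Q : {poly K}, [/\ Q != 0, (size Q <= B)%N &
  forall x : 'I_n -> K, (forall i, (f i).@[x] = 0) ->
    (forall c : 'I_n -> K, exists v : 'I_n -> K, forall i, dirderiv x v (f i) = c i) ->
    root Q (x j)].
Proof.
have sX : (msize ('X_j : {mpoly K[n]}) <= 2)%N by rewrite msizeX mdeg1.
have [a [[b0 ab0] rel]] := algebraic_relation sX.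
pose w (b : {ffun 'I_n -> 'I_B} * 'I_B) := (\sum_i b.1 i)%N.
case: (@arg_minnP _ b0 (fun b => a b != 0) w ab0) => bm abm wmin.
(* The terms of degree w with one fixed power of the coordinate make up a nonzero form in the f_i; c
   is taken where it does not vanish, so that Q is nonzero. *)
pose a' (b : {ffun 'I_n -> 'I_B}) := if (\sum_i b i == w bm)%N then a (b, bm.2) else 0.
have [c cP] : exists c : 'I_n -> K, \sum_b a' b * \prod_(i < n) c i ^+ b i != 0.
  by apply: (@box_nonvanishing _ _ _ bm.1); rewrite /a' eqxx -surjective_pairing.
pose t b := if w b == w bm then a b * \prod_(i < n) c i ^+ b.1 i else 0.
exists (\sum_b t b *: 'X^(b.2)); split.
- apply: contraNneq cP => /(congr1 (fun p : {poly K} => p`_bm.2)).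
  rewrite coef0 coef_sum => E; apply/eqP; apply: etrans E.
  rewrite (eq_bigr (fun b : _ * 'I_B => if b.2 == bm.2 then t b else 0)); last first.
    move=> b _; rewrite coefZ coefXn eq_sym -[(_ == _ :> nat)]/(b.2 == bm.2).
    by case: ifP; rewrite ?mulr1 ?mulr0.
  rewrite -big_mkcond (reindex_onto (fun b => (b, bm.2)) (fun b => b.1)) /=; last first.
    by move=> [b1 b2] /= /eqP ->.
  apply: eq_big => [b|b _]; first by rewrite !eqxx.
  by rewrite /t /a' /w /=; case: ifP => // _; rewrite mul0r.
- apply: leq_trans (size_sum _ _ _) _; apply/bigmax_leqP => b _.
  by apply: leq_trans (size_scale_leq _ _) _; rewrite size_polyXn.
move=> x fx sv; have [v vc] := sv c; rewrite /root horner_sum.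
pose L := line_eval x v.
have /choice [u uE] : forall i, exists u : {poly K}, L (f i) = 'X * u /\ u.[0] = c i.
  move=> i; exists (\poly_(k < size (L (f i))) (L (f i))`_k.+1); split.
    apply/polyP => [] [|k]; rewrite coefXM /= ?line_eval_coef0 //.
    rewrite coef_poly; case: ltnP => // /leq_sizeP -> //.
  rewrite horner_coef0 coef_poly -vc /dirderiv -/L.
  case: ltnP => //; rewrite leqn0 size_poly_eq0 => /eqP ->.
  by rewrite coef0.
have E : \sum_b a b *: ('X^(w b - w bm) * (\prod_i u i ^+ b.1 i) * (L 'X_j) ^+ b.2) = 0.
  have Xr0 : 'X^(w bm) != 0 :> {poly K} by rewrite -size_poly_gt0 size_polyXn.
  apply: (mulfI Xr0); rewrite mulr0 -[RHS](rmorph0 (line_eval x v)) -rel rmorph_sum mulr_sumr.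
  apply: eq_bigr => b _; have [->|ab] := eqVneq (a b) 0; first by rewrite !scale0r mulr0 rmorph0.
  rewrite -mul_mpolyC !rmorphM /= line_evalC mul_polyC -scalerAr; congr (_ *: _).
  rewrite rmorphXn rmorph_prod /= mulrA; congr (_ * _); rewrite mulrA -exprD subnKC ?wmin //.
  have -> : \prod_i line_eval x v (f i ^+ b.1 i) = \prod_i ('X ^+ b.1 i * u i ^+ b.1 i).
    apply: eq_bigr => i _; rewrite rmorphXn /= -exprMn -(proj1 (uE i)); reflexivity.
  by rewrite big_split /= prodrXr.
have := congr1 (fun p : {poly K} => p.[0]) E; rewrite horner0 horner_sum => E0.
apply/eqP; apply: etrans E0; apply: eq_bigr => b _.
rewrite !hornerZ hornerXn !hornerM hornerXn /t horner_prod !horner_exp /L line_evalX.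
rewrite !hornerE /= expr0n subn_eq0.
have [->|ab] := eqVneq (a b) 0; first by rewrite mul0r if_same !mul0r.
have wb := wmin _ ab.
rewrite [(w b == w bm)]eqn_leq wb andbT; case: (w b <= w bm)%N; last by rewrite mulr0 !mul0r.
rewrite mulr1; congr (_ * _ * _).
by apply: eq_bigr => i _; rewrite horner_exp (proj2 (uE i)).
Qed.
End Relation.

(** The Jacobian matrix has rank n, so n of its rows form an invertible matrix. *)
Lemma independent_rows n M (x : 'I_n -> K) (f : 'I_M -> {mpoly K[n]}) :
  (forall v : 'I_n -> K, (forall i, dirderiv x v (f i) = 0) -> forall j, v j = 0) ->
  exists g : {ffun 'I_n -> 'I_M},
    forall c : 'I_n -> K, exists v : 'I_n -> K, forall i, dirderiv x v (f (g i)) = c i.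
Proof.
move=> nd; pose J := \matrix_(i < M, j < n) dirderiv x (fun k => (k == j)%:R) (f i).
have Jv (v : 'rV[K]_n) i : (v *m J^T) 0 i = dirderiv x (fun j => v 0 j) (f i).
  by rewrite dirderiv_lin mxE; apply: eq_bigr => j _; rewrite !mxE.
have full : row_full J.
  rewrite /row_full -mxrank_tr; apply: inj_row_free => v vJ.
  apply/rowP => j; rewrite mxE; apply: (nd (fun j => v 0 j)) => i.
  by rewrite -Jv vJ mxE.
exists [ffun i => fullrankfun full i] => c.
pose G := rowsub (fullrankfun full) J.
have Gu : G^T \in unitmx by rewrite unitmx_tr fullrowsub_unit.
pose v := (\row_i c i) *m invmx G^T.
exists (fun j => v 0 j) => i; rewrite ffunE -Jv.
have : v *m G^T = \row_i c i by rewrite mulmxKV.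
move/rowP/(_ i); rewrite mxE [RHS]mxE => <-; rewrite mxE.
by apply: eq_bigr => j _; rewrite !mxE.
Qed.

(* Bezout-type bound: f_1, .., f_n and a coordinate satisfy a polynomial relation; restricting
   its lowest order part to suitable lines through a nondegenerate zero gives a polynomial, the
   same for all zeros, that vanishes at this coordinate. *)
Theorem nondegenerate_zeros_bound n M D : exists bound, forall f : 'I_M -> {mpoly K[n]},
  (forall i, (msize (f i) <= D.+1)%N) -> forall xs : seq {ffun 'I_n -> K}, uniq xs ->
  (forall x : {ffun 'I_n -> K}, x \in xs -> (forall i, (f i).@[x] = 0) /\
     forall v : 'I_n -> K, (forall i, dirderiv x v (f i) = 0) -> forall j, v j = 0) ->
  (size xs <= bound)%N.
Proof.
pose G : finType := ({ffun 'I_n -> 'I_M} * 'I_n)%type; pose B := ((n * D + 2) ^ n).+1.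
pose N := (\sum_(gj : G) B).+1; exists (N.+1 ^ n)%N => f fD xs uxs xsP.
(* Whichever n equations are independent at a zero, its coordinates are roots of the corresponding
   Q; all coordinates of all zeros are thus roots of the single product P. *)
have /choice [Q QP] : forall gj : G, exists Q : {poly K}, [/\ Q != 0, (size Q <= B)%N &
  forall x : 'I_n -> K, (forall i, (f (gj.1 i)).@[x] = 0) ->
    (forall c : 'I_n -> K, exists v : 'I_n -> K, forall i, dirderiv x v (f (gj.1 i)) = c i) ->
    root Q (x gj.2)].
  move=> [g j]; exact: (@coordinate_polynomial n D (fun i => f (g i))).
pose P := \prod_gj Q gj.
have P0 : P != 0 by apply/prodf_neq0 => gj _; have [] := QP gj.
have sP : (size P <= N)%N.
  apply: leq_trans (size_prod_leq _ _) _; apply: leq_trans (leq_subr _ _) _; rewrite ltnS.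
  by apply: leq_sum => gj _; have [] := QP gj.
have [r Er] := closed_field_poly_normal P.
have sr : (size r <= N)%N.
  apply: leq_trans sP; rewrite Er size_scale ?lead_coef_eq0 // size_prod_XsubC.
  exact: leqnSn.
have xr x : x \in xs -> forall j, x j \in r.
  move=> /xsP [fx /independent_rows [g gP]] j.
  have [_ _ /(_ x (fun i => fx _) gP) rQ] := QP (g, j).
  rewrite -root_prod_XsubC -(rootZ _ _ (a := lead_coef P)) ?lead_coef_eq0 // -Er.
  by rewrite /P (bigD1 (g, j)) //= rootM rQ.
pose code (x : {ffun 'I_n -> K}) := [ffun j : 'I_n => inord (index (x j) r) : 'I_N.+1].
have code_inj : {in xs &, injective code}.
  move=> x y xx yx /ffunP E; apply/ffunP => j; have := E j; rewrite !ffunE => /(congr1 val).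
  rewrite /= !inordK ?ltnS; try by apply: leq_trans sr; rewrite index_size.
  by move=> Ei; rewrite -(nth_index (0 : K) (xr _ xx j)) Ei nth_index ?xr.
have : uniq (map code xs) by rewrite map_inj_in_uniq.
move/card_uniqP; rewrite size_map => <-.
by apply: leq_trans (max_card _) _; rewrite card_ffun !card_ord.
Qed.

End Zeros.

Lemma derivation_prod_uniq (R S : comNzRingType) (ev : {rmorphism R -> S}) (D : R -> S)
    (I : eqType) (r : seq I) (F : I -> R) :
  D 1 = 0 -> (forall p q, D (p * q) = D p * ev q + ev p * D q) -> uniq r ->
  D (\prod_(i <- r) F i) = \sum_(i <- r) D (F i) * \prod_(j <- r | j != i) ev (F j).
Proof.
move=> D1 DM; elim: r => [|i r IH] /=; first by rewrite !big_nil.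
case/andP => ir ur; rewrite !big_cons DM eqxx IH //= rmorph_prod; congr (_ * _ + _).
  rewrite [RHS]big_seq_cond [LHS]big_seq_cond; apply: eq_bigl => j.
  by rewrite andbT; case: (boolP (j \in r)) => // jr; apply/esym; apply: contraNneq ir => <-.
rewrite mulr_sumr [LHS]big_seq_cond [RHS]big_seq_cond; apply: eq_bigr => k /andP [kr _].
rewrite big_cons ifT; first by rewrite mulrCA.
by apply: contraNneq ir => ->.
Qed.

(** * Infinitesimal rigidity and counting *)

Section Rigidity.
Variable K : numClosedFieldType.
Implicit Types (p q P Q R U : {poly K}) (w : K).

Lemma coprimep_XsubC_exp w P e : ~~ root P w -> coprimep (('X - w%:P) ^+ e) P.
Proof. by move=> h; rewrite coprimep_expl // coprimep_sym coprimep_XsubC. Qed.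

Lemma exp_XsubC_dvd_le w P i e : ~~ root P w -> ('X - w%:P) ^+ i %| ('X - w%:P) ^+ e * P -> (i <= e)%N.
Proof.
move=> Pw d; have := d; rewrite (Gauss_dvdpl _ (coprimep_XsubC_exp i Pw)).
by rewrite dvdp_Pexp2l // size_XsubC.
Qed.

Lemma dvdp_by_multiplicity P Q : P != 0 ->
  (forall w i, ('X - w%:P) ^+ i %| P -> ('X - w%:P) ^+ i %| Q) -> P %| Q.
Proof.
have [n] := ubnP (size P); elim: n => // n IH in P Q *.
rewrite ltnS => sn P0 H; have [sP|] := boolP (size P == 1%N).
  by have /size_poly1P [c c0 ->] := sP; rewrite -[c%:P]alg_polyC dvdpZl // dvd1p.
case/closed_rootP => w rw; have [Q' EQ] : exists Q', Q = Q' * ('X - w%:P).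
  by apply/dvdpP; rewrite -[_ - _]expr1; apply: H; rewrite expr1 dvdp_XsubCl.
have [P' EP] := factor_theorem _ _ rw; rewrite EP EQ dvdp_mul2r ?polyXsubC_eq0 //.
have P'0 : P' != 0 by apply: contraNneq P0 => P'0; rewrite EP P'0 mul0r.
apply: IH => //.
  by apply: leq_trans sn; rewrite EP size_Mmonic ?monicXsubC // size_XsubC addn2.
move=> u i di; have [uw|uw] := eqVneq u w.
  have := H u i.+1; rewrite EP EQ uw exprSr !dvdp_mul2r ?polyXsubC_eq0 //.
  by rewrite -uw; apply.
have cu : coprimep (('X - u%:P) ^+ i) ('X - w%:P).
  by apply: coprimep_XsubC_exp; rewrite root_XsubC.
by rewrite -(Gauss_dvdpl _ cu) -EQ; apply: H; rewrite EP dvdp_mulr.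
Qed.

Lemma multiplicityP w P : P != 0 -> exists e U, P = ('X - w%:P) ^+ e * U /\ ~~ root U w.
Proof.
move=> P0; have [e [U]] := multiplicity_XsubC P w; rewrite P0 /= => Uw ->.
by exists e, U; rewrite mulrC.
Qed.

Lemma root_exp_gt0 w e U : ~~ root U w -> root (('X - w%:P) ^+ e * U) w -> (0 < e)%N.
Proof. by move=> Uw; rewrite rootM (negPf Uw) orbF; case: e => //; rewrite expr0 /root hornerC oner_eq0. Qed.

(** The combination is (X - w)^(e-1) times a polynomial whose value at w is e U(w) Q(w), nonzero in
    characteristic 0. *)
Lemma wronskian_multiplicity w e U Q i : (0 < e)%N -> ~~ root U w -> ~~ root Q w ->
  let P := ('X - w%:P) ^+ e * U in
  ('X - w%:P) ^+ i %| P^`() * Q - P * Q^`() -> (i <= e.-1)%N.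
Proof.
case: e => // e _ Uw Qw /=; set L := 'X - w%:P.
have -> : (L ^+ e.+1 * U)^`() * Q - (L ^+ e.+1 * U) * Q^`() =
    L ^+ e * ((e.+1%:R *: U + L * U^`()) * Q - L * U * Q^`()).
  rewrite derivM deriv_exp /= derivXsubC mul1r exprS -mulr_natl scaler_nat.
  rewrite -mulr_natl; move: (L ^+ e) => Le; ring.
have Lw : L.[w] = 0 by rewrite hornerXsubC subrr.
apply: exp_XsubC_dvd_le; move: (L) Lw => M Mw.
rewrite /root !(hornerD, hornerN, hornerM, hornerZ) Mw.
rewrite !mul0r subr0 addr0 !mulf_eq0 !negb_or; apply/andP; split=> //.
by rewrite pnatr_eq0.
Qed.

Section Prod.
Variables (n : nat) (c : 'I_n -> K).

Definition rprod := \prod_j ('X - (c j)%:P).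
Definition rprod' j := \prod_(i | i != j) ('X - (c i)%:P).
(** Minus the derivative of [rprod] when each root [c j] moves with velocity [a j]. *)
Definition drprod (a : 'I_n -> K) := \sum_j a j *: rprod' j.

Lemma rprodE j : rprod = ('X - (c j)%:P) * rprod' j.
Proof. by rewrite /rprod (bigD1 j). Qed.

Lemma rprod_monic : rprod \is monic.
Proof. exact: monic_prod_XsubC. Qed.

Lemma size_rprod : size rprod = n.+1.
Proof. by rewrite size_prod_XsubC /index_enum -enumT size_enum_ord. Qed.

Lemma root_rprod j : root rprod (c j).
Proof. by rewrite (rprodE j) rootM root_XsubC eqxx. Qed.

Lemma size_rprod' j : size (rprod' j) = n.
Proof.
have := size_rprod; rewrite (rprodE j) size_monicM ?monicXsubC //; last first.
  by apply/prodf_neq0 => i _; rewrite polyXsubC_eq0.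
by rewrite size_XsubC add2n => -[].
Qed.

Lemma size_drprod a : (size (drprod a) <= n)%N.
Proof.
apply: leq_trans (size_sum _ _ _) _; apply/bigmax_leqP => j _.
by apply: leq_trans (size_scale_leq _ _) _; rewrite size_rprod'.
Qed.

Lemma rprod'_dvd w e j : ('X - w%:P) ^+ e.+1 %| rprod -> ('X - w%:P) ^+ e %| rprod' j.
Proof.
rewrite (rprodE j); have [->|cw] := eqVneq (c j) w.
  by rewrite exprS dvdp_mul2l // polyXsubC_eq0.
have cc : coprimep (('X - w%:P) ^+ e.+1) ('X - (c j)%:P).
  by apply: coprimep_XsubC_exp; rewrite root_XsubC eq_sym.
rewrite (Gauss_dvdpr _ cc); apply: dvdp_trans.
by rewrite exprS dvdp_mulIr.
Qed.

Lemma drprod_dvd w e a : ('X - w%:P) ^+ e.+1 %| rprod -> ('X - w%:P) ^+ e %| drprod a.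
Proof.
move=> d; rewrite /drprod; apply: (big_ind (fun t => _ %| t)) => [|p q|j _]; first exact: dvdp0.
  exact: dvdp_add.
by rewrite -mul_polyC dvdp_mull // rprod'_dvd.
Qed.

Lemma deriv_rprod : rprod^`() = drprod (fun=> 1).
Proof.
rewrite /rprod (derivation_prod_uniq (ev := idfun)) ?index_enum_uniq //.
- by apply: eq_bigr => j _; rewrite derivXsubC mul1r scale1r.
- exact: derivC.
- exact: derivM.
Qed.

Lemma horner_drprod a j : a j = 0 -> (drprod a).[c j] = 0.
Proof.
move=> aj; rewrite horner_sum big1 // => i _; rewrite hornerZ.
have [->|ij] := eqVneq i j; first by rewrite aj mul0r.
by rewrite /rprod' horner_prod (bigD1 j) 1?eq_sym //= hornerXsubC subrr mul0r mulr0.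
Qed.

End Prod.

(** Q stands for the derivatives, or for the variations, of members P of a pencil. The Wronskian of
    P_k with P0 or P1 is proportional to that of P0 and P1, which can thus be studied in the fibre
    over any T_k. *)
Lemma wronskian_pencil (P0 P1 Pk Q0 Q1 Qk : {poly K}) (d al be : K) :
  d *: Pk = al *: P0 + be *: P1 -> d *: Qk = al *: Q0 + be *: Q1 ->
  d *: (Qk * P1 - Pk * Q1) = al *: (Q0 * P1 - P0 * Q1) /\
  d *: (Q0 * Pk - P0 * Qk) = be *: (Q0 * P1 - P0 * Q1).
Proof.
rewrite -!mul_polyC => EP EQ; split.
  have -> : d%:P * (Qk * P1 - Pk * Q1) = d%:P * Qk * P1 - d%:P * Pk * Q1 by ring.
  by rewrite EP EQ; ring.
have -> : d%:P * (Q0 * Pk - P0 * Qk) = Q0 * (d%:P * Pk) - P0 * (d%:P * Qk) by ring.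
by rewrite EP EQ; ring.
Qed.

(** At a root c_j of multiplicity e of P = [rprod c], the sum is congruent to a_j P' modulo (X -
    c_j)^e, because coinciding roots have the same velocity. Only (X - c_j)^(e-1) divides P', so a_j
    = 0. *)
Lemma grouped_drprod_eq0 n (c a : 'I_n -> K) : (forall i j, c i = c j -> a i = a j) ->
  drprod c a = 0 -> forall j, a j = 0.
Proof.
move=> ac da j; have P0 : rprod c != 0 by rewrite monic_neq0 ?rprod_monic.
have [e [U [EP Uw]]] := multiplicityP (c j) P0.
have e0 : (0 < e)%N by apply: (root_exp_gt0 Uw); rewrite -EP root_rprod.
have dvd1 : ('X - (c j)%:P) ^+ e %| drprod c a - a j *: (rprod c)^`().
  rewrite deriv_rprod /drprod scaler_sumr -sumrB.
  apply: (big_ind (fun t => _ %| t)) => [|p q|i _]; [exact: dvdp0|exact: dvdp_add|].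
  rewrite scale1r -scalerBl; have [E|ij] := eqVneq (c i) (c j).
    by rewrite (ac _ _ E) subrr scale0r dvdp0.
  rewrite -mul_polyC dvdp_mull //.
  have cc : coprimep (('X - (c j)%:P) ^+ e) ('X - (c i)%:P).
    by apply: coprimep_XsubC_exp; rewrite root_XsubC eq_sym.
  by rewrite -(Gauss_dvdpr _ cc) -rprodE EP dvdp_mulIl.
rewrite da sub0r dvdpNr in dvd1; apply/eqP; apply: contraT => aj.
rewrite dvdpZr // in dvd1.
have := @wronskian_multiplicity (c j) e U 1 e e0 Uw; rewrite /root hornerC oner_neq0 => /(_ isT) /=.
rewrite -EP derivC mulr0 subr0 mulr1 => /(_ dvd1).
by case: (e) e0 => // k _; rewrite ltnn.
Qed.

Section Configuration.
Variables (I : Type) (k0 k1 : I) (T : I -> K) (m : nat) (c : I -> 'I_m.+1 -> K).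
Hypothesis T01 : T k0 != T k1.
Hypothesis pencil : forall k,
  (T k1 - T k0) *: rprod (c k) = (T k1 - T k) *: rprod (c k0) + (T k - T k0) *: rprod (c k1).
Hypotheses (c0 : c k0 ord0 = 0) (c1 : c k1 ord0 = 1).
Hypothesis cop : coprimep (rprod (c k0)) (rprod (c k1)).
Hypothesis sdiff : size (rprod (c k0) - rprod (c k1)) = m.+1.
Let W := (rprod (c k0))^`() * rprod (c k1) - rprod (c k0) * (rprod (c k1))^`().
Hypothesis crit : forall w, root W w -> exists k, root (rprod (c k)) w.
Hypotheses (W0 : ~~ root W 0) (W1 : ~~ root W 1).
(* [a] is a tangent vector to the space of configurations, and [dW] below is proportional to
   the numerator of the variation of X; see [dW_eq0]. *)
Variable a : I -> 'I_m.+1 -> K.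
Hypothesis dpencil : forall k, (T k1 - T k0) *: drprod (c k) (a k) =
  (T k1 - T k) *: drprod (c k0) (a k0) + (T k - T k0) *: drprod (c k1) (a k1).
Hypotheses (a0 : a k0 ord0 = 0) (a1 : a k1 ord0 = 0).
Hypothesis agroup : forall k i j, c k i = c k j -> a k i = a k j.

Let dW := drprod (c k0) (a k0) * rprod (c k1) - rprod (c k0) * drprod (c k1) (a k1).

Let d0 : T k1 - T k0 != 0. Proof. by rewrite subr_eq0 eq_sym. Qed.

Lemma pencil_deriv k : (T k1 - T k0) *: (rprod (c k))^`() =
  (T k1 - T k) *: (rprod (c k0))^`() + (T k - T k0) *: (rprod (c k1))^`().
Proof. by rewrite -!derivZ pencil derivD. Qed.

(** For r = P0 - P1, W = P0 r' - P0' r has m r_m - (m + 1) r_m = - r_m as coefficient of degree 2m.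
    Geometrically, the 2 (m + 1) - 2 critical points are all finite. *)
Lemma size_W : (2 * m < size W)%N.
Proof.
pose r := rprod (c k0) - rprod (c k1).
have EW : W = rprod (c k0) * r^`() - (rprod (c k0))^`() * r.
  by rewrite /W /r derivB; ring.
have rm : r`_m != 0.
  have := lead_coef_eq0 r; rewrite lead_coefE /r sdiff /= => ->.
  by rewrite -size_poly_gt0 sdiff.
have sP := size_rprod (c k0); have lP : (rprod (c k0))`_m.+1 = 1.
  by have := monicP (rprod_monic (c k0)); rewrite lead_coefE sP.
have h1 : (rprod (c k0) * r^`())`_(m + m) = m%:R * r`_m.
  move: sdiff rm; rewrite -/r; case: (m) (rprod (c k0)) sP lP => [|m'] P sP lP sr rm.
    have /size1_polyC -> : (size r <= 1)%N by rewrite sr.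
    by rewrite derivC mulr0 coef0 mul0r.
  rewrite -addSnnS coefM_top ?sP //.
    by rewrite lP mul1r coef_deriv mulr_natl.
  by apply: leq_trans (size_poly _ _) _; rewrite sr.
have h2 : ((rprod (c k0))^`() * r)`_(m + m) = m.+1%:R * r`_m.
  rewrite coefM_top ?sdiff //; first by rewrite coef_deriv lP mulr_natl.
  by apply: leq_trans (size_poly _ _) _; rewrite sP.
rewrite ltnNge; apply/negP => /leq_sizeP /(_ (m + m)%N); rewrite mul2n -addnn => /(_ (leqnn _)).
rewrite EW coefB h1 h2 -mulrBl -natr1 opprD addrA subrr sub0r mulN1r => /eqP.
by rewrite oppr_eq0 (negPf rm).
Qed.

(* At a critical point of multiplicity e in its fibre, W vanishes to order exactly e - 1, and
   so does dW at least because coinciding points move together. *)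
Lemma W_dvd_dW : W %| dW.
Proof.
apply: dvdp_by_multiplicity => [|w [|i] di]; first by rewrite -size_poly_gt0; apply: leq_trans size_W.
  by rewrite expr0 dvd1p.
have rW : root W w by rewrite -dvdp_XsubCl; apply: dvdp_trans di; rewrite exprS dvdp_mulIl.
have [k rk] := crit rW.
have Pk0 : rprod (c k) != 0 by rewrite monic_neq0 ?rprod_monic.
have [e [U [EP Uw]]] := multiplicityP w Pk0.
have e0 : (0 < e)%N by apply: (root_exp_gt0 Uw); rewrite -EP.
have dP : ('X - w%:P) ^+ e.-1 %| drprod (c k) (a k).
  by apply: drprod_dvd; rewrite prednK // EP dvdp_mulIl.
have dPk : ('X - w%:P) ^+ e.-1 %| rprod (c k).
  by rewrite EP -(prednK e0) exprSr -mulrA dvdp_mulIl.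
have [W1E W2E] := wronskian_pencil (pencil k) (pencil_deriv k).
have [dW1E dW2E] := wronskian_pencil (pencil k) (dpencil k).
have nroot k' k'' s : s != 0 -> s *: rprod (c k') = 
   (T k1 - T k0) *: rprod (c k) - (T k1 - T k0 - s) *: rprod (c k'') -> 
   (forall u, root (rprod (c k')) u -> ~~ root (rprod (c k'')) u) -> ~~ root (rprod (c k'')) w.
  move=> s0 Es cu; apply/negP => r''; have : root (rprod (c k')) w; last by move/cu; rewrite r''.
  rewrite -(rootZ _ _ s0) Es /root hornerD hornerN !hornerZ.
  by move: rk r''; rewrite /root => /eqP -> /eqP ->; rewrite !mulr0 subr0.
(* W is computed from P_k and a second member of the pencil that does not vanish at w: P1, unless T
   k = T k1, and then P0. *)
have [ak|ak] := eqVneq (T k1 - T k) 0.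
  have bk : T k - T k0 = T k1 - T k0 by rewrite -(subr0_eq ak).
  have P0w : ~~ root (rprod (c k0)) w.
    apply: (nroot k1 k0 (T k1 - T k0)) => //.
      by rewrite subrr scale0r subr0 pencil ak bk scale0r add0r.
    by move=> u ru; move/coprimep_root: cop => cu; apply: contraL ru => /cu.
  have iE : (i.+1 <= e.-1)%N.
    apply: (wronskian_multiplicity e0 Uw P0w); rewrite -EP.
    have -> : (rprod (c k))^`() * rprod (c k0) - rprod (c k) * (rprod (c k0))^`() =
       - ((rprod (c k0))^`() * rprod (c k) - rprod (c k0) * (rprod (c k))^`()) by ring.
    by rewrite dvdpNr -(dvdpZr _ _ d0) W2E bk dvdpZr.
  apply: dvdp_trans (dvdp_exp2l _ iE) _.
  rewrite -(dvdpZr _ _ d0) -bk /dW -dW2E dvdpZr // dvdp_sub //.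
    by rewrite dvdp_mull.
  by rewrite dvdp_mull.
have P1w : ~~ root (rprod (c k1)) w.
  apply: (nroot k0 k1 (T k1 - T k)) => //.
    rewrite pencil; have -> : T k1 - T k0 - (T k1 - T k) = T k - T k0 by ring.
    by rewrite addrK.
  by move=> u ru; move/coprimep_root: cop => /(_ _ ru).
have iE : (i.+1 <= e.-1)%N.
  apply: (wronskian_multiplicity e0 Uw P1w); rewrite -EP.
  by rewrite -(dvdpZr _ _ d0) W1E dvdpZr.
apply: dvdp_trans (dvdp_exp2l _ iE) _.
rewrite -(dvdpZr _ _ ak) /dW -dW1E dvdpZr // dvdp_sub //.
  by rewrite dvdp_mulr.
by rewrite dvdp_mulr.
Qed.

(* The quotient dW / W has degree at most 1 and vanishes at 0 and 1. *)
Lemma dW_eq0 : dW = 0.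
Proof.
have /dvdpP [g Eg] := W_dvd_dW.
have [->|dW0] := eqVneq dW 0; first by [].
exfalso.
have W_0 : W != 0 by rewrite -size_poly_gt0; apply: leq_trans size_W.
have g0 : g != 0 by apply: contraNneq dW0 => g0; rewrite Eg g0 mul0r.
have sdW : (size dW <= 2 * m + 2)%N.
  have sm (u v : {poly K}) : (size u <= m.+1)%N -> (size v <= m.+2)%N -> (size (u * v)%R <= 2 * m + 2)%N.
    move=> su sv; apply: leq_trans (size_polyMleq _ _) _; move: su sv; move: (size u) (size v).
    by clear; lia.
  apply: leq_trans (size_polyD _ _) _; rewrite geq_max size_polyN.
  rewrite sm ?size_drprod ?size_rprod //= mulrC sm ?size_drprod ?size_rprod //.
have sg : (size g <= 2)%N.
  move: sdW size_W; rewrite Eg size_mul //; move: (size g) (size W); clear; lia.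
have := @max_poly_roots _ g [:: 0; 1] g0; rewrite /= inE eq_sym oner_eq0 /= => H.
suff /H : [&& root g 0, root g 1 & true] by move/(_ isT); rewrite ltnNge sg.
have rg u : root dW u -> ~~ root W u -> root g u by rewrite Eg rootM => /orP [//|->].
rewrite !rg //.
  rewrite /dW /root hornerD hornerN !hornerM -{1 3}c1.
  have /eqP := root_rprod (c k1) ord0; rewrite c1 => ->.
  have := horner_drprod (c k1) a1; rewrite c1 => ->.
  by rewrite !mulr0 subrr.
rewrite /dW /root hornerD hornerN !hornerM.
have /eqP := root_rprod (c k0) ord0; rewrite c0 => ->.
have := horner_drprod (c k0) a0; rewrite c0 => ->.
by rewrite !mul0r subrr.
Qed.

(** By dW = 0 and coprimality, P0 divides its own variation, which has smaller degree. So the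
    variations of P0 and P1 vanish, hence those of all P_k by the pencil, and [grouped_drprod_eq0]
    applies. *)
Lemma configuration_rigid k j : a k j = 0.
Proof.
have E := subr0_eq dW_eq0.
have P00 : rprod (c k0) != 0 by rewrite monic_neq0 ?rprod_monic.
have D0 : drprod (c k0) (a k0) = 0.
  apply/eqP; apply: contraT => D0; exfalso.
  have := dvdp_leq D0 (_ : rprod (c k0) %| _); rewrite -(Gauss_dvdpl _ cop) E dvdp_mulIl => /(_ isT).
  by rewrite size_rprod leqNgt ltnS size_drprod.
have D1 : drprod (c k1) (a k1) = 0.
  move/esym/eqP: E; rewrite D0 mul0r mulf_eq0 (negPf P00) => /eqP; exact.
apply: (grouped_drprod_eq0 (c := c k)); first exact: agroup.
apply: (scalerI d0); rewrite dpencil D0 D1 !scaler0 addr0; reflexivity.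
Qed.

End Configuration.
End Rigidity.

Section Counting.
Variable K : numClosedFieldType.

Section System.
Variables (t m : nat) (T : 'I_t.+2 -> K).
Local Notation I := 'I_t.+2.
Local Notation J := 'I_m.+1.
Local Notation k0 := (ord0 : I).
Local Notation k1 := (ord_max : I).
Local Notation N := #|{: I * J}|.

(* [c k] lists, with multiplicity, the fibre of X = (P0 + T k0 q) / q over [T k], where P_k is
   [rprod (c k)] and q is (P0 - P1) / (T k1 - T k0). The Moebius group is fixed by a simple pole
   at infinity and by the points 0 and 1 in the fibres of [k0] and [k1], and [W] is proportional
   to the numerator of X'. *)
Definition configuration (c : I -> J -> K) :=
  let W := (rprod (c k0))^`() * rprod (c k1) - rprod (c k0) * (rprod (c k1))^`() in
  [/\ forall k, (T k1 - T k0) *: rprod (c k) =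
        (T k1 - T k) *: rprod (c k0) + (T k - T k0) *: rprod (c k1),
      c k0 ord0 = 0 /\ c k1 ord0 = 1,
      coprimep (rprod (c k0)) (rprod (c k1)),
      size (rprod (c k0) - rprod (c k1)) = m.+1 &
      (forall w, root W w -> exists k, root (rprod (c k)) w) /\ ~~ root W 0 /\ ~~ root W 1].

Definition var (k : I) (j : J) : 'I_N := enum_rank (k, j).

Definition gprod (k : I) : {poly {mpoly K[N]}} := \prod_j ('X - ('X_(var k j))%:P).

(* [kap] records which points of a fibre coincide: without the linear equations it gives, a
   multiple point could split along a tangent vector. *)
Definition equation (kap : I -> J -> J) (s : (I * 'I_m.+2) + (I * J) + bool) : {mpoly K[N]} :=
  match s with
  | inl (inl (k, i)) => (T k1 - T k0)%:MP * (gprod k)`_i - (T k1 - T k)%:MP * (gprod k0)`_i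
                        - (T k - T k0)%:MP * (gprod k1)`_i
  | inl (inr (k, j)) => 'X_(var k j) - 'X_(var k (kap k j))
  | inr b => if b then 'X_(var k0 ord0) else 'X_(var k1 ord0) - 1%:MP
  end.

Lemma msize_add_le (p q : {mpoly K[N]}) d : (msize p <= d)%N -> (msize q <= d)%N -> (msize (p + q) <= d)%N.
Proof. by move=> hp hq; apply: leq_trans (mmeasureD_le _ _ _) _; rewrite geq_max hp. Qed.

Lemma msize_opp (p : {mpoly K[N]}) : msize (- p) = msize p.
Proof. exact: mmeasureN. Qed.

Lemma msize_gprod k i : (msize ((gprod k)`_i) <= m.+2)%N.
Proof.
suff H (r : seq J) : forall i, (msize ((\prod_(j <- r) ('X - ('X_(var k j))%:P) : {poly {mpoly K[N]}})`_i) <= (size r).+1)%N.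
  by apply: leq_trans (H _ _) _; rewrite /index_enum -enumT size_enum_ord.
elim: r => [|j r IH] {}i.
  by rewrite big_nil coef1; case: (i == 0)%N; rewrite ?msize1 ?msize0.
rewrite big_cons mulrBl coefB coefXM coefCM /=; apply: msize_add_le.
  by case: (i == 0)%N; [rewrite msize0|apply: leq_trans (IH _) (leqnSn _)].
rewrite msize_opp; apply: (@msize_mul_le _ _ _ _ 1 (size r)) => //.
by rewrite msizeX mdeg1.
Qed.

Lemma msize_equation kap s : (msize (equation kap s) <= m.+2)%N.
Proof.
have sX (i : 'I_N) : (msize ('X_i : {mpoly K[N]}) <= m.+2)%N by rewrite msizeX mdeg1.
case: s => [[[k i]|[k j]]|[]] /=.
- rewrite msize_add_le ?msize_opp ?msize_add_le ?msize_opp //; apply: (@msize_mul_le _ _ _ _ 0 m.+1);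
    by rewrite ?msize_gprod // msizeC; case: (_ != _).
- by rewrite msize_add_le ?msize_opp.
- exact: sX.
- by rewrite msize_add_le ?msize_opp ?sX // msizeC; case: (_ != _).
Qed.

Variables (x v : 'I_N -> K).
Let c k j := x (var k j).
Let a k j := v (var k j).

Lemma meval_gprod k i : ((gprod k)`_i).@[x] = (rprod (c k))`_i.
Proof.
have <- : map_poly (meval x) (gprod k) = rprod (c k).
  rewrite /gprod rmorph_prod; apply: eq_bigr => j _.
  by rewrite rmorphB /= map_polyX map_polyC /= mevalXU.
by rewrite coef_map.
Qed.

Lemma dirderiv0 : dirderiv x v 0 = 0.
Proof. by rewrite /dirderiv rmorph0 coef0. Qed.
Lemma dirderivC e : dirderiv x v e%:MP = 0.
Proof. by rewrite /dirderiv line_evalC coefC. Qed.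
Lemma dirderivX i : dirderiv x v 'X_i = v i.
Proof. by rewrite /dirderiv line_evalX coefD coefC coefMX coefC add0r. Qed.
Lemma dirderivB p q : dirderiv x v (p - q) = dirderiv x v p - dirderiv x v q.
Proof. by rewrite /dirderiv rmorphB coefB. Qed.
Lemma dirderivCM e p : dirderiv x v (e%:MP * p) = e * dirderiv x v p.
Proof. by rewrite dirderivM dirderivC mevalC mul0r add0r. Qed.

Lemma dirderiv_gprod k i : dirderiv x v (gprod k)`_i = - (drprod (c k) (a k))`_i.
Proof.
pose D (P : {poly {mpoly K[N]}}) : {poly K} := map_poly (dirderiv x v) P.
have DE P j : (D P)`_j = dirderiv x v P`_j by rewrite coef_map_id0 // dirderiv0.
rewrite -DE -coefN; suff -> : D (gprod k) = - drprod (c k) (a k) by [].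
rewrite /gprod (derivation_prod_uniq (ev := map_poly (meval x))) ?index_enum_uniq //.
- rewrite /drprod -sumrN; apply: eq_bigr => j _.
  have -> : D ('X - ('X_(var k j))%:P) = - (a k j)%:P.
    apply/polyP => l; rewrite DE coefB dirderivB coefX !coefC coefN coefC.
    case: l => [|[|l]] /=; rewrite ?dirderivX ?dirderiv0 ?sub0r ?subr0 //.
    by rewrite -mpolyC1 dirderivC oppr0.
  rewrite mulNr mul_polyC; congr (- (_ *: _)); rewrite /rprod'; apply: eq_bigr => l _.
  by rewrite rmorphB /= map_polyX map_polyC /= mevalXU.
- apply/polyP => l; rewrite DE coef1 coef0; case: (l == 0)%N; last exact: dirderiv0.
  by rewrite -mpolyC1 dirderivC.
move=> p q; apply/polyP => l; rewrite DE coefD !coefM /dirderiv rmorph_sum coef_sum -big_split /=.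
by apply: eq_bigr => j _; rewrite -/(dirderiv x v _) dirderivM !coef_map !DE.
Qed.

Lemma comb_opp (a1 a2 a3 b1 b2 b3 : K) :
  a1 * b1 - a2 * b2 - a3 * b3 = - (a1 * - b1 - a2 * - b2 - a3 * - b3).
Proof. by ring. Qed.

Lemma meval_comb e e0 e1 (P P0 P1 : {mpoly K[N]}) :
  (e%:MP * P - e0%:MP * P0 - e1%:MP * P1).@[x] = e * P.@[x] - e0 * P0.@[x] - e1 * P1.@[x].
Proof. by rewrite !mevalB !mevalM !mevalC. Qed.

Lemma dirderiv_comb e e0 e1 (P P0 P1 : {mpoly K[N]}) :
  dirderiv x v (e%:MP * P - e0%:MP * P0 - e1%:MP * P1) =
  e * dirderiv x v P - e0 * dirderiv x v P0 - e1 * dirderiv x v P1.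
Proof. by rewrite !dirderivB !dirderivCM. Qed.

Lemma meval_pencil kap k i : (equation kap (inl (inl (k, i)))).@[x] =
  ((T k1 - T k0) *: rprod (c k) - (T k1 - T k) *: rprod (c k0) - (T k - T k0) *: rprod (c k1))`_i.
Proof.
rewrite coefB coefB coefZ coefZ coefZ -(meval_gprod k i) -(meval_gprod k0 i) -(meval_gprod k1 i).
exact: meval_comb.
Qed.

Lemma dirderiv_pencil kap k i : dirderiv x v (equation kap (inl (inl (k, i)))) =
  - ((T k1 - T k0) *: drprod (c k) (a k) - (T k1 - T k) *: drprod (c k0) (a k0)
     - (T k - T k0) *: drprod (c k1) (a k1))`_i.
Proof.
have e l : (drprod (c l) (a l))`_i = - dirderiv x v (gprod l)`_i by rewrite dirderiv_gprod opprK.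
rewrite coefB coefB coefZ coefZ coefZ (e k) (e k0) (e k1).
apply: etrans (dirderiv_comb _ _ _ _ _ _) _; exact: comb_opp.
Qed.

End System.

(** Each index is sent to a representative of the indices carrying the same point of the fibre, so
    that patterns of coincidences form a finite type. The default is never taken, since the index
    itself is a candidate. *)
Definition same_root (t m : nat) (c : {ffun 'I_t.+2 * 'I_m.+1 -> K}) :
    {ffun 'I_t.+2 * 'I_m.+1 -> 'I_m.+1} :=
  [ffun kj => odflt kj.2 [pick i | c (kj.1, i) == c kj]].

Lemma same_rootE t m (c : {ffun 'I_t.+2 * 'I_m.+1 -> K}) k j :
  c (k, same_root c (k, j)) = c (k, j).
Proof. by rewrite ffunE; case: pickP => [i /eqP|/(_ j)] //=; rewrite eqxx. Qed.

Lemma same_root_eq t m (c : {ffun 'I_t.+2 * 'I_m.+1 -> K}) k i j :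
  c (k, i) = c (k, j) -> same_root c (k, i) = same_root c (k, j).
Proof.
move=> E; rewrite !ffunE /= (eq_pick (Q := fun l => c (k, l) == c (k, j))); last first.
  by move=> l /=; rewrite E.
by case: pickP => // /(_ j); rewrite eqxx.
Qed.

Lemma size_sum_count (X : Type) (S : finType) (f : X -> S) (xs : seq X) :
  size xs = (\sum_s count (fun y => f y == s) xs)%N.
Proof.
elim: xs => [|y xs IH] /=; first by rewrite big1.
by rewrite big_split /= -IH (bigD1 (f y)) //= eqxx big1 ?addn0 // => s /negPf; rewrite eq_sym => ->.
Qed.

(** Configurations are sorted by pattern of coincidences. Those with a given pattern are
    nondegenerate zeros of one system, whose numbers of equations and variables and whose degree
    depend only on t and m. *)
Theorem configuration_count t m : exists bound, forall (T : 'I_t.+2 -> K), T ord0 != T ord_max ->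
  forall cs : seq {ffun 'I_t.+2 * 'I_m.+1 -> K}, uniq cs ->
  (forall c : {ffun _ -> K}, c \in cs -> configuration T (fun k j => c (k, j))) ->
  (size cs <= bound)%N.
Proof.
pose I := 'I_t.+2; pose J := 'I_m.+1; pose N := #|{: I * J}|.
pose E : finType := ((I * 'I_m.+2) + (I * J) + bool)%type.
have [b bP] := @nondegenerate_zeros_bound K N #|{: E}| m.+1.
exists (\sum_(kap : {ffun I * J -> J}) b)%N => T T01 cs ucs csP.
rewrite (size_sum_count (@same_root t m)); apply: leq_sum => kap _; rewrite -size_filter.
pose conv (c : {ffun I * J -> K}) : {ffun 'I_N -> K} := [ffun i => c (enum_val i)].
have convE c k j : conv c (var k j) = c (k, j) by rewrite ffunE /var enum_rankK.
have conv_inj : injective conv.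
  by move=> c c' /ffunP e; apply/ffunP => -[k j]; rewrite -!convE e.
rewrite -(size_map conv).
apply: (bP (fun i => equation T (fun k j => kap (k, j)) (enum_val i))).
- by move=> i; exact: msize_equation.
- by rewrite map_inj_uniq // filter_uniq.
move=> x /mapP [c]; rewrite mem_filter => /andP [/eqP kapE /csP [pen [c0 c1] cop sd [crit [W0 W1]]]] ->.
have rpE k : rprod (fun j => conv c (var k j)) = rprod (fun j => c (k, j)).
  by apply: eq_bigr => j _; rewrite convE.
have drpE a k : drprod (fun j => conv c (var k j)) a = drprod (fun j => c (k, j)) a.
  by apply: eq_bigr => j _; congr (_ *: _); apply: eq_bigr => i _; rewrite convE.
have convX k j : ('X_(var k j)).@[conv c] = c (k, j) by rewrite mevalXU convE.
have convS k j : kap (k, j) = same_root c (k, j) by rewrite kapE.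
clearbody conv.
split=> [i|v hv j].
  case: (enum_val i) => [[[k l]|[k j]]|[]].
  - rewrite meval_pencil !rpE pen.
    suff -> : forall p q : {poly K}, p + q - p - q = 0 by rewrite coef0.
    by move=> p q; ring.
  - by rewrite /equation mevalB !convX convS same_rootE subrr.
  - by rewrite /equation convX.
  by rewrite /equation mevalB convX mevalC c1 subrr.
have ev s : dirderiv (conv c) v (equation T (fun k j => kap (k, j)) s) = 0.
  by have := hv (enum_rank s); rewrite enum_rankK.
rewrite -[j]enum_valK; case: (enum_val j) => k l; rewrite -/(var k l).
apply: (configuration_rigid (a := fun k j => v (var k j)) T01 pen c0 c1 cop sd crit W0 W1).
- move=> k'; apply/polyP => i; have [im|im] := ltnP i m.+2; last first.
    have z k'' a : (drprod (fun j => c (k'', j)) a)`_i = 0.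
      by apply: (leq_sizeP _ _ (size_drprod _ _)); apply: leq_trans im.
    by rewrite coefD !coefZ !z !mulr0 addr0.
  have := ev (inl (inl (k', Ordinal im))); rewrite dirderiv_pencil !drpE => /eqP.
  rewrite oppr_eq0 !coefB coefD => /eqP e.
  by apply/eqP; rewrite -subr_eq0 opprD addrA; apply/eqP.
- by have := ev (inr true); rewrite /= dirderivX.
- by have := ev (inr false); rewrite /= dirderivB dirderivX dirderivC subr0.
move=> k' i i' e.
have h i0 : v (var k' i0) = v (var k' (kap (k', i0))).
  have := ev (inl (inr (k', i0))); rewrite /= dirderivB !dirderivX => /eqP.
  by rewrite subr_eq0 => /eqP.
by rewrite h [RHS]h !convS (same_root_eq e).
Qed.
End Counting.

Lemma frac_scale (F : fieldType) (k a b : F) : k != 0 -> a / b = (k * a) / (k * b).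
Proof. by move=> k0; rewrite -mulf_div divff // mul1r. Qed.

(** A family of pairwise inequivalent elements of maximal size meets every class. *)
Lemma maximal_family (X : eqType) (P : X -> Prop) (E : X -> X -> Prop) B :
  (forall y, E y y) -> (forall y z, E y z -> E z y) ->
  (forall s : seq X, uniq s -> (forall y, y \in s -> P y) ->
    {in s &, forall y z, E y z -> y = z} -> (size s <= B)%N) ->
  exists s : seq X, [/\ uniq s, forall y, y \in s -> P y & forall y, P y -> exists2 z, z \in s & E y z].
Proof.
move=> Er Es bd.
pose Q n := `[< exists s : seq X, [/\ uniq s, forall y, y \in s -> P y,
   {in s &, forall y z, E y z -> y = z} & size s = n] >].
have Q0 : exists n, Q n by exists 0%N; apply/asboolP; exists [::]; split.
have QB n : Q n -> (n <= B)%N by move=> /asboolP [s [us Ps Is <-]]; exact: bd.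
case: (ex_maxnP Q0 QB) => n /asboolP [s [us Ps Is sn]] max.
exists s; split=> // y Py; apply: contrapT => ny.
have nE z : z \in s -> ~ E y z by move=> zs Ez; apply: ny; exists z.
suff : (n.+1 <= n)%N by rewrite ltnn.
apply: max; apply/asboolP; exists (y :: s); split; rewrite /= ?sn //.
- by rewrite us andbT; apply/negP => ys; case: (nE y ys).
- by move=> z; rewrite inE => /predU1P [->|/Ps].
move=> a b; rewrite !inE => /predU1P [->|sa] /predU1P [->|sb] // e.
- by case: (nE b sb).
- by case: (nE a sa); exact: Es.
exact: Is.
Qed.

(** * Functions with prescribed critical values *)

Section Normalization.
Variable K : numClosedFieldType.
Local Notation ratK := {fraction {poly K}}.
Local Notation const c := (@tofrac {poly K} (polyC c)).
Local Notation x := (ratvar K).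
Implicit Types (f g X : ratK) (p q P : {poly K}).

Lemma double_root P w : root P w -> root P^`() w -> ('X - w%:P) ^+ 2 %| P.
Proof.
move=> /factor_theorem [Q EQ]; rewrite {1}EQ derivM derivXsubC mulr1 rootE hornerD hornerM.
have -> : ('X - w%:P).[w] = 0 by rewrite hornerXsubC subrr.
rewrite mulr0 add0r EQ expr2 => rQ; rewrite dvdp_mul2r ?polyXsubC_eq0 //.
by rewrite dvdp_XsubCl.
Qed.

Lemma ram_double f p q w : coprimep p q -> q != 0 -> f = p%:F / q%:F ->
  ('X - w%:P) ^+ 2 %| p -> ram f.
Proof.
move=> cpq q0 Ef dw; exists (x + const w); first exact: moebius_add.
exact/(@van_shiftP _ 2 w _ _ _ cpq q0 Ef isT).
Qed.

Lemma rooted_rprod m P w : P \is monic -> size P = m.+2 -> root P w ->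
  exists c : 'I_m.+1 -> K, c ord0 = w /\ rprod c = P.
Proof.
move=> Pm sP rw; have [r Er] := closed_field_poly_normal P.
rewrite (monicP Pm) scale1r in Er.
have wr : w \in r by rewrite -root_prod_XsubC -Er.
have sr : size r = m.+1 by move: sP; rewrite Er size_prod_XsubC => -[].
exists (fun j => nth 0 (w :: rem w r) j); split=> //.
rewrite Er (perm_big _ (perm_to_rem wr)) (big_nth 0) big_mkord.
have -> : size (w :: rem w r) = m.+1 by rewrite /= size_rem // sr.
by [].
Qed.

Lemma coprimep_pencil p q (a b : K) : coprimep p q -> a != b ->
  coprimep (p - a *: q) (p - b *: q).
Proof.
move=> cpq ab; apply/Pdiv.ClosedField.coprimepP => w; rewrite /root !hornerD !hornerN !hornerZ => /eqP E1.
apply/negP => /eqP E2; have qw : q.[w] = 0.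
  have : (b - a) * q.[w] = 0 by rewrite -[RHS](subrr 0) -{1}E1 -E2; ring.
  by move/eqP; rewrite mulf_eq0 subr_eq0 eq_sym (negPf ab) => /eqP.
have pw : p.[w] = 0 by move: E1; rewrite qw mulr0 subr0.
by move/coprimep_root: cpq => /(_ w); rewrite /root pw qw eqxx => /(_ isT).
Qed.

Lemma coprimep_subl p q (a : K) : coprimep p q -> coprimep (p - a *: q) q.
Proof.
by move=> cpq; rewrite coprimep_sym addrC -mul_polyC -mulNr coprimep_addl_mul coprimep_sym.
Qed.

Lemma ratfrac_sub p q v : q != 0 -> p%:F / q%:F - const v = (p - v *: q)%:F / q%:F :> ratK.
Proof.
move=> q0; have qF : q%:F != 0 :> ratK by rewrite tofrac_eq0.
by rewrite -mul_polyC tofracB tofracM mulrBl (mulfK qF).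
Qed.

(** A pole is moved to infinity; it is simple because infinity is not a critical value, whence deg q
    = deg p - 1. *)
Lemma normalize_pole X m : is_ratfun X -> ratdeg X = m.+1 -> ~ ram X^-1 ->
  exists mu p q, [/\ is_moebius mu, coprimep p q, q != 0, ratcomp X mu = p%:F / q%:F &
    size p = m.+2 /\ size q = m.+1].
Proof.
move=> XR dX nr.
suff [mu [p [q [muM cpq q0 E [sp sq]]]]] : exists mu p q, [/\ is_moebius mu, coprimep p q, q != 0,
    ratcomp X mu = p%:F / q%:F & size p = m.+2 /\ (size q <= m.+1)%N].
  exists mu, p, q; split=> //; split=> //; apply/eqP; rewrite eqn_leq sq leqNgt; apply/negP => sq'.
  apply: nr; apply/(ram_moebius _ muM); exists x^-1; first exact: moebius_V.
  have muR := moebius_ratfun muM; rewrite (ratcompV muR) E invf_div.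
  have p0 : p != 0 by rewrite -size_poly_gt0 sp.
  have cqp : coprimep q p by rewrite coprimep_sym.
  apply/(@van_invP _ 2 _ _ _ cqp p0 q0 erefl isT).
  rewrite -(ratdegS cqp p0 erefl) leq_max sp; apply/orP; right.
  by rewrite addn2 !ltnS.
have [n [d [cnd d0 EX]]] := ratfracP X; have sm := ratdegS cnd d0 EX; rewrite dX in sm.
have [sd|sd] := boolP (size d == 1%N).
  exists x, n, d; rewrite ratcomp_varr; split=> //; first exact: moebius_var.
  by move/eqP: sd sm => ->; move: (size n); clear; lia.
have [w rw] : exists w, root d w by apply/closed_rootP.
pose mu := linfrac w 1 1 (0 : K).
have muM : is_moebius mu.
  by apply: moebius_linfrac; rewrite mulr0 mulr1 sub0r oppr_eq0 oner_neq0.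
have muR := moebius_ratfun muM.
have VR := moebius_ratfun (moebius_V K).
have muV : ratcomp mu x^-1 = x + const w.
  rewrite (ratcomp_linfrac _ _ _ _ VR).
  rewrite polyC0 polyC1 tofrac0 tofrac1 mul1r addr0 invrK mulrDl mul1r -mulrA mulVf ?mulr1 1?addrC //;
    exact: ratfun_neq0 (@ratfun_var K).
have [p [q [cpq q0 E]]] := ratfracP (ratcomp X mu).
have XmR : is_ratfun (ratcomp X mu) by exact: ratfun_comp.
have sp := ratdegS cpq q0 E; rewrite (ratdeg_comp XR muR) (proj2 muM) muln1 dX in sp.
exists mu, p, q; split=> //.
have n0 : n != 0.
  by apply/eqP => n0; have := ratfun_neq0 XR; rewrite EX n0 tofrac0 mul0r eqxx.
have p0 : p != 0.
  by apply/eqP => p0; have := ratfun_neq0 XmR; rewrite E p0 tofrac0 mul0r eqxx.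
have cqp : coprimep q p by rewrite coprimep_sym.
have cdn : coprimep d n by rewrite coprimep_sym.
have EV : ratcomp X^-1 mu = q%:F / p%:F by rewrite (ratcompV muR) E invf_div.
have EXV : X^-1 = d%:F / n%:F by rewrite EX invf_div.
have dV : ratdeg (ratcomp X^-1 mu) = m.+1.
  by apply/eqP; rewrite -eqSS -(ratdegS cqp p0 EV) maxnC sp.
have : (size q + 1 <= m.+2)%N.
  rewrite -dV; apply/(@van_invP _ 1 _ _ _ cqp p0 q0 EV isT).
  rewrite -(ratcompA _ muR VR) muV; apply/(@van_shiftP _ 1 w _ _ _ cdn n0 EXV isT).
  by rewrite expr1 dvdp_XsubCl.
by move: sp; move: (size p) (size q); clear; lia.
Qed.

(** An affine map keeps the pole at infinity and brings one point of each of the two fibres to 0 and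
    1; these points differ since t1 != t2. Scaling p and q together makes p monic. *)
Lemma normalize_values X m t1 t2 : is_ratfun X -> ratdeg X = m.+1 -> ~ ram X^-1 -> t1 != t2 ->
  exists mu p q, [/\ is_moebius mu, coprimep p q, ratcomp X mu = p%:F / q%:F &
    [/\ p \is monic, size p = m.+2, size q = m.+1, p.[0] = t1 * q.[0] & p.[1] = t2 * q.[1]]].
Proof.
move=> XR dX nr t12; have [mu1 [p [q [mu1M cpq q0 E1 [sp sq]]]]] := normalize_pole XR dX nr.
have spv v : size (p - v *: q) = m.+2.
  by rewrite size_polyDl // size_polyN sp ltnS (leq_trans (size_scale_leq _ _)) // sq.
have [al ral] : exists w, root (p - t1 *: q) w by apply/closed_rootP; rewrite spv.
have [be rbe] : exists w, root (p - t2 *: q) w by apply/closed_rootP; rewrite spv.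
have ab : be - al != 0.
  rewrite subr_eq0; apply/eqP => E; have := coprimep_pencil cpq t12.
  by move/coprimep_root => /(_ _ ral); rewrite -E -rootE rbe.
have mu2M : is_moebius (linfrac (be - al) al 0 1) by apply: moebius_linfrac; rewrite mulr1 mulr0 subr0.
pose l := (be - al) *: 'X + al%:P : {poly K}.
have sl : size l = 2%N.
  rewrite /l size_polyDl size_scale ?size_polyX // size_polyC.
  by case: (al != 0).
have mu2E : linfrac (be - al) al 0 1 = l%:F.
  by rewrite linfracE scale0r add0r polyC1 tofrac1 divr1.
have mu1R := moebius_ratfun mu1M; have mu2R := moebius_ratfun mu2M.
have lR : is_ratfun l%:F by rewrite -mu2E.
have rl r : ratsubst r l%:F = (r \Po l)%:F.
  elim/poly_ind: r => [|r e IH]; first by rewrite comp_poly0 tofrac0; exact: (rmorph0 (rsubst _)).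
  rewrite ratsubstD ratsubstM IH ratsubstC ratsubstX comp_polyD comp_polyM comp_polyX comp_polyC.
  rewrite [RHS]tofracD [X in _ = X + _]tofracM; reflexivity.
have spl : size (p \Po l) = m.+2 by rewrite size_comp_poly2 // sp.
have sql : size (q \Po l) = m.+1 by rewrite size_comp_poly2 // sq.
have l0 : l.[0] = al by rewrite /l hornerD hornerZ hornerX hornerC mulr0 add0r.
have l1 : l.[1] = be by rewrite /l hornerD hornerZ hornerX hornerC mulr1 subrK.
have lead0 : lead_coef (p \Po l) != 0 by rewrite lead_coef_eq0 -size_poly_gt0 spl.
set k := (lead_coef (p \Po l))^-1.
have k0 : k != 0 by rewrite invr_neq0.
exists (ratcomp mu1 (linfrac (be - al) al 0 1)), (k *: (p \Po l)), (k *: (q \Po l)).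
have H (r : {poly K}) w v : root (p - v *: q) w -> p.[w] = v * q.[w].
  by rewrite /root hornerD hornerN hornerZ subr_eq0 => /eqP.
split; first exact: moebius_comp.
- rewrite coprimepZl // coprimepZr //; apply/Pdiv.ClosedField.coprimepP => w.
  by rewrite /root !horner_comp => rw; move/coprimep_root: cpq => /(_ _ rw).
- rewrite (ratcompA X mu1R mu2R) E1 mu2E (ratcompE _ lR q0) !rl -!mul_polyC !tofracM.
  have kF : (k%:P)%:F != 0 :> ratK by rewrite const_eq0.
  exact: frac_scale.
split.
- by rewrite monicE lead_coefZ mulVf.
- by rewrite size_scale.
- by rewrite size_scale.
- by rewrite !hornerZ !horner_comp l0 (H 0 _ _ ral) mulrCA.
- by rewrite !hornerZ !horner_comp l1 (H 0 _ _ rbe) mulrCA.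
Qed.

(** The fibre over T_k is the set of roots of p - T_k q. A root of W is not a pole, the poles being
    simple, so it is a critical point and its value is some T_k. The values at 0 and 1 are not
    critical, so W does not vanish there. *)
Lemma configuration_exists X m t (T : 'I_t.+2 -> K) : is_ratfun X -> ratdeg X = m.+1 ->
  ~ ram X^-1 -> T ord0 != T ord_max ->
  ~ ram (X - const (T ord0)) -> ~ ram (X - const (T ord_max)) ->
  (forall v, ram (X - const v) -> exists k, T k = v) ->
  exists mu (cf : 'I_t.+2 -> 'I_m.+1 -> K), [/\ is_moebius mu, configuration T cf &
    let P0 := rprod (cf ord0) in let P1 := rprod (cf ord_max) in
    let q := (T ord_max - T ord0)^-1 *: (P0 - P1) in
    ratcomp X mu = (P0 + T ord0 *: q)%:F / q%:F].
Proof.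
move=> XR dX nr T01 n0 n1 full.
have [mu [p [q [muM cpq E [pm sp sq p0 p1]]]]] := normalize_values XR dX nr T01.
have muR := moebius_ratfun muM.
have q0 : q != 0 by rewrite -size_poly_gt0 sq.
have ramE v w : ('X - w%:P) ^+ 2 %| p - v *: q -> ram (X - const v).
  move=> dw; apply/(ram_moebius _ muM).
  apply: (ram_double (coprimep_subl v cpq) q0 _ dw).
  by rewrite (ratcompB muR) (ratcompC muR) E ratfrac_sub.
have ramV w : ~ ('X - w%:P) ^+ 2 %| q.
  move=> dw; apply: nr; apply/(ram_moebius _ muM).
  have cqp : coprimep q p by rewrite coprimep_sym.
  apply: (ram_double cqp _ _ dw); first by rewrite -size_poly_gt0 sp.
  by rewrite (ratcompV muR) E invf_div.
pose P k := p - T k *: q.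
have sP k : size (P k) = m.+2.
  by rewrite /P size_polyDl // size_polyN sp ltnS (leq_trans (size_scale_leq _ _)) // sq.
have mP k : P k \is monic.
  rewrite monicE lead_coefDl ?(monicP pm) // size_polyN sp ltnS.
  by rewrite (leq_trans (size_scale_leq _ _)) // sq.
have root_k k : exists w, root (P k) w /\ (k = ord0 -> w = 0) /\ (k = ord_max -> w = 1).
  have [->|k0] := eqVneq k ord0.
    exists 0; split; first by rewrite /root /P hornerD hornerN hornerZ p0 subrr.
    by split=> // e; move: T01; rewrite -e eqxx.
  have [->|k1] := eqVneq k ord_max.
    exists 1; split; first by rewrite /root /P hornerD hornerN hornerZ p1 subrr.
    by split=> // e; move: T01; rewrite -e eqxx.
  have [w rw] : exists w, root (P k) w by apply/closed_rootP; rewrite sP.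
  by exists w; split=> //; split=> e; [move: k0|move: k1]; rewrite e eqxx.
have /choice [cf cfP] : forall k, exists c : 'I_m.+1 -> K,
    rprod c = P k /\ (k = ord0 -> c ord0 = 0) /\ (k = ord_max -> c ord0 = 1).
  move=> k; have [w [rw [w0 w1]]] := root_k k.
  by have [c [cw rc]] := rooted_rprod (mP k) (sP k) rw; exists c; rewrite rc cw.
have rE k : rprod (cf k) = P k by case: (cfP k).
have d0 : T ord_max - T ord0 != 0 by rewrite subr_eq0 eq_sym.
have qE : P ord0 - P ord_max = (T ord_max - T ord0) *: q.
  by rewrite /P -!mul_polyC polyCB; ring.
pose W := (P ord0)^`() * P ord_max - P ord0 * (P ord_max)^`().
have WE : W = (T ord0 - T ord_max) *: (p^`() * q - p * q^`()).
  by rewrite /W /P !derivB !derivZ -!mul_polyC polyCB; ring.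
have Wroot w : root W w -> exists v, ram (X - const v) /\ p.[w] = v * q.[w].
  rewrite WE rootZ; last by rewrite subr_eq0.
  move=> rw; have qw : q.[w] != 0.
    apply/negP => /eqP qw; have pw : p.[w] != 0.
      have cqp : coprimep q p by rewrite coprimep_sym.
      by move/coprimep_root: cqp; apply; apply/rootP.
    apply: (ramV w); apply: double_root; first exact/rootP.
    move: rw; rewrite /root hornerD hornerN !hornerM qw mulr0 add0r oppr_eq0 mulf_eq0 (negPf pw).
    by [].
  exists (p.[w] / q.[w]); split; last by rewrite divfK.
  apply: (ramE _ w); apply: double_root.
    by rewrite /root hornerD hornerN hornerZ divfK // subrr.
  rewrite /root derivB derivZ hornerD hornerN hornerZ subr_eq0.
  move: rw; rewrite /root hornerD hornerN !hornerM subr_eq0 => /eqP e.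
  by apply/eqP; apply: (mulIf qw); rewrite e mulrAC divfK.
have nW (t0 : K) w : p.[w] = t0 * q.[w] -> ~ ram (X - const t0) -> ~~ root W w.
  move=> pw nt; apply/negP => /Wroot [v [rv e]].
  have qw : q.[w] != 0.
    apply/negP => /eqP qw; have cqp : coprimep q p by rewrite coprimep_sym.
    move/coprimep_root: cqp => /(_ w); rewrite /root qw eqxx => /(_ isT).
    by rewrite pw qw mulr0 eqxx.
  by apply: nt; have <- : v = t0 by apply: (mulIf qw); rewrite -e.
exists mu, cf; split=> //; last first.
  have e : (T ord_max - T ord0)^-1 *: (P ord0 - P ord_max) = q.
    by rewrite qE scalerA mulVf // scale1r.
  rewrite /= !rE e E; congr (tofrac _ / _).
  by rewrite /P subrK.
split; rewrite ?rE.
- by move=> k; rewrite rE /P -!mul_polyC !polyCB; ring.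
- by split; [apply: (proj1 (proj2 (cfP _)))|apply: (proj2 (proj2 (cfP _)))].
- exact: coprimep_pencil.
- by rewrite qE size_scale.
split; last by split; [exact: nW p0 n0|exact: nW p1 n1].
move=> w /Wroot [v [/full [k kE] e]]; exists k.
by rewrite rE /P /root hornerD hornerN hornerZ kE e subrr.
Qed.

Definition precomp_equiv (X Y : ratK) := exists2 mu, is_moebius mu & X = ratcomp Y mu.

Lemma precomp_refl X : precomp_equiv X X.
Proof. by exists x; [exact: moebius_var | rewrite ratcomp_varr]. Qed.

Lemma precomp_sym X Y : precomp_equiv X Y -> precomp_equiv Y X.
Proof.
case=> mu muM ->; have [nu [nuM munu _]] := moebius_inv muM; exists nu => //.
by rewrite -(ratcompA Y (moebius_ratfun muM) (moebius_ratfun nuM)) munu ratcomp_varr.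
Qed.

Lemma precomp_trans X Y Z : precomp_equiv X Y -> precomp_equiv Y Z -> precomp_equiv X Z.
Proof.
case=> mu muM -> [nu nuM ->]; exists (ratcomp nu mu); first exact: moebius_comp.
by rewrite (ratcompA Z (moebius_ratfun nuM) (moebius_ratfun muM)).
Qed.

Lemma ram_values C : is_ratfun C -> exists s : seq K,
  [/\ uniq s, (size s <= 2 * ratdeg C)%N & forall v, ram (C - const v) -> v \in s].
Proof.
move=> CR; have [||s us Ps _|s [us Ps cov]] :=
    @maximal_family K (fun v => ram (C - const v)) eq (2 * ratdeg C).
- by [].
- by move=> ? ? ->.
- exact: ram_count.
by exists s; split=> // [|v /cov [w ws ->]] //; exact: ram_count.
Qed.

Lemma fresh_element (s : seq K) : exists v, v \notin s.
Proof.
have P0 : \prod_(v <- s) ('X - v%:P) != 0 by rewrite monic_neq0 // monic_prod_XsubC.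
by have [v] := closed_nonrootP _ P0; rewrite root_prod_XsubC; exists v.
Qed.

(** Quantifying over the Moebius maps [s] on the left treats infinity like any other critical value.
    After a common change of coordinate in the target, every X yields a configuration, which
    determines X up to precomposition. *)
Lemma ram_family_bound D m : exists bound, forall C : ratK, is_ratfun C -> (ratdeg C <= D)%N ->
  forall Xs : seq ratK, uniq Xs ->
  (forall X, X \in Xs -> [/\ is_ratfun X, ratdeg X = m.+1 &
      forall s, is_moebius s -> ram (ratcomp s X) -> ram (ratcomp s C)]) ->
  {in Xs &, forall X Y, precomp_equiv X Y -> X = Y} -> (size Xs <= bound)%N.
Proof.
have /choice [b bP] := fun t => @configuration_count K t m.
(* The number of critical values is only known to be at most 2 D, so the bounds for all these
   numbers are added. *)
exists (\sum_(t < (2 * D).+1) b t)%N => C CR dC Xs uXs XsP inj.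
have [sC [_ _ sCP]] := ram_values CR.
have [e eC] := fresh_element sC.
have nC : ~ ram (C - const e) by move=> /sCP; rewrite (negPf eC).
(* 1 / (z - e) puts the noncritical value e at infinity. *)
pose s0 := linfrac 0 1 1 (- e).
have s0M : is_moebius s0 by apply: moebius_linfrac; rewrite mul0r sub0r mulr1 oppr_eq0 oner_neq0.
have s0R := moebius_ratfun s0M.
have s0E (Y : ratK) : is_ratfun Y -> ratcomp s0 Y = (Y - const e)^-1.
  move=> YR; rewrite (ratcomp_linfrac _ _ _ _ YR).
  by rewrite polyC0 polyC1 polyCN tofrac0 tofrac1 tofracN mul0r add0r !mul1r.
have CR' : is_ratfun (ratcomp s0 C) by exact: ratfun_comp.
have [s [us ss sP]] := ram_values CR'.
have dC' : ratdeg (ratcomp s0 C) = ratdeg C by rewrite (ratdeg_comp s0R CR) (proj2 s0M) mul1n.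
have [t1 t1s] := fresh_element s; have [t2 t2s] := fresh_element (t1 :: s).
(* The two end values are not critical and serve to fix the points 0 and 1; the critical values
   stand between them. *)
pose T (i : 'I_(size s).+2) := nth 0 (t1 :: rcons s t2) i.
have T0 : T ord0 = t1 by [].
have T1 : T ord_max = t2 by rewrite /T /= nth_rcons ltnn eqxx.
have T01 : T ord0 != T ord_max by rewrite T0 T1 eq_sym; move: t2s; rewrite inE negb_or => /andP [].
have Tfull v : v \in s -> exists k, T k = v.
  move=> vs; have lt : (index v s < (size s).+1)%N by rewrite ltnS ltnW // index_mem.
  exists (Ordinal (n := (size s).+2) (m := (index v s).+1) lt).
  by rewrite /T /= nth_rcons index_mem vs nth_index.
pose good X (cf : {ffun 'I_(size s).+2 * 'I_m.+1 -> K}) := exists mu : ratK,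
   [/\ is_moebius mu, configuration T (fun k j => cf (k, j)) &
    let P0 := rprod (fun j => cf (ord0, j)) in let P1 := rprod (fun j => cf (ord_max, j)) in
    let q := (T ord_max - T ord0)^-1 *: (P0 - P1) in
    ratcomp (ratcomp s0 X) mu = (P0 + T ord0 *: q)%:F / q%:F].
have ex X : X \in Xs -> exists cf, good X cf.
  move=> /XsP [XR dX rX].
  have XR' : is_ratfun (ratcomp s0 X) by exact: ratfun_comp.
  have dX' : ratdeg (ratcomp s0 X) = m.+1 by rewrite (ratdeg_comp s0R XR) (proj2 s0M) mul1n.
  have rX' v : ram (ratcomp s0 X - const v) -> v \in s.
    move=> rv; apply: sP; move: rv; rewrite (subr_const_comp v XR') (subr_const_comp v CR').
    have aM := moebius_add (- v); have aR := moebius_ratfun aM.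
    rewrite (ratcompA _ s0R XR) (ratcompA _ s0R CR); apply: rX; exact: moebius_comp.
  have nr : ~ ram (ratcomp s0 X)^-1.
    rewrite (s0E _ XR) invrK (subr_const_comp e XR) => rv; apply: nC.
    rewrite (subr_const_comp e CR); exact: rX (moebius_add _) rv.
  have [||v /rX' /Tfull //|mu [cf [muM cfC E]]] := configuration_exists XR' dX' nr T01.
  - by rewrite T0 => /rX'; rewrite (negPf t1s).
  - by rewrite T1 => /rX' h; move: t2s; rewrite inE h orbT.
  exists [ffun kj => cf kj.1 kj.2], mu.
  have rE k : rprod (fun j => [ffun kj => cf kj.1 kj.2] (k, j)) = rprod (cf k).
    by apply: eq_bigr => j _; rewrite ffunE.
  split=> //; last by rewrite /= !rE.
  case: cfC => h1 h2 h3 h4 h5; split; rewrite ?rE ?ffunE //.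
    by move=> k; rewrite !rE.
  split; last by case: h5.
  by move=> w /(proj1 h5) [k rk]; exists k; rewrite rE.
have /choice [cfX cfXP] : forall X, exists cf, X \in Xs -> good X cf.
  by move=> X; have [/ex [cf]|nX] := boolP (X \in Xs); [exists cf|exists [ffun=> 0]].
have cf_inj : {in Xs &, injective cfX}.
  move=> X Y hX hY E; apply: inj => //.
  have [mu [muM _ EX]] := cfXP X hX; have [nu [nuM _ EY]] := cfXP Y hY.
  have muR := moebius_ratfun muM; have nuR := moebius_ratfun nuM.
  have XR : is_ratfun X by case: (XsP X hX). have YR : is_ratfun Y by case: (XsP Y hY).
  apply: (precomp_trans (Y := ratcomp Y nu)); last by exists nu.
  have [i0 [i0M _ i0s]] := moebius_inv s0M; have i0R := moebius_ratfun i0M.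
  apply: (precomp_trans (Y := ratcomp X mu)); first by apply: precomp_sym; exists mu.
  suff -> : ratcomp X mu = ratcomp Y nu by exact: precomp_refl.
  have E2 : ratcomp s0 (ratcomp X mu) = ratcomp s0 (ratcomp Y nu).
    by rewrite (ratcompA _ XR muR) (ratcompA _ YR nuR) EX EY E.
  have XmR := ratfun_comp XR muR; have YnR := ratfun_comp YR nuR.
  by rewrite -(ratcomp_varl XmR) -(ratcomp_varl YnR) -i0s -!ratcompA // E2.
rewrite -(size_map cfX); apply: leq_trans (_ : (b (size s) <= _)%N).
  apply: (bP (size s) T T01); first by rewrite map_inj_in_uniq.
  by move=> cf /mapP [X hX ->]; case: (cfXP X hX) => mu [].
have lt : (size s < (2 * D).+1)%N.
  by rewrite ltnS (leq_trans ss) // dC' leq_mul2l.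
by rewrite (bigD1 (Ordinal lt)) //= leq_addr.
Qed.

End Normalization.

(** Makes the degree of A^(2m) large enough for [square_ram]. *)
Lemma leq_expn4 n m : (1 < n)%N -> (0 < m)%N -> (2 * m + 2 <= n ^ (2 * m))%N.
Proof.
move=> n1; elim: m => // -[|m] IH _.
  by have : (2 ^ 2 <= n ^ 2)%N by rewrite leq_exp2r.
have := IH isT; rewrite [(2 * m.+2)%N]mulnS [(n ^ (2 + _))%N]expnD => h.
apply: leq_trans (_ : (2 ^ 2 * (2 * m.+1 + 2) <= _)%N); first by clear; lia.
by apply: leq_mul => //; rewrite leq_exp2r.
Qed.

(** * The chain of stages *)

Section Chain.
Variable K : numClosedFieldType.
Local Notation ratK := {fraction {poly K}}.
Local Notation x := (ratvar K).

Lemma ram_has_zero (g : ratK) : is_ratfun g -> exists mu, is_moebius mu /\ van 1 (ratcomp g mu).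
Proof.
move=> gR; have [p [q [cpq q0 Eg]]] := ratfracP g.
have p0 : p != 0.
  by apply/eqP => p0; have := ratfun_neq0 gR; rewrite Eg p0 tofrac0 mul0r eqxx.
have [sp|] := boolP (size p == 1%N).
  exists x^-1; split; first exact: moebius_V.
  apply/(@van_invP _ 1 _ _ _ cpq q0 p0 Eg isT); rewrite (eqP sp) addn1 ltnS.
  exact/ratfun_deg.
case/closed_rootP => w rw; exists (x + tofrac w%:P); split; first exact: moebius_add.
by apply/(@van_shiftP _ 1 w _ _ _ cpq q0 Eg isT); rewrite expr1 dvdp_XsubCl.
Qed.

(** [g], being onto, reaches the point where [f] is ramified over 0, and f o g is ramified there
    too. *)
Lemma ram_comp (f g : ratK) : is_ratfun g -> ram f -> ram (ratcomp f g).
Proof.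
move=> gR [mu muM fm]; have muR := moebius_ratfun muM.
have [nu [nuM munu _]] := moebius_inv muM; have nuR := moebius_ratfun nuM.
have ngR := ratfun_comp nuR gR.
have [eta [etaM vg]] := ram_has_zero ngR; have etaR := moebius_ratfun etaM.
exists eta => //; have ngeR := ratfun_comp ngR etaR.
have -> : ratcomp (ratcomp f g) eta = ratcomp (ratcomp f mu) (ratcomp (ratcomp nu g) eta).
  rewrite -(ratcompA f muR ngeR) (ratcompA mu ngR etaR) (ratcompA mu nuR gR) munu.
  by rewrite (ratcomp_varl gR) (ratcompA f gR etaR).
exact: van_comp.
Qed.

Section Bound.
Variable fam : nat -> nat -> nat.
Hypothesis famP : forall D m (C : ratK), is_ratfun C -> (ratdeg C <= D)%N ->
  forall Xs : seq ratK, uniq Xs ->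
  (forall X, X \in Xs -> [/\ is_ratfun X, ratdeg X = m.+1 &
      forall s, is_moebius s -> ram (ratcomp s X) -> ram (ratcomp s C)]) ->
  {in Xs &, forall X Y, precomp_equiv X Y -> X = Y} -> (size Xs <= fam D m)%N.

(* On a run of constant degree m, the first stages, followed by 2m further ones, are inequivalent
   and have their critical values among those of A^(2m). *)
Definition drop_length n m := (2 * m + fam (n ^ (2 * m)) m.-1)%N.

Section Stage.
Variables (A Q : ratK) (AR : is_ratfun A) (QR : is_ratfun Q) (d : nat).
Local Notation stage := (stage Q AR d).

Lemma stage_deg_le k l X R Y S : (k <= l)%N -> (l <= d)%N -> stage k X R -> stage l Y S ->
  (ratdeg Y <= ratdeg X)%N.
Proof.
move=> kl ld sk sl; have [C [YR [CR _ E g]]] := stage_square kl ld sk sl.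
have [XR _ _ _ _] := sk; exact: square_deg_le (ratfun_iter AR) XR CR E g.
Qed.

Lemma stage_deg_gt1 k X R : stage k X R -> (1 < ratdeg X)%N -> (1 < ratdeg A)%N.
Proof.
case=> XR RR E _ _ d1; rewrite ltnNge; apply/negP => dA.
have A1 : ratdeg A = 1%N by apply/eqP; rewrite eqn_leq dA; apply/ratfun_deg.
have := ratdeg_iter (d - k) AR; rewrite A1 exp1n E ratdeg_comp // => /eqP.
by rewrite muln_eq1 => /andP [/eqP e _]; rewrite e in d1.
Qed.

(* If X_i and X_j were equivalent, [square_deg_rigid] would apply to the squares of height
   b + 1 - j starting at these stages: the one at j drops the degree, the one at i does not. *)
Lemma stage_inequiv k b (Xf Rf : nat -> ratK) m : (forall i, stage i (Xf i) (Rf i)) ->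
  (forall i, (k <= i <= b)%N -> ratdeg (Xf i) = m) -> (b < d)%N -> ratdeg (Xf b.+1) != m ->
  forall i j, (k <= i)%N -> (i < j)%N -> (j <= b)%N -> ~ precomp_equiv (Xf i) (Xf j).
Proof.
move=> st dm bd nb i j ki ij jb [mu muM E].
pose de := (b.+1 - j)%N.
have idb : (i + de <= b)%N by rewrite /de; move: ij jb; clear; lia.
have [C [YR [CR _ EC gC]]] := stage_square (leq_trans jb (leqnSn b)) bd (st j) (st b.+1).
have [C' [YR' [CR' _ EC' gC']]] := stage_square (leq_addr de i) (leq_trans idb (ltnW bd)) (st i) (st (i + de)%N).
rewrite addKn -/de in EC EC'.
have muR := moebius_ratfun muM; have [nu [nuM _ numu]] := moebius_inv muM.
have mCR := ratfun_comp muR CR'.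
have [XjR _ _ _ _] := st j.
have EC2 : ratcomp (Xf j) (ratcomp mu C') = ratcomp (ratiter A de) (Xf (i + de)%N).
  by rewrite (ratcompA _ muR CR') -E EC'.
have g2 : gen YR' (ratcomp mu C') x.
  apply: (gen_sub (genF _ _) _ gC').
  have := gen_ratcomp nu mCR (genG YR' (ratcomp mu C')).
  by rewrite (ratcompA nu muR CR') numu (ratcomp_varl CR').
have dj : ratdeg (Xf j) = m by apply: dm; rewrite (leq_trans ki (ltnW ij)).
have dd : ratdeg (Xf (i + de)%N) = ratdeg (Xf j).
  by rewrite dj; apply: dm; rewrite (leq_trans ki (leq_addr _ _)).
have := square_deg_rigid (ratfun_iter (d := de) AR) XjR CR mCR EC gC EC2 g2 dd.
by rewrite dj; apply/eqP.
Qed.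

Lemma stage_drop k X R : (k <= d)%N -> stage k X R -> (1 < ratdeg X)%N ->
  exists l Y S, [/\ (l <= d)%N, (l <= k + drop_length (ratdeg A) (ratdeg X))%N,
    stage l Y S & (ratdeg Y < ratdeg X)%N].
Proof.
move=> kd sX dX; apply: contrapT => no.
have A1 := stage_deg_gt1 sX dX.
set m := ratdeg X in dX no *; set len := drop_length _ _ in no.
have [XR0 [Rf st0]] : exists Xf Rf : nat -> ratK, forall i, stage i (Xf i) (Rf i).
  have /choice [f fP] := fun i => stage_exists AR QR d i.
  by exists (fun i => (f i).1), (fun i => (f i).2).
move: XR0 st0 => Xf st.
have eqm i : (k <= i)%N -> (i <= d)%N -> (i <= k + len)%N -> ratdeg (Xf i) = m.
  move=> ki id ilen; apply/eqP; rewrite eqn_leq (stage_deg_le ki id sX (st i)) leqNgt.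
  by apply/negP => lt; apply: no; exists i, (Xf i), (Rf i).
have dd : ratdeg (Xf d) = 1%N := stage_last (st d).
have klen : (k + len < d)%N.
  rewrite ltnNge; apply/negP => h; have := eqm d kd (leqnn d) h.
  by rewrite dd => e; rewrite -e in dX.
pose P i := (i <= d)%N && (ratdeg (Xf i) == m).
have Pex : exists i, P i.
  by exists (k + len)%N; rewrite /P (ltnW klen) (eqm _ (leq_addr _ _) (ltnW klen) (leqnn _)) /=.
have Pd i : P i -> (i <= d)%N by case/andP.
(* b is the last stage of degree m, possibly far beyond k + len; the drop right after it is what
   makes the earlier stages inequivalent. *)
case: (ex_maxnP Pex Pd) => b /andP [bd /eqP db] bmax.
have lenb : (k + len <= b)%N.
  by apply: bmax; rewrite /P (ltnW klen) (eqm _ (leq_addr _ _) (ltnW klen) (leqnn _)) /=.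
have {}bd : (b < d)%N.
  by rewrite ltn_neqAle bd andbT; apply: contraTneq dX => e; rewrite -db e dd.
have nb : ratdeg (Xf b.+1) != m.
  by apply/negP => e; have := bmax b.+1; rewrite /P bd e ltnn => /(_ isT).
have dm i : (k <= i <= b)%N -> ratdeg (Xf i) = m.
  case/andP => ki ib; apply/eqP; rewrite eqn_leq -{2}db.
  rewrite (stage_deg_le ib (ltnW bd) (st i) (st b)) andbT.
  by have := stage_deg_le ki (leq_trans ib (ltnW bd)) sX (st i).
have ineq := stage_inequiv st dm bd nb.
pose B := fam (ratdeg A ^ (2 * m)) m.-1.
have elen : len = (2 * m + B)%N by [].
have idx i : (i <= B)%N -> (k + i + 2 * m <= b)%N.
  by move=> iB; apply: leq_trans lenb; rewrite elen; move: iB; clear; lia.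
have eqv_eq i j : (i <= B)%N -> (j <= B)%N -> precomp_equiv (Xf (k + i)%N) (Xf (k + j)%N) -> i = j.
  move=> iB jB e; have ib := leq_trans (leq_addr _ _) (idx i iB); have jb := leq_trans (leq_addr _ _) (idx j jB).
  case: (ltngtP i j) => // h.
    by case: (ineq (k + i)%N (k + j)%N) => //; rewrite ?leq_addr // ltn_add2l.
  by case: (ineq (k + j)%N (k + i)%N) => //; rewrite ?leq_addr // ?ltn_add2l //; exact: precomp_sym.
(* The B + 1 stages k, .., k + B, each followed by 2m stages of the same degree, exceed the bound
   B. *)
have := @famP (ratdeg A ^ (2 * m)) m.-1 (ratiter A (2 * m)) (ratfun_iter AR) _
  [seq Xf (k + i)%N | i <- iota 0 B.+1].
rewrite (ratdeg_iter _ AR) => /(_ (leqnn _)).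
rewrite size_map size_iota -/B ltnn => H; suff : false by []; apply: H.
- rewrite map_inj_in_uniq ?iota_uniq // => i j.
  rewrite !mem_iota !add0n !ltnS => /andP [_ iB] /andP [_ jB] e.
  by apply: eqv_eq => //; rewrite e; exact: precomp_refl.
- move=> Y /mapP [] i; rewrite mem_iota add0n ltnS => /andP [_ iB] ->.
  have ib := idx i iB; have ib' := leq_trans (leq_addr _ _) ib.
  have [YR _ _ _ _] := st (k + i)%N.
  have dY : ratdeg (Xf (k + i)%N) = m by apply: dm; rewrite leq_addr.
  split=> //; first by rewrite dY prednK // ltnW.
  move=> s sM; have sR := moebius_ratfun sM.
  have [C [ZR [CR _ E g]]] := stage_square (leq_addr (2 * m) (k + i)) (leq_trans ib (ltnW bd))
     (st (k + i)%N) (st (k + i + 2 * m)%N).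
  rewrite addKn in E; have IR : is_ratfun (ratiter A (2 * m)) by exact: ratfun_iter.
  have sYR := ratfun_comp sR YR; have sIR := ratfun_comp sR IR.
  have dsY : ratdeg (ratcomp s (Xf (k + i)%N)) = m by rewrite (ratdeg_comp sR YR) (proj2 sM) mul1n.
  apply: (square_ram (YR := ZR) sIR sYR CR _ g).
  + by rewrite -(ratcompA _ YR CR) E (ratcompA _ IR ZR).
  + rewrite dsY; apply: dm; rewrite ib andbT.
    by rewrite -addnA leq_addr.
  rewrite dsY (ratdeg_comp sR IR) (proj2 sM) mul1n (ratdeg_iter _ AR).
  by apply: leq_expn4 => //; exact: ltnW.
move=> Y Z /mapP [] i; rewrite mem_iota add0n ltnS => /andP [_ iB] ->.
move=> /mapP [j]; rewrite mem_iota add0n ltnS => /andP [_ jB] -> e.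
by rewrite (eqv_eq i j).
Qed.

(** Each degree i from 2 to m is left within [drop_length n i] stages. *)
Definition chain_bound n m := (\sum_(i < m.+1) drop_length n i)%N.

Lemma stage_deg1 m k X R : (k <= d)%N -> stage k X R -> (ratdeg X <= m)%N ->
  exists l Y S, [/\ (l <= d)%N, (l <= k + chain_bound (ratdeg A) m)%N, stage l Y S & ratdeg Y = 1%N].
Proof.
elim: m k X R => [|m IH] k X R kd sX dX.
  have [XR _ _ _ _] := sX; have := proj1 (ratfun_deg X) XR; by rewrite ltnNge dX.
have cb : chain_bound (ratdeg A) m.+1 = (chain_bound (ratdeg A) m + drop_length (ratdeg A) m.+1)%N.
  by rewrite /chain_bound big_ord_recr.
have [dXm|dXm] := leqP (ratdeg X) m.
  have [l [Y [S [ld lk sY dY]]]] := IH k X R kd sX dXm; exists l, Y, S; split=> //.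
  by apply: leq_trans lk _; rewrite cb addnA leq_addr.
have dXE : ratdeg X = m.+1 by apply/eqP; rewrite eqn_leq dX.
have [X1|X1] := leqP (ratdeg X) 1.
  exists k, X, R; split=> //; first exact: leq_addr.
  by apply/eqP; rewrite eqn_leq X1; have [XR _ _ _ _] := sX; apply/ratfun_deg.
have [l [Y [S [ld lk sY dY]]]] := stage_drop kd sX X1.
have dYm : (ratdeg Y <= m)%N by rewrite -ltnS -dXE.
have [l' [Y' [S' [ld' lk' sY' dY']]]] := IH l Y S ld sY dYm.
exists l', Y', S'; split=> //; apply: leq_trans lk' _; rewrite cb -dXE.
by move: lk; move: (drop_length _ _) (chain_bound _ _); clear; lia.
Qed.

End Stage.

Lemma factorization_bound (A X Q : ratK) d : is_ratfun A -> is_ratfun X -> is_ratfun Q -> (1 <= d)%N ->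
  ratiter A d = ratcomp X Q ->
  exists N Q', [/\ (1 <= N)%N, (N <= (chain_bound (ratdeg A) (ratdeg X)).+1)%N, is_ratfun Q',
    ratiter A N = ratcomp X Q' & (N < d)%N -> Q = ratcomp Q' (ratiter A (d - N))].
Proof.
move=> AR XR QR d1 E; have s0 := stage_first AR QR XR E.
have [l [Y [S [ld lk sY dY]]]] := stage_deg1 QR (leq0n d) s0 (leqnn _).
have [N [N1 Nd NB [Y' [S' [sY' dY']]]]] : exists N, [/\ (1 <= N)%N, (N <= d)%N,
    (N <= (chain_bound (ratdeg A) (ratdeg X)).+1)%N &
    exists Y' S', stage Q AR d N Y' S' /\ ratdeg Y' = 1%N].
  (* If X already has degree 1, stage 1 replaces stage 0 so that N >= 1; its degree cannot be
     larger. This accounts for the successor in the bound. *)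
  case: l ld lk sY => [|l] ld lk sY; last by exists l.+1; split=> //; [exact: leqW|exists Y, S].
  exists 1%N; split=> //; have [[Y' S'] /= sY'] := stage_exists AR QR d 1.
  exists Y', S'; split=> //; apply/eqP; rewrite eqn_leq -{1}dY (stage_deg_le (leq0n 1) d1 sY sY') /=.
  by have [YR' _ _ _ _] := sY'; apply/ratfun_deg.
have [Q' [Q'R E' EQ]] := stage_conclude QR XR E Nd sY' dY'.
by exists N, Q'; split.
Qed.

End Bound.
End Chain.

Lemma ram_family_bounds (K : numClosedFieldType) : exists fam : nat -> nat -> nat,
  forall D m (C : {fraction {poly K}}), is_ratfun C -> (ratdeg C <= D)%N ->
  forall Xs : seq {fraction {poly K}}, uniq Xs ->
  (forall X, X \in Xs -> [/\ is_ratfun X, ratdeg X = m.+1 &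
      forall s, is_moebius s -> ram (ratcomp s X) -> ram (ratcomp s C)]) ->
  {in Xs &, forall X Y, precomp_equiv X Y -> X = Y} -> (size Xs <= fam D m)%N.
Proof.
have /choice [fam famP] : forall D, exists fD, forall m (C : {fraction {poly K}}), is_ratfun C ->
  (ratdeg C <= D)%N -> forall Xs : seq {fraction {poly K}}, uniq Xs ->
  (forall X, X \in Xs -> [/\ is_ratfun X, ratdeg X = m.+1 &
      forall s, is_moebius s -> ram (ratcomp s X) -> ram (ratcomp s C)]) ->
  {in Xs &, forall X Y, precomp_equiv X Y -> X = Y} -> (size Xs <= fD m)%N.
  by move=> D; have /choice [fD fDP] := fun m => @ram_family_bound K D m; exists fD.
by exists fam.
Qed.

Theorem theorem1p4 (R : realType) :
  (exists phi : nat -> nat -> R,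
     forall A X : {fraction {poly R[i]}}, is_ratfun A -> is_ratfun X ->
     forall (Q : {fraction {poly R[i]}}) (d : nat), is_ratfun Q -> (1 <= d)%N ->
       ratiter A d = ratcomp X Q ->
       exists (N : nat) (Q' : {fraction {poly R[i]}}),
         [/\ (1 <= N)%N, N%:R <= phi (ratdeg A) (ratdeg X), is_ratfun Q',
             ratiter A N = ratcomp X Q'
           & (N < d)%N -> Q = ratcomp Q' (ratiter A (d - N))]) /\
  (forall (A : {fraction {poly R[i]}}) (n : nat), is_ratfun A -> (1 <= n)%N ->
     exists s : seq {fraction {poly R[i]}},
       forall X : {fraction {poly R[i]}}, is_ratfun X -> ratdeg X = n ->
         (exists (Q : {fraction {poly R[i]}}) (d : nat),
            [/\ is_ratfun Q, (1 <= d)%N & ratiter A d = ratcomp X Q]) ->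
         exists Y mu : {fraction {poly R[i]}},
           [/\ Y \in s, is_moebius mu & X = ratcomp Y mu]).
Proof.
have [fam famP] := ram_family_bounds R[i].
split.
  exists (fun n m => ((chain_bound fam n m).+1)%:R) => A X AR XR Q d QR d1 E.
  have [N [Q' [N1 NB Q'R EN EQ]]] := factorization_bound famP AR XR QR d1 E.
  by exists N, Q'; split=> //; rewrite ler_nat.
move=> A n AR n1.
(* For this exponent M, all the X considered are left factors of the same function: A^M = A^N o
   A^(M-N) = X o R' o A^(M-N). *)
pose F := ratiter A (chain_bound fam (ratdeg A) n).+1.
have FR : is_ratfun F by exact: ratfun_iter.
pose P (X : {fraction {poly R[i]}}) := [/\ is_ratfun X, ratdeg X = n &
  exists (Q : {fraction {poly R[i]}}) (d : nat),
    [/\ is_ratfun Q, (1 <= d)%N & ratiter A d = ratcomp X Q]].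
have ramP X : P X -> forall s, is_moebius s -> ram (ratcomp s X) -> ram (ratcomp s F).
  case=> XR dX [Q [d [QR d1 E]]] s sM; have sR := moebius_ratfun sM.
  have [N [Q' [N1 NB Q'R EN _]]] := factorization_bound famP AR XR QR d1 E.
  rewrite dX in NB; set M := (chain_bound _ _ _).+1 in NB.
  have WR : is_ratfun (ratcomp Q' (ratiter A (M - N))).
    by apply: ratfun_comp => //; exact: ratfun_iter.
  have -> : F = ratcomp X (ratcomp Q' (ratiter A (M - N))).
    rewrite (ratcompA X Q'R (ratfun_iter (d := (M - N)%N) AR)) -EN -ratiterD //.
    by rewrite subnKC.
  by rewrite (ratcompA s XR WR); exact: ram_comp.
have [||s us Ps inj|s [us Ps cov]] :=
  @maximal_family _ P (@precomp_equiv _) (fam (ratdeg F) n.-1).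
- exact: precomp_refl.
- exact: precomp_sym.
- apply: (famP _ _ F FR (leqnn _) s us _ inj) => X /Ps PX.
  by split; [case: PX|rewrite prednK //; case: PX|exact: ramP].
exists s => X XR dX ex; have [//|Y Ys [mu muM E]] := cov X.
by exists Y, mu.
Qed.
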